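(* Let $k\in\{0,2\}$ and $u_0\in Z_k$, and consider the problem with $\delta=0$, $$u_t=\Delta^2(\Delta u-W'(u))\ \text{ in }\mathbb{T}\times(0,\infty),\qquad u(x,0)=u_0(x).$$ Then the $\omega$-limit set satisfies $\omega(u_0)=\{\phi\}$, where $\phi$ is a steady state of this equation. In other words, all solutions converge to a steady state as $t\to\infty$.
   Context: $L>0$, $\mathbb{T}=\mathbb{R}/L\mathbb{Z}$, $\Delta=\partial_x^2$, $W(v)=\frac14(v^2-1)^2$. $Z_0=\dot L^2$ is the space of zero-mean functions in $L^2(\mathbb{T})$ and $Z_2=\dot H^2_{per}$ the space of zero-mean functions in $H^2(\mathbb{T})$. The solution is the global solution generated by the analytic semigroup theory, given by $u(t)=e^{\Delta^3t}u_0-\int_0^te^{\Delta^3(t-s)}\Delta^2W'(u(s))\,ds$, continuous into $Z_k$ on $[0,\infty)$ and regular for $t>0$. $\omega(u_0)$ is the set of limits in $Z_k$ of $u(t_m)$ along sequences $t_m\to\infty$. A steady state is a zero-mean $L$-periodic $\phi$ with $\Delta^2(\Delta\phi-W'(\phi))=0$. *)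

(* Defs.v *)
From HB Require Import structures.
From mathcomp Require Import all_boot all_order all_algebra.
From mathcomp Require Import all_classical all_reals all_analysis.

Set Implicit Arguments.
Unset Strict Implicit.
Unset Printing Implicit Defensive.

Import Order.TTheory GRing.Theory Num.Theory.
Import numFieldNormedType.Exports.

Local Open Scope classical_set_scope.
Local Open Scope ring_scope.

(* Functions on the torus R / L Z are L-periodic functions on the line, and
   almost-everywhere equality is always left explicit. *)

(* Lebesgue measure of the torus, carried by the fundamental domain [0, L[ *)
Definition torus_measure (R : realType) (L : R) :
    {measure set (measurableTypeR R) -> \bar R} :=
  mrestr (@lebesgue_measure R) (measurable_itv `[0, L[).

Definition zero_mean (R : realType) (L : R) (f : R -> R) : Prop :=
  \int[torus_measure L]_x f x = 0.

Definition L2_torus (R : realType) (L : R) (f : R -> R) : Prop :=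
  periodic f L /\ f \in Lfun (torus_measure L) 2%:E.

Definition test_function (R : realType) (L : R) (psi : R -> R) : Prop :=
  periodic psi L /\ forall (j : nat) (x : R), derivable (derive1n j psi) x 1.

Definition is_weak_derivative (R : realType) (L : R) (j : nat)
    (f g : R -> R) : Prop :=
  forall psi : R -> R, test_function L psi ->
    \int[torus_measure L]_x (f x * derive1n j psi x) =
    (-1) ^+ j * \int[torus_measure L]_x (g x * psi x).

(* The j-th weak derivative in L^2 (unique up to a null set), or 0 if there is
   none. *)
Definition weak_derivative (R : realType) (L : R) (j : nat) (f : R -> R) :
    R -> R :=
  xget (cst 0) [set g | L2_torus L g /\ is_weak_derivative L j f g].

(* Z_k: zero-mean functions in H^k of the torus, with H^0 = L^2 *)
Definition Zspace (R : realType) (L : R) (k : nat) : set (R -> R) :=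
  [set f | [/\ L2_torus L f, zero_mean L f &
    forall j : nat, (j <= k)%N ->
      exists2 g : R -> R, L2_torus L g & is_weak_derivative L j f g]].

Definition Znorm (R : realType) (L : R) (k : nat) (f : R -> R) : R :=
  Num.sqrt (\sum_(j < k.+1)
    fine ('N[torus_measure L]_2%:E[EFin \o weak_derivative L j f])%E ^+ 2).

Definition W (R : realType) (v : R) : R := 4^-1 * (v ^+ 2 - 1) ^+ 2.

Definition laplacian (R : realType) (f : R -> R) : R -> R := derive1n 2 f.

(* The n-th eigenvalue of the Laplacian on the torus, and the orthogonal
   projection onto its eigenspace, which is spanned by cos (2 pi n x / L) and
   sin (2 pi n x / L). *)
Definition laplacian_eigenvalue (R : realType) (L : R) (n : nat) : R :=
  - (2 * pi * n%:R / L) ^+ 2.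

Definition eigenprojection (R : realType) (L : R) (n : nat) (g : R -> R)
    (x : R) : R :=
  (if n == 0%N then 1 else 2) / L *
  \int[torus_measure L]_y (g y * cos (2 * pi * n%:R / L * (x - y))).

(* Functional calculus: m (Laplacian) g, evaluated at x. *)
Definition laplacian_calculus (R : realType) (L : R) (m : R -> R)
    (g : R -> R) (x : R) : R :=
  \big[+%R/0]_(0 <= n <oo)
    (m (laplacian_eigenvalue L n) * eigenprojection L n g x).

(* exp (t Laplacian^3) and exp (t Laplacian^3) Laplacian^2. For t > 0 and g in
   L^1 the defining series converge absolutely; they are used only then. *)
Definition semigroup (R : realType) (L t : R) : (R -> R) -> R -> R :=
  laplacian_calculus L (fun z => expR (z ^+ 3 * t)).

Definition semigroup_bilaplacian (R : realType) (L t : R) :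
    (R -> R) -> R -> R :=
  laplacian_calculus L (fun z => expR (z ^+ 3 * t) * z ^+ 2).

(* [u t] is the state at time t; values at t < 0 are irrelevant. For t > 0,
   [u t] is the smooth representative, so that the Duhamel formula can be read
   at every point x. *)
Record is_solution (R : realType) (L : R) (k : nat) (u0 : R -> R)
    (u : R -> R -> R) : Prop := IsSolution {
  sol_space : forall t : R, 0 <= t -> Zspace L k (u t);
  sol_continuous : forall t0 : R, 0 <= t0 ->
    Znorm L k (fun x => u t x - u t0 x)
      @[t --> within `[0, +oo[ (nbhs t0)] --> (0 : R);
  sol_initial : u 0 = u0 %[ae torus_measure L];
  sol_integrable : forall t x : R, 0 < t ->
    (@lebesgue_measure R).-integrable `]0, t[
      (fun s => (semigroup_bilaplacian L (t - s)
                   (fun y => derive1 (@W R) (u s y)) x)%:E);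
  sol_mild : forall t x : R, 0 < t ->
    u t x = semigroup L t u0 x -
      \int[@lebesgue_measure R]_(s in `]0, t[)
        semigroup_bilaplacian L (t - s) (fun y => derive1 (@W R) (u s y)) x;
  sol_derivable_t : forall t x : R, 0 < t -> derivable (fun s => u s x) t 1;
  sol_continuous_t : forall t x : R, 0 < t ->
    {for (t, x), continuous
      (fun p : R * R => derive1 (fun s => u s p.2) p.1)};
  sol_derivable_x : forall (j : nat) (t x : R), (j < 6)%N -> 0 < t ->
    derivable (derive1n j (u t)) x 1;
  sol_continuous_x : forall (j : nat) (t x : R), (j <= 6)%N -> 0 < t ->
    {for (t, x), continuous (fun p : R * R => derive1n j (u p.1) p.2)};
  sol_equation : forall t x : R, 0 < t ->
    derive1 (fun s => u s x) t =
    laplacian (laplacian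
      (fun y => laplacian (u t) y - derive1 (@W R) (u t y))) x
}.

Definition omega_limit (R : realType) (L : R) (k : nat) (u : R -> R -> R) :
    set (R -> R) :=
  [set psi | Zspace L k psi /\
    exists tm : nat -> R, [/\ forall m, 0 <= tm m,
      tm m @[m --> \oo] --> +oo &
      Znorm L k (fun x => u (tm m) x - psi x) @[m --> \oo] --> (0 : R)]].

Definition steady_state (R : realType) (L : R) (phi : R -> R) : Prop :=
  [/\ periodic phi L, zero_mean L phi,
      forall (j : nat) (x : R), (j < 6)%N -> derivable (derive1n j phi) x 1 &
      forall x : R,
        laplacian (laplacian
          (fun y => laplacian phi y - derive1 (@W R) (phi y))) x = 0].

(* Main.v *)
(* For t > 0 the solution is smooth and solves u_t = m'''' with the potential
   m = u'' - (u^3 - u), so that the energy E = \int (u'^2 / 2 + W(u)) decreases at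
   the rate \int m''^2. Times of small dissipation yield a zero-mean limit phi
   with phi'' = phi^3 - phi + c, and a quadrature of this equation shows c = 0 and,
   unless phi = 0, that the linearization at phi has only the translations in
   its kernel. This gives the Lojasiewicz inequality E(u) - E(phi) <= C \int m''^2
   near phi, which together with a uniform H^2 bound makes |u(t) - u(s)|^2
   bounded by a multiple of (E(s) - E(phi))^(1/2): the trajectory has finite drift
   and converges to phi in L^2. If phi = 0, the same conclusion follows from the
   identity E = L/4 - \int m u / 2 - \int u^4 / 4. A differential inequality for
   |u'' - phi''|^2 upgrades the convergence to H^2. *)

(* The dissipation \int m''^2 controls u_t = m'''' only in the dual of H^2, not in L^2. The drift is
   therefore measured by testing u_t against the fixed function u(t) - u(s), which produces \int
   (u(t) - u(s))'' m''. This is where the H^2 bound, uniform in time, is spent, and why only the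
   square of the L^2 drift is estimated. The dissipation also leaves the mean of m free, so every
   estimate near phi has to recover that constant separately. Near a nonzero phi the translation
   mode is removed without a spectral projection: the energy is translation invariant, so U may be
   compared with the translate of phi whose maximum sits at a critical point of U. This fails at phi
   = 0, whose translates are all 0, while w'' + w = 0 has periodic solutions when L is a multiple of
   2 pi. *)
Require Import Defs.
From HB Require Import structures.
From mathcomp Require Import all_boot all_order all_algebra.
From mathcomp Require Import all_classical all_reals all_analysis measurable_realfun.
From mathcomp Require Import ring lra.
Import Order.TTheory GRing.Theory Num.Theory.
Import numFieldNormedType.Exports.
Local Open Scope classical_set_scope.
Local Open Scope ring_scope.
Set Implicit Arguments.
Unset Strict Implicit.
Unset Printing Implicit Defensive.

(** * Calculus on the line *)

Section Differentiation.
Context {R : realType}.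
Implicit Types (A : set R) (f g : R -> R).

(** An alias that the syntax-directed tactic [cont] can match on. *)
Definition cts f := continuous f.

(** The set [A] serves functions of time, which are differentiable at positive times only; in space
    it is [setT]. *)
Definition der A f g := forall x, A x -> is_derive x (1 : R) f (g x).

Lemma der_ext A f g h : der A f g -> (forall x, A x -> g x = h x) -> der A f h.
Proof. by move=> fg gh x Ax; apply: is_derive_eq (fg x Ax) (gh x Ax). Qed.

Lemma der_cst A (c : R) : der A (fun=> c) (fun=> 0).
Proof. by move=> x _; exact: is_derive_cst. Qed.

Lemma der_id A : der A (fun x => x) (fun=> 1).
Proof. by move=> x _; exact: is_derive_id. Qed.

Lemma derD A f g f' g' : der A f f' -> der A g g' ->
  der A (fun x => f x + g x) (fun x => f' x + g' x).
Proof.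
by move=> ff gg x Ax; exact: (@is_deriveD _ _ _ f g x 1 _ _ (ff x Ax) (gg x Ax)).
Qed.

Lemma derN A f f' : der A f f' -> der A (fun x => - f x) (fun x => - f' x).
Proof. by move=> ff x Ax; exact: (@is_deriveN _ _ _ f x 1 _ (ff x Ax)). Qed.

Lemma derM A f g f' g' : der A f f' -> der A g g' ->
  der A (fun x => f x * g x) (fun x => f' x * g x + f x * g' x).
Proof.
move=> ff gg x Ax; have H := @is_deriveM _ _ f g x 1 _ _ (ff x Ax) (gg x Ax).
apply: (is_derive_eq H); rewrite /= addrC mulrC.
by congr (_ + _); rewrite mulrC.
Qed.

Lemma derX A f f' n : der A f f' ->
  der A (fun x => f x ^+ n) (fun x => n%:R * f x ^+ n.-1 * f' x).
Proof.
move=> ff x Ax; rewrite (_ : (fun x => f x ^+ n) = f ^+ n).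
  exact: (@is_deriveX _ _ f n x 1 _ (ff x Ax)).
by apply/funext => y; rewrite exprfctE.
Qed.

Lemma derV A f f' : der A f f' -> (forall x, A x -> f x != 0) ->
  der A (fun x => (f x)^-1) (fun x => - (f x ^- 2) * f' x).
Proof.
move=> ff f0 x Ax.
exact: (@is_deriveV _ f x _ 1 (f0 x Ax) (ff x Ax)).
Qed.

Lemma der_comp A (B : set R) f g f' g' : der A f f' -> der B g g' ->
  (forall x, B x -> A (g x)) -> der B (fun x => f (g x)) (fun x => f' (g x) * g' x).
Proof.
move=> ff gg BA x Bx.
exact: (@is_derive1_comp _ f g x _ _ (ff _ (BA x Bx)) (gg x Bx)).
Qed.

Lemma der_sqrt A f f' : der A f f' -> (forall x, A x -> 0 < f x) ->
  der A (fun x => Num.sqrt (f x)) (fun x => (2 * Num.sqrt (f x))^-1 * f' x).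
Proof.
move=> ff f0; apply: (@der_comp [set y | 0 < y] A Num.sqrt f
  (fun y => (2 * Num.sqrt y)^-1)) => // y y0.
exact: is_derive1_sqrt.
Qed.

Lemma der_ln A f f' : der A f f' -> (forall x, A x -> 0 < f x) ->
  der A (fun x => ln (f x)) (fun x => (f x)^-1 * f' x).
Proof.
move=> ff f0; apply: (@der_comp [set y | 0 < y] A (@ln R) f (fun y => y^-1)) => //.
by move=> y y0; exact: is_derive1_ln.
Qed.

Lemma der_expR A f f' : der A f f' ->
  der A (fun x => expR (f x)) (fun x => expR (f x) * f' x).
Proof.
move=> ff; apply: (@der_comp setT A (@expR R) f (@expR R)) => // y _.
exact: is_derive_expR.
Qed.

Lemma der_shift f g (c : R) : der setT f g ->
  der setT (fun x => f (x + c)) (fun x => g (x + c)).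
Proof.
move=> fg; have shift_der := derD (@der_id setT) (@der_cst setT c).
apply: (der_ext (der_comp fg shift_der _)) => //= x _.
by rewrite addr0 mulr1.
Qed.

Lemma der_sub A (B : set R) f g : der A f g -> B `<=` A -> der B f g.
Proof. by move=> fg BA x /BA; exact: fg. Qed.

Lemma is_derive_continuous f (x d : R) : is_derive x 1 f d -> {for x, continuous f}.
Proof.
by move=> [dr _]; apply: differentiable_continuous; apply/derivable1_diffP.
Qed.

Lemma der_continuous f g : der setT f g -> cts f.
Proof. by move=> fg x; exact: is_derive_continuous (fg x I). Qed.

Lemma der_mvt A f g a b : a < b -> (forall x, a <= x <= b -> A x) -> der A f g ->
  exists2 c, a < c < b & f b - f a = g c * (b - a).
Proof.
move=> ab Asub fg.
have [c cab fE] : exists2 c, c \in `]a, b[%R & f b - f a = g c * (b - a).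
  apply: MVT => //.
    move=> x; rewrite in_itv/= => /andP[ax xb]; apply: fg; apply: Asub.
    by rewrite !ltW.
  apply: derivable_within_continuous => x; rewrite in_itv/= => xab.
  by have [] := fg x (Asub x xab).
by exists c => //; move: cab; rewrite in_itv.
Qed.

Lemma der_nonincreasing A f g a b : a <= b -> (forall x, a <= x <= b -> A x) ->
  der A f g -> (forall x, a <= x <= b -> g x <= 0) -> f b <= f a.
Proof.
move=> ab Asub fg g0; move: ab; rewrite le_eqVlt => /predU1P[->//|ab].
have [c /andP[ac cb] fE] := der_mvt ab Asub fg.
rewrite -subr_le0 fE; apply: mulr_le0_ge0; last by rewrite subr_ge0 ltW.
by apply: g0; rewrite !ltW.
Qed.

Lemma der_lipschitz A f g a b (K : R) : a <= b -> (forall x, a <= x <= b -> A x) ->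
  der A f g -> (forall x, a <= x <= b -> `|g x| <= K) ->
  `|f b - f a| <= K * (b - a).
Proof.
move=> ab Asub fg gK; move: ab; rewrite le_eqVlt => /predU1P[->|ab].
  by rewrite !subrr normr0 mulr0.
have [c /andP[ac cb] ->] := der_mvt ab Asub fg.
rewrite normrM (ger0_norm (_ : 0 <= b - a)); last by rewrite subr_ge0 ltW.
by rewrite ler_wpM2r ?subr_ge0 ?(ltW ab)// gK// !ltW.
Qed.

Lemma der_uniq A f g h x : A x -> der A f g -> der A f h -> g x = h x.
Proof. by move=> Ax fg fh; have [_ <-] := fg x Ax; have [_ <-] := fh x Ax. Qed.

Lemma der0_cst f : der setT f (fun=> 0) -> forall x y, f x = f y.
Proof.
by move=> f0 x y; apply: is_derive_0_is_cst => z; exact: f0.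
Qed.

Lemma der_max f g (x0 : R) : der setT f g -> (forall x, f x <= f x0) -> g x0 = 0.
Proof.
move=> fg fmax.
have H : is_derive x0 1 f 0.
  apply: (@derive1_at_max _ f (x0 - 1) (x0 + 1) x0).
  - by lra.
  - by move=> t _; have [] := fg t I.
  - by rewrite in_itv/=; apply/andP; split; lra.
  - by move=> t _; exact: fmax.
by have [_ <-] := fg x0 I; have [_ ->] := H.
Qed.

Lemma periodicB f L x : periodic f L -> f (x - L) = f x.
Proof. by move=> fL; rewrite -[in RHS](subrK L x) fL. Qed.

Lemma der_periodic f g L : der setT f g -> periodic f L -> periodic g L.
Proof.
move=> fg fL x.
have := der_shift L fg; rewrite (_ : (fun z => f (z + L)) = f).
  by move=> H; exact: (@der_uniq setT f (fun y => g (y + L)) g x).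
by apply/funext => z; rewrite fL.
Qed.

Lemma periodicn_int f L (n : nat) : periodic f L ->
  forall x, (f (x + n%:R * L) = f x) * (f (x - n%:R * L) = f x).
Proof.
move=> fL; elim: n => [|n IHn] x; first by rewrite mul0r addr0 subr0.
split.
  have -> : x + n.+1%:R * L = (x + n%:R * L) + L by rewrite -natr1; ring.
  by rewrite fL IHn.
have -> : x - n.+1%:R * L = (x - n%:R * L) - L by rewrite -natr1; ring.
by rewrite periodicB// IHn.
Qed.

Lemma periodic_reduce f L a : 0 < L -> periodic f L ->
  forall x, exists2 y, a <= y <= a + L & f x = f y.
Proof.
move=> L0 fL x; have [xa|ax] := leP a x.
  pose n := Num.truncn ((x - a) / L).
  have q0 : 0 <= (x - a) / L by rewrite divr_ge0 ?subr_ge0// ltW.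
  have /andP[n1 n2] := truncn_itv q0.
  exists (x - n%:R * L); last by rewrite (periodicn_int n fL).
  move: n1 n2; rewrite -/n ler_pdivlMr// ltr_pdivrMr// -natr1 mulrDl mul1r.
  by lra.
pose n := Num.truncn ((a - x) / L).
have q0 : 0 <= (a - x) / L by rewrite divr_ge0 ?subr_ge0// ltW.
have /andP[n1 n2] := truncn_itv q0.
exists (x + n.+1%:R * L); last by rewrite (periodicn_int n.+1 fL).
move: n1 n2; rewrite -/n ler_pdivlMr// ltr_pdivrMr// -natr1 mulrDl mul1r.
by lra.
Qed.

End Differentiation.

Section Continuity.
Context {R : realType}.
Implicit Types f g : R -> R.

Lemma continuous_cstr (c : R) : cts (fun _ : R => c).
Proof. by move=> x; exact: cvg_cst. Qed.
Lemma continuous_idr : cts (fun x : R => x).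
Proof. by move=> x; exact: cvg_id. Qed.
Lemma continuousDr f g : cts f -> cts g ->
  cts (fun x => f x + g x).
Proof. by move=> cf cg x; apply: cvgD; [exact: cf|exact: cg]. Qed.
Lemma continuousNr f : cts f -> cts (fun x => - f x).
Proof. by move=> cf x; apply: cvgN; exact: cf. Qed.
Lemma continuousMr f g : cts f -> cts g ->
  cts (fun x => f x * g x).
Proof. by move=> cf cg x; apply: cvgM; [exact: cf|exact: cg]. Qed.
Lemma continuousXr f n : cts f -> cts (fun x => f x ^+ n).
Proof.
move=> cf; elim: n => [|n IH].
  by under [fun x => _]funext => x do rewrite expr0; exact: continuous_cstr.
by under [fun x => _]funext => x do rewrite exprS; exact: continuousMr.
Qed.
Lemma continuous_normr f : cts f -> cts (fun x => `|f x|).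
Proof. by move=> cf x; apply: cvg_norm; exact: cf. Qed.
Lemma continuousVr f : cts f -> (forall x, f x != 0) ->
  cts (fun x => (f x)^-1).
Proof. by move=> cf f0 x; apply: cvgV; [exact: f0|exact: cf]. Qed.
Lemma continuous_compr f g : cts f -> cts g ->
  cts (fun x => f (g x)).
Proof. by move=> cf cg x; apply: continuous_comp; [exact: cg|exact: cf]. Qed.
Lemma continuous_shiftr f (c : R) : cts f -> cts (fun x => f (x + c)).
Proof.
move=> cf; apply: continuous_compr => //.
by apply: continuousDr; [exact: continuous_idr|exact: continuous_cstr].
Qed.

End Continuity.

(** The derivative is built in an existential variable by recursion on the syntax of the function;
    [derr] then compares it with the expected one by [ring]. *)
Ltac dert := lazymatch goal with
  | |- der _ (fun x => @?f x + @?g x) _ => eapply (@derD _ _ f g); dert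
  | |- der _ (fun x => - @?f x) _ => eapply (@derN _ _ f); dert
  | |- der _ (fun x => @?f x * @?g x) _ => eapply (@derM _ _ f g); dert
  | |- der _ (fun x => @?f x ^+ ?n) _ => eapply (@derX _ _ f _ n); dert
  | _ => first [ simple apply der_cst | simple apply der_id | eassumption | idtac ]
  end.

Ltac derr := eapply der_ext; [dert | move=> ? _ /=; try ring].

Ltac cont := lazymatch goal with
  | |- cts (fun x => @?f x + @?g x) => refine (@continuousDr _ f g _ _); cont
  | |- cts (fun x => - @?f x) => refine (@continuousNr _ f _); cont
  | |- cts (fun x => @?f x * @?g x) => refine (@continuousMr _ f g _ _); cont
  | |- cts (fun x => @?f x ^+ ?n) => refine (@continuousXr _ f n _); cont
  | |- cts (fun x => `|@?f x|) => refine (@continuous_normr _ f _); cont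
  | _ => first [ simple apply continuous_cstr | simple apply continuous_idr
               | assumption | idtac ]
  end.

(** * Integrals over a period *)

(** The closed interval suits compactness and the fundamental theorem of calculus;
    [cts_torus_integral] identifies this with the integral over the torus. *)
Definition cint (R : realType) (L : R) (f : R -> R) : R :=
  \int[@lebesgue_measure R]_(x in `[0, L]) f x.

Section CircleIntegral.
Context {R : realType} (L : R) (L0 : 0 < L).
Implicit Types f g : R -> R.
Local Notation mu := (@lebesgue_measure R).
Local Notation J := (cint L).

Lemma continuous_integrable f a b :
  cts f -> mu.-integrable `[a, b] (EFin \o f).
Proof.
move=> cf; apply: continuous_compact_integrable; first exact: segment_compact.
by apply: continuous_subspaceT => x; exact: cf.
Qed.

Lemma cintD f g : cts f -> cts g ->
  J (fun x => f x + g x) = J f + J g.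
Proof. by move=> cf cg; rewrite /cint RintegralD//; exact: continuous_integrable. Qed.

Lemma cintZ k f : cts f -> J (fun x => k * f x) = k * J f.
Proof. by move=> cf; rewrite /cint RintegralZl//; exact: continuous_integrable. Qed.

Lemma cintN f : cts f -> J (fun x => - f x) = - J f.
Proof.
move=> cf; rewrite -mulN1r -cintZ//; congr cint.
by apply/funext => x; rewrite mulN1r.
Qed.

Lemma cintB f g : cts f -> cts g ->
  J (fun x => f x - g x) = J f - J g.
Proof. by move=> cf cg; rewrite cintD// ?cintN//; exact: continuousNr. Qed.

Lemma cint_cst k : J (fun=> k) = k * L.
Proof.
rewrite /cint Rintegral_cst//= lebesgue_measure_itv/= lte_fin L0.
by rewrite -EFinB/= subr0.
Qed.

Lemma eq_cint f g : f =1 g -> J f = J g.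
Proof. by move=> /funext ->. Qed.

Lemma le_cint f g : cts f -> cts g -> (forall x, 0 <= x <= L -> f x <= g x) ->
  J f <= J g.
Proof.
move=> cf cg fg; apply: le_Rintegral => //; exact: continuous_integrable.
Qed.

Lemma cint_ge0 f : (forall x, 0 <= x <= L -> 0 <= f x) -> 0 <= J f.
Proof.
move=> f0; apply: Rintegral_ge0 => x /=; rewrite in_itv/= => xL; exact: f0.
Qed.

Lemma cint_bounds f a b : cts f -> (forall x, 0 <= x <= L -> a <= f x <= b) ->
  a * L <= J f <= b * L.
Proof.
move=> cf fab; rewrite -!cint_cst; apply/andP; split; apply: le_cint => //;
  by [cont | move=> x /fab /andP[]].
Qed.

Lemma cint_norm_le f k : cts f -> (forall x, 0 <= x <= L -> `|f x| <= k) ->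
  `|J f| <= k * L.
Proof.
move=> cf fk; rewrite ler_norml -mulNr cint_bounds// => x xL.
by rewrite -ler_norml fk.
Qed.

Lemma cint_ftc F f : der setT F f -> cts f -> J f = F L - F 0.
Proof.
move=> Ff cf; rewrite /cint /Rintegral (@continuous_FTC2 _ f F)//.
- by apply: continuous_subspaceT => x; exact: cf.
- split.
  + by move=> x _; have [] := Ff x I.
  + by apply: cvg_at_right_filter; exact: (der_continuous Ff).
  + by apply: cvg_at_left_filter; exact: (der_continuous Ff).
- by move=> x _; rewrite derive1E; have [_ ->] := Ff x I.
Qed.

Lemma cint_der F f : der setT F f -> cts f -> periodic F L -> J f = 0.
Proof.
by move=> Ff cf FL; rewrite (cint_ftc Ff cf) -[L]add0r FL subrr.
Qed.

Lemma cint_ibp f g f' g' : der setT f f' -> der setT g g' ->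
  cts f' -> cts g' -> periodic f L -> periodic g L ->
  J (fun x => f' x * g x) = - J (fun x => f x * g' x).
Proof.
move=> ff gg cf' cg' fL gL; apply/eqP; rewrite -subr_eq0 opprK -cintD; last 2 first.
- by have cg := der_continuous gg; cont.
- by have cf := der_continuous ff; cont.
apply/eqP; apply: (@cint_der (fun x => f x * g x)).
- exact: derM.
- by have cf := der_continuous ff; have cg := der_continuous gg; cont.
- by move=> x; rewrite fL gL.
Qed.

Lemma cint_amgm f g k : cts f -> cts g ->
  2 * k * J (fun x => f x * g x) <=
  k ^+ 2 * J (fun x => f x ^+ 2) + J (fun x => g x ^+ 2).
Proof.
move=> cf cg; rewrite -!cintZ; [|cont|cont].
rewrite -cintD; [|cont|cont].
apply: le_cint; [cont|cont|move=> x _].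
by rewrite -subr_ge0 (_ : _ - _ = (k * f x - g x) ^+ 2) ?sqr_ge0//; ring.
Qed.

Lemma cint_CS f g : cts f -> cts g ->
  J (fun x => f x * g x) ^+ 2 <= J (fun x => f x ^+ 2) * J (fun x => g x ^+ 2).
Proof.
move=> cf cg.
set a := J (fun x => f x * g x); set b := J (fun x => f x ^+ 2).
set c := J (fun x => g x ^+ 2).
have b0 : 0 <= b by apply: cint_ge0 => x _; exact: sqr_ge0.
have c0 : 0 <= c by apply: cint_ge0 => x _; exact: sqr_ge0.
have H k : 2 * k * a <= k ^+ 2 * b + c by exact: cint_amgm.
have [b_eq0|b_neq0] := eqVneq b 0.
  have [->|a0] := eqVneq a 0; first by rewrite expr0n/= mulr_ge0.
  (* With b = 0 the inequality reads 2 k a <= c for every k; this k turns it into 2 (c + 1) <= c. *)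
  have := H ((c + 1) / a); rewrite b_eq0 mulr0 add0r -mulrA divfK//.
  by lra.
have bp : 0 < b by rewrite lt_neqAle eq_sym b_neq0.
have := H (a / b); rewrite -(ler_pM2r bp).
have -> : 2 * (a / b) * a * b = 2 * a ^+ 2 by field.
have -> : ((a / b) ^+ 2 * b + c) * b = a ^+ 2 + b * c by field.
by lra.
Qed.

Lemma cint_CS_sqrt f g : cts f -> cts g ->
  `|J (fun x => f x * g x)| <=
  Num.sqrt (J (fun x => f x ^+ 2)) * Num.sqrt (J (fun x => g x ^+ 2)).
Proof.
move=> cf cg; rewrite -sqrtrM; last by apply: cint_ge0 => x _; exact: sqr_ge0.
by rewrite -sqrtr_sqr; apply: ler_wsqrtr; exact: cint_CS.
Qed.

Lemma cint_sqr f : cts f -> J f ^+ 2 <= L * J (fun x => f x ^+ 2).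
Proof.
move=> cf; have := cint_CS (@continuous_cstr _ 1) cf.
rewrite (@eq_cint (fun x => 1 * f x) f); last by move=> x; rewrite mul1r.
by rewrite expr1n cint_cst mul1r.
Qed.

End CircleIntegral.

(** * Integrals depending on a parameter *)

Section Parametric.
Context {R : realType} (L : R) (L0 : 0 < L).
Implicit Types (f g : R -> R) (t : R) (G K : R -> R -> R).
Local Notation J := (cint L).

(** Continuity in both variables, but only at the points of the slice at time t: the flow gives it
    for t > 0 alone. *)
Definition jointly_continuous t G :=
  forall x, {for (t, x), continuous (fun p : R * R => G p.1 p.2)}.
Local Notation jc := jointly_continuous.

Lemma jcD t G K : jc t G -> jc t K -> jc t (fun s x => G s x + K s x).
Proof. by move=> cG cK x; apply: cvgD; [exact: cG|exact: cK]. Qed.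
Lemma jcN t G : jc t G -> jc t (fun s x => - G s x).
Proof. by move=> cG x; apply: cvgN; exact: cG. Qed.
Lemma jcM t G K : jc t G -> jc t K -> jc t (fun s x => G s x * K s x).
Proof. by move=> cG cK x; apply: cvgM; [exact: cG|exact: cK]. Qed.
Lemma jcX t G n : jc t G -> jc t (fun s x => G s x ^+ n).
Proof.
move=> cG; elim: n => [|n IH].
  move=> x; rewrite (_ : (fun p => _) = fun=> 1); first exact: cvg_cst.
  by apply/funext => p; rewrite expr0.
have := jcM cG IH; rewrite (_ : (fun s x => _) = fun s x => G s x ^+ n.+1)//.
by apply/funext => s; apply/funext => x; rewrite exprS.
Qed.
Lemma jc_space t f : cts f -> jc t (fun _ x => f x).
Proof.
move=> cf x; apply: (@continuous_comp _ _ _ snd f); first exact: cvg_snd.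
exact: cf.
Qed.
Lemma jc_cst t (c : R) : jc t (fun _ _ => c).
Proof. by move=> x; exact: cvg_cst. Qed.

Lemma jc_cts t G : jc t G -> cts (G t).
Proof.
move=> cG x; have := cG x => H.
have H2 : (fun y : R => (t, y)) @ x --> (t, x).
  exact: (@cvg_pair _ _ _ (nbhs x) (nbhs t) (nbhs x) _ _ _ (fun=> t) id
    (@cvg_cst _ _ _ _ _) (@cvg_id _ _)).
exact: (@continuous_comp _ _ _ (fun x => (t, x)) _ x H2 H).
Qed.

(** A tube argument on the compact interval [0, L]: near each of its points, both [G s] and [G t]
    stay within e / 2 of the value of [G t] there. *)
Lemma jc_uniform t G (e : R) : jc t G -> 0 < e -> exists2 d : R, 0 < d &
  forall s x, `|s - t| < d -> 0 <= x <= L -> `|G s x - G t x| < e.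
Proof.
move=> cG e0.
have /compact_near_coveringP cov := @segment_compact R 0 L.
have : \forall s \near t, forall x, `[0, L]%classic x -> `|G s x - G t x| < e.
  apply: (cov R (nbhs t) (fun s x => `|G s x - G t x| < e) (nbhs_filter t)) => /= x _.
  have cGt : continuous (G t) := jc_cts cG.
  have e2 : 0 < e / 2 by rewrite divr_gt0.
  have /cvgrPdist_lt /(_ _ e2) H1 := cG x.
  have /cvgrPdist_lt /(_ _ e2) H2 := cGt x.
  have H1' : \forall x' \near x & s \near t, `|G t x - G s x'| < e / 2.
    case: H1 => -[A B] /= [At Bx] AB.
    by exists (B, A) => //= -[x' s] /= [Bx' As]; apply: (AB (s, x')).
  have H2' : \forall x' \near x & s \near t, `|G t x - G t x'| < e / 2.
    case/nbhs_ballP : H2 => r /= r0 H2.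
    exists (ball x r, setT) => /=; first by split; [exact: nbhsx_ballx|exact: filterT].
    by move=> [x' s] /= [xx' _]; exact: H2.
  apply: filterS2 H1' H2' => -[x' s] /= h1 h2.
  rewrite (_ : G s x' - G t x' = (G t x - G t x') - (G t x - G s x')); last by ring.
  by rewrite (le_lt_trans (ler_normB _ _))// [e]splitr ltrD.
case/nbhs_ballP => d /= d0 H; exists d => // s x sd xL.
by apply: H => //=; rewrite /ball/= distrC.
Qed.

Lemma cts_bounded f a b : cts f -> exists2 M : R, 0 <= M & forall x, a <= x <= b -> `|f x| <= M.
Proof.
move=> cf; have [ab|ba] := leP a b; last first.
  by exists 0 => // x /andP[ax xb]; move: (le_trans ax xb); rewrite leNgt ba.
have [c _ cmax] : exists2 c, c \in `[a, b]%R &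
    forall t, t \in `[a, b]%R -> `|f t| <= `|f c|.
  apply: (@EVT_max _ (fun x => `|f x|)) => //.
  by apply: continuous_subspaceT => x; exact: (continuous_normr cf).
by exists `|f c| => // x xab; apply: cmax; rewrite in_itv.
Qed.

Lemma is_derive_eps (Q : R -> R) t l :
  (forall e : R, 0 < e -> exists2 d : R, 0 < d & forall h, h != 0 -> `|h| < d ->
     `|(Q (t + h) - Q t) / h - l| <= e) ->
  is_derive t (1 : R) Q l.
Proof.
move=> H.
have C : h^-1 *: ((Q \o shift t) (h *: (1 : R)) - Q t) @[h --> 0^'] --> l.
  apply/cvgrPdist_le => e e0; have [d d0 Hd] := H e e0.
  exists d => //= h /=; rewrite /ball/= sub0r normrN => hd h0.
  have := Hd h h0 hd; rewrite distrC /= /GRing.scale/= mulr1 addrC [h + t]addrC.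
  by rewrite addrC mulrC.
apply: DeriveDef; first by apply/cvg_ex; exists l.
exact: cvg_lim.
Qed.

(* Only u itself, and not its x-derivatives, is known to be differentiable in t:
   the difference of a functional at two times is first integrated by parts
   until it is tested against U s - U t. *)
Lemma parametric_is_derive (A : set R) (U Ut K : R -> R -> R) (Q : R -> R) t d0 :
  0 < d0 -> (forall s, `|s - t| < d0 -> A s) ->
  (forall x, der A (fun s => U s x) (fun s => Ut s x)) ->
  (forall s, A s -> cts (U s)) -> (forall s, A s -> cts (K s)) ->
  jc t Ut -> jc t K ->
  (forall s, A s -> Q s - Q t = J (fun x => K s x * (U s x - U t x))) ->
  is_derive t (1 : R) Q (J (fun x => K t x * Ut t x)).
Proof.
move=> d00 dA UUt cU cK jUt jK QE.
have At : A t by apply: dA; rewrite subrr normr0.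
have cUt := jc_cts jUt; have cKt := jc_cts jK.
have [M1 M10 HM1] := cts_bounded 0 L cUt.
have [M2 M20 HM2] := cts_bounded 0 L cKt.
have cUt' := cU _ At; have cK' := cK _ At.
apply: is_derive_eps => e e0.
(* The integrand will differ from its limit by at most [e1 * (M1 + 1) + M2 * e1], which integrates
   to [e1 * B]. The cap [e1 <= 1] is what bounds [Ut] by [M1 + 1] at nearby times. *)
pose B := L * (M1 + M2 + 1).
have B0 : 0 < B by rewrite mulr_gt0//; lra.
pose e1 := Num.min 1 (e / B).
have e10 : 0 < e1 by rewrite lt_min ltr01 divr_gt0.
have e11 : e1 <= 1 by rewrite ge_min lexx.
have e1e : e1 * B <= e by rewrite -ler_pdivlMr// ge_min lexx orbT.
have [d1 d10 H1] := jc_uniform jUt e10.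
have [d2 d20 H2] := jc_uniform jK e10.
exists (Num.min d0 (Num.min d1 d2)).
  by rewrite !lt_min d00 d10 d20.
move=> h h0; rewrite !lt_min => /and3P[hd0 hd1 hd2].
have tht s : `|s - t| <= `|h| -> A s by move=> sh; apply: dA; exact: le_lt_trans sh hd0.
have Ath : A (t + h) by apply: tht; rewrite addrAC subrr add0r.
have cUh := cU _ Ath; have cKh := cK _ Ath.
rewrite QE// mulrC -cintZ//; last by cont.
rewrite -cintB; [|by cont|by cont].
apply: (@le_trans _ _ (e1 * (M1 + M2 + 1) * L)); last first.
  by rewrite (le_trans _ e1e)// /B mulrAC mulrA.
apply: cint_norm_le => // [|x xL]; first by cont.
(* The intermediate time depends on x; the estimate [H1], uniform in x, makes this harmless. *)
have [xi xih qE] : exists2 xi, `|xi - t| <= `|h| & U (t + h) x - U t x = Ut xi x * h.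
  have [hp|hn|h_eq0] := ltgtP 0 h.
  - have tth : t < t + h by rewrite ltrDl.
    have tthA y : t <= y <= t + h -> A y.
      by move=> /andP[y1 y2]; apply: tht; rewrite (gtr0_norm hp) ger0_norm; lra.
    have [xi /andP[x1 x2]] := der_mvt tth tthA (UUt x).
    rewrite addrAC subrr add0r => ->; exists xi => //.
    by rewrite (gtr0_norm hp) ger0_norm; lra.
  - have tth : t + h < t by rewrite gtrDl.
    have tthA y : t + h <= y <= t -> A y.
      by move=> /andP[y1 y2]; apply: tht; rewrite (ltr0_norm hn) ler0_norm; lra.
    have [xi /andP[x1 x2] E] := der_mvt tth tthA (UUt x).
    exists xi; first by rewrite (ltr0_norm hn) ler0_norm; lra.
    by rewrite -opprB E; ring.
  - by rewrite h_eq0 eqxx in h0.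
rewrite qE (_ : _ - _ = (K (t + h) x - K t x) * Ut xi x
   + K t x * (Ut xi x - Ut t x)); last by field.
have k1 : `|K (t + h) x - K t x| <= e1.
  by apply/ltW/H2 => //; rewrite addrAC subrr add0r.
have u1 : `|Ut xi x - Ut t x| <= e1.
  by apply/ltW/H1 => //; exact: le_lt_trans xih hd1.
have u2 : `|Ut xi x| <= M1 + 1.
  rewrite -[Ut xi x](subrK (Ut t x)) (le_trans (ler_normD _ _))// addrC lerD ?HM1//.
  exact: le_trans u1 e11.
rewrite (le_trans (ler_normD _ _))// !normrM.
have := ler_pM (normr_ge0 _) (normr_ge0 _) k1 u2.
have := ler_pM (normr_ge0 _) (normr_ge0 _) (HM2 x xL) u1.
by move: e10; lra.
Qed.

(** The integral is differentiated with respect to c: the derivative is the integral of f' over a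
    period, which is zero. Asking for a C^1 function avoids cutting the interval of integration. *)
Lemma cint_shift f f1 c : der setT f f1 -> cts f1 -> periodic f L ->
  J (fun x => f (x + c)) = J f.
Proof.
move=> ff1 cf1 fL.
have cf := der_continuous ff1.
have jplus g t : cts g -> jc t (fun s x => g (x + s)).
  move=> cg x; have H : {for (t, x), continuous (fun p : R * R => p.2 + p.1)}.
    by apply: cvgD; [exact: cvg_snd|exact: cvg_fst].
  exact: (@continuous_comp _ _ _ (fun p : R * R => p.2 + p.1) g _ H (cg _)).
have D : der setT (fun c => J (fun x => f (x + c))) (fun=> 0).
  move=> t _.
  have -> : 0 = J (fun x => 1 * f1 (x + t)).
    under eq_cint do rewrite mul1r.
    apply/esym; apply: (cint_der L0 (der_shift t ff1)) => //.
      exact: continuous_shiftr.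
    by move=> x; rewrite addrAC fL.
  apply: (@parametric_is_derive setT (fun s x => f (x + s)) (fun s x => f1 (x + s))
    (fun _ _ => 1) _ t 1) => //.
  - move=> x s _ /=.
    by have := der_shift x ff1 I; under eq_fun do rewrite addrC; rewrite addrC.
  - by move=> s _; exact: continuous_shiftr.
  - by move=> s _; exact: continuous_cstr.
  - exact: jplus.
  - exact: jc_cst.
  - move=> s _; rewrite -cintB//; try exact: continuous_shiftr.
    by apply: eq_cint => x; rewrite mul1r.
rewrite (der0_cst D c 0).
by apply: eq_cint => x; rewrite addr0.
Qed.

Definition l2 f := Num.sqrt (J (fun x => f x ^+ 2)).

Lemma l2_ge0 f : 0 <= l2 f. Proof. exact: sqrtr_ge0. Qed.

Lemma sqr_l2 f : l2 f ^+ 2 = J (fun x => f x ^+ 2).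
Proof. by rewrite sqr_sqrtr//; apply: cint_ge0 => x _; exact: sqr_ge0. Qed.

Lemma l2_CS f g : cts f -> cts g -> `|J (fun x => f x * g x)| <= l2 f * l2 g.
Proof. exact: cint_CS_sqrt. Qed.

(** * Sobolev, Poincare, Agmon and interpolation inequalities *)

Section Sobolev.
Context (f f1 f2 : R -> R).
Hypotheses (d1 : der setT f f1) (d2 : der setT f1 f2) (c2 : cts f2).
Hypotheses (fL : periodic f L).

Let c0 : cts f. Proof. exact: der_continuous d1. Qed.
Let c1 : cts f1. Proof. exact: der_continuous d2. Qed.
Let f1L : periodic f1 L. Proof. exact: der_periodic d1 fL. Qed.

Let sqr_shift x : J (fun y => f (y + x) ^+ 2) = J (fun y => f y ^+ 2).
Proof.
apply: (@cint_shift (fun y => f y ^+ 2) (fun y => 2 * f y * f1 y)) => //.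
- by derr.
- by cont.
- by move=> y; rewrite fL.
Qed.

Let sqr1_shift x : J (fun y => f1 (y + x) ^+ 2) = J (fun y => f1 y ^+ 2).
Proof.
apply: (@cint_shift (fun y => f1 y ^+ 2) (fun y => 2 * f1 y * f2 y)) => //.
- by derr.
- by cont.
- by move=> y; rewrite f1L.
Qed.

(* L f(x) is the integral of y f'(x + y) over a period. *)
Lemma sobolev_sup : J f = 0 -> forall x, f x ^+ 2 <= L * J (fun y => f1 y ^+ 2).
Proof.
move=> f0 x.
have c1x : cts (fun y => f1 (y + x)) by exact: continuous_shiftr.
have c0x : cts (fun y => f (y + x)) by exact: continuous_shiftr.
have d1x := der_shift x d1.
have E : L * f x = J (fun y => y * f1 (y + x)).
  have H : der setT (fun y => y * f (y + x)) (fun y => f (y + x) + y * f1 (y + x)).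
    by derr.
  have := cint_ftc L0 H; rewrite cintD//; last by cont.
  rewrite (cint_shift _ d1)// f0 add0r => -> //; last by cont.
  by rewrite mul0r subr0 [L + x]addrC fL.
have := cint_CS L (@continuous_idr _) c1x; rewrite -E sqr1_shift.
have : J (fun y => y ^+ 2) <= L ^+ 2 * L.
  rewrite -cint_cst//; apply: le_cint => //; [by cont|by cont|move=> y /andP[y0 yL]].
  by rewrite ler_sqr ?nnegrE// ltW.
set a := J _; set b := J _ => aL H.
have b0 : 0 <= b by apply: cint_ge0 => y _; exact: sqr_ge0.
rewrite -(@ler_pM2l _ (L ^+ 2)) ?exprn_gt0// -exprMn (le_trans H)//.
by rewrite mulrA ler_wpM2r.
Qed.

Lemma poincare : J f = 0 -> J (fun y => f y ^+ 2) <= L ^+ 2 * J (fun y => f1 y ^+ 2).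
Proof.
move=> f0; apply: (@le_trans _ _ (J (fun=> L * J (fun y => f1 y ^+ 2)))).
  by apply: le_cint => //; [by cont|by cont|move=> x _; exact: sobolev_sup].
by rewrite cint_cst// mulrAC expr2.
Qed.

Lemma l2_poincare : J f = 0 -> l2 f <= L * l2 f1.
Proof.
move=> f0; rewrite -ler_sqr ?nnegrE ?mulr_ge0 ?l2_ge0 ?(ltW L0)//.
by rewrite exprMn !sqr_l2; exact: poincare.
Qed.

(** Integrating the derivative of [y * f (y + x) ^+ 2] gives L f(x)^2 = \int f^2 + 2 \int y f(y + x)
    f'(y + x). The constant 3 is 1 from Poincare on the first term plus 2 from Cauchy-Schwarz on the
    second. *)
Lemma agmon : J f = 0 -> forall x, f x ^+ 2 <= 3 * (l2 f * l2 f1).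
Proof.
move=> f0 x.
have c1x : cts (fun y => f1 (y + x)) by exact: continuous_shiftr.
have c0x : cts (fun y => f (y + x)) by exact: continuous_shiftr.
have d1x := der_shift x d1.
have E : L * f x ^+ 2 = J (fun y => f y ^+ 2) +
    2 * J (fun y => (y * f (y + x)) * f1 (y + x)).
  have H : der setT (fun y => y * f (y + x) ^+ 2)
      (fun y => f (y + x) ^+ 2 + 2 * (y * f (y + x) * f1 (y + x))).
    by derr.
  have := cint_ftc L0 H; rewrite cintD//; [|by cont|by cont].
  rewrite cintZ// ?sqr_shift; last by cont.
  move=> -> //; last by cont.
  by rewrite mul0r subr0 [L + x]addrC fL.
have H1 : `|J (fun y => (y * f (y + x)) * f1 (y + x))| <= L * (l2 f * l2 f1).
  apply: (le_trans (l2_CS _ c1x)); first by cont.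
  rewrite mulrA {2}/l2 sqr1_shift ler_wpM2r ?l2_ge0//.
  rewrite -ler_sqr ?nnegrE ?mulr_ge0 ?l2_ge0 ?(ltW L0)// exprMn !sqr_l2.
  rewrite -(sqr_shift x) -cintZ//; last by cont.
  apply: le_cint => //; [by cont|by cont|move=> y /andP[y0 yL]].
  by rewrite exprMn ler_wpM2r ?sqr_ge0// ler_sqr ?nnegrE// ltW.
have H2 : J (fun y => f y ^+ 2) <= L * (l2 f * l2 f1).
  by rewrite -sqr_l2 expr2 mulrCA ler_wpM2l ?l2_ge0// l2_poincare.
rewrite -(ler_pM2l L0) E mulrCA.
move: H1; rewrite ler_norml => /andP[_].
by move: H2; set a := J _; set b := J _; set c := L * _; lra.
Qed.

(** One integration by parts: \int f'^2 = - \int f f''. *)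
Lemma l2_interpolation : l2 f1 ^+ 2 <= l2 f * l2 f2.
Proof.
rewrite sqr_l2 (eq_cint _ (fun x => expr2 (f1 x))).
rewrite (cint_ibp L0 d1 d2)//.
by rewrite (le_trans (ler_norm _))// normrN l2_CS.
Qed.

End Sobolev.
End Parametric.

Ltac jcont := lazymatch goal with
  | |- jointly_continuous _ (fun s x => @?f s x + @?g s x) =>
      refine (@jcD _ _ f g _ _); jcont
  | |- jointly_continuous _ (fun s x => - @?f s x) => refine (@jcN _ _ f _); jcont
  | |- jointly_continuous _ (fun s x => @?f s x * @?g s x) =>
      refine (@jcM _ _ f g _ _); jcont
  | |- jointly_continuous _ (fun s x => @?f s x ^+ ?n) =>
      refine (@jcX _ _ f n _); jcont
  | _ => first [ simple apply jc_cst | assumption | idtac ]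
  end.

(** * Stationary profiles *)

Section SteadyStates.
Context {R : realType}.
Implicit Types (a b f g phi : R -> R).

(** The quantity a^2 + b^2 + eps^2, damped by exp (- (2 + K) (y - x0)), is nonincreasing; including
    eps^2 in it absorbs the inhomogeneous term. *)
Lemma gronwall a b g (K eps x0 x : R) : 0 <= K -> 0 <= eps -> x0 <= x ->
  der setT a b -> der setT b g -> (forall y, `|g y| <= K * `|a y| + eps) ->
  a x ^+ 2 + b x ^+ 2 <=
  (a x0 ^+ 2 + b x0 ^+ 2 + eps ^+ 2) * expR ((2 + K) * (x - x0)).
Proof.
move=> K0 e0 x0x ab bg gK.
pose E y := (a y ^+ 2 + b y ^+ 2 + eps ^+ 2) * expR (- (2 + K) * (y - x0)).
have dexp : der setT (fun y => expR (- (2 + K) * (y - x0)))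
    (fun y => expR (- (2 + K) * (y - x0)) * - (2 + K)).
  eapply der_ext; first by eapply der_expR; dert.
  by move=> y _ /=; ring.
have dE : der setT E (fun y => (2 * a y * b y + 2 * b y * g y
    - (2 + K) * (a y ^+ 2 + b y ^+ 2 + eps ^+ 2)) * expR (- (2 + K) * (y - x0))).
  by rewrite /E; derr.
have := der_nonincreasing x0x (fun _ _ => I) dE.
rewrite /E subrr mulr0 expR0 mulr1 => H.
have {}H : E x <= a x0 ^+ 2 + b x0 ^+ 2 + eps ^+ 2.
  apply: H => y _; rewrite mulr_le0_ge0 ?expR_ge0//.
  have h1 : 2 * a y * b y <= a y ^+ 2 + b y ^+ 2.
    by rewrite -subr_ge0 (_ : _ - _ = (a y - b y) ^+ 2) ?sqr_ge0//; ring.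
  have h2 : b y * g y <= `|b y| * (K * `|a y| + eps).
    by rewrite (le_trans (ler_norm _))// normrM ler_wpM2l.
  have h3 : 2 * `|b y| * `|a y| <= a y ^+ 2 + b y ^+ 2.
    rewrite -(real_normK (num_real (a y))) -(real_normK (num_real (b y))).
    by rewrite -subr_ge0 (_ : _ - _ = (`|a y| - `|b y|) ^+ 2) ?sqr_ge0//; ring.
  have h4 : 2 * `|b y| * eps <= b y ^+ 2 + eps ^+ 2.
    rewrite -(real_normK (num_real (b y))).
    by rewrite -subr_ge0 (_ : _ - _ = (`|b y| - eps) ^+ 2) ?sqr_ge0//; ring.
  have h5 := ler_wpM2l K0 h3.
  have h6 : 0 <= a y ^+ 2 by exact: sqr_ge0.
  have h7 : 0 <= K * eps ^+ 2 by rewrite mulr_ge0 ?sqr_ge0.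
  have h8 : 0 <= eps ^+ 2 by exact: sqr_ge0.
  by lra.
apply: (@le_trans _ _ (E x * expR ((2 + K) * (x - x0)))); last first.
  by rewrite ler_wpM2r ?expR_ge0.
rewrite /E -mulrA -expRD mulNr addNr expR0 mulr1.
by rewrite lerDl sqr_ge0.
Qed.

(** Every x has a representative within one period to the right of [x0], so the forward estimate
    covers both sides with a fixed exponential factor. *)
Lemma gronwall_periodic (L : R) a b g (K eps x0 x : R) : 0 < L ->
  periodic a L -> 0 <= K -> 0 <= eps ->
  der setT a b -> der setT b g -> (forall y, `|g y| <= K * `|a y| + eps) ->
  a x ^+ 2 + b x ^+ 2 <= (a x0 ^+ 2 + b x0 ^+ 2 + eps ^+ 2) * expR ((2 + K) * L).
Proof.
move=> L0 aL K0 e0 ab bg gK.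
have bL : periodic b L := der_periodic ab aL.
have [|z /andP[z1 z2] zE] := @periodic_reduce _ (fun y => a y ^+ 2 + b y ^+ 2) _ x0 L0 _ x.
  by move=> y; rewrite aL bL.
rewrite zE (le_trans (gronwall K0 e0 z1 ab bg gK))//.
rewrite ler_wpM2l ?addr_ge0 ?sqr_ge0// ler_expR ler_wpM2l//; first by lra.
by lra.
Qed.

Lemma second_derivative_min f f1 f2 x0 : der setT f f1 -> der setT f1 f2 -> cts f2 ->
  (forall x, f x0 <= f x) -> 0 <= f2 x0.
Proof.
move=> d1 d2 c2 fmin; rewrite leNgt; apply/negP => f2neg.
have f10 : f1 x0 = 0.
  apply/eqP; rewrite -oppr_eq0; apply/eqP.
  by apply: (der_max (derN d1)) => x /=; rewrite lerN2.
have c2' : continuous f2 := c2.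
have /cvgr_lt /(_ 0 f2neg) := c2' x0.
case/nbhs_ballP => r /= r0 Hr.
have r2 : x0 < x0 + r / 2 by rewrite ltrDl divr_gt0.
have [x /andP[x1 x2] E1] := der_mvt r2 (fun _ _ => I) d1.
have [y /andP[y1 y2] E2] := der_mvt x1 (fun _ _ => I) d2.
have f2y : f2 y < 0.
  by apply: Hr; rewrite /ball/= ltr_norml; apply/andP; split; lra.
have f1x : f1 x < 0.
  by move: E2; rewrite f10 subr0 => ->; rewrite nmulr_rlt0// subr_gt0.
have := fmin (x0 + r / 2); rewrite leNgt -subr_lt0 E1.
by rewrite nmulr_rlt0// subr_gt0 r2.
Qed.

Section Profile.
Context (L : R) (L0 : 0 < L).
Local Notation J := (cint L).

(** Here [c] is the constant value of the potential m, the Lagrange multiplier of the zero-mean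
    constraint. *)
Record profile phi phi1 (c : R) : Prop := Profile {
  profile_der : der setT phi phi1;
  profile_der1 : der setT phi1 (fun x => phi x ^+ 3 - phi x + c);
  profile_periodic : periodic phi L;
  profile_mean : J phi = 0 }.

Lemma profileN phi phi1 c : profile phi phi1 c ->
  profile (fun x => - phi x) (fun x => - phi1 x) (- c).
Proof.
move=> [d d1 p m]; split.
- exact: derN.
- eapply der_ext; first by dert.
  by move=> x _ /=; ring.
- by move=> x; rewrite p.
- by rewrite cintN ?m ?oppr0//; exact: der_continuous d.
Qed.

(** If phi'' vanished at the minimum, the constant phi(x0) would solve the same equation with the
    same Cauchy data, and uniqueness (Gronwall with eps = 0) would make phi constant. *)
Lemma profile_min phi phi1 c x0 : profile phi phi1 c -> (forall x, phi x0 <= phi x) ->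
  (exists x, phi x != phi x0) -> 0 < phi x0 ^+ 3 - phi x0 + c.
Proof.
move=> [d d1 p m] phmin [x1 x1P].
have cp := der_continuous d; have cp1 := der_continuous d1.
have H : 0 <= phi x0 ^+ 3 - phi x0 + c.
  by apply: (second_derivative_min d d1) => //; cont.
rewrite lt_neqAle H andbT; apply/eqP => E.
have phi10 : phi1 x0 = 0.
  apply/eqP; rewrite -oppr_eq0; apply/eqP.
  by apply: (der_max (derN d)) => x /=; rewrite lerN2.
pose h x := phi x ^+ 2 + phi x * phi x0 + phi x0 ^+ 2 - 1.
have ch : cts h by rewrite /h; cont.
have [K K0 HK] := cts_bounded 0 (0 + L) ch.
have {}HK x : `|h x| <= K.
  have [|y yL ->] := @periodic_reduce _ h L 0 L0 _ x; last exact: HK.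
  by move=> y; rewrite /h p.
suff : (phi x1 - phi x0) ^+ 2 + phi1 x1 ^+ 2 <= 0.
  apply/negP; rewrite -ltNge ltr_wpDr ?sqr_ge0//.
  by rewrite lt_neqAle sqr_ge0 andbT eq_sym sqrf_eq0 subr_eq0.
rewrite (_ : 0 = ((phi x0 - phi x0) ^+ 2 + phi1 x0 ^+ 2 + 0 ^+ 2)
  * expR ((2 + K) * L)); last by rewrite subrr phi10 expr0n/= !addr0 mul0r.
apply: (@gronwall_periodic L (fun x => phi x - phi x0) phi1
  (fun x => phi x ^+ 3 - phi x + c)) => //.
- by move=> y; rewrite p.
- by eapply der_ext; [dert|move=> y _ /=; ring].
- move=> y; rewrite addr0.
  rewrite (_ : phi y ^+ 3 - phi y + c = h y * (phi y - phi x0)); last first.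
    by rewrite /h; move: E => /esym/eqP; rewrite addrC addr_eq0 => /eqP->; ring.
  by rewrite normrM ler_wpM2r.
Qed.

(* By conservation of energy, phi'^2 is a quartic in phi, namely
   (phi - a) (b - phi) G / 2 with a and b the extrema and G quadratic. With
   D = G + 2 s (phi - s / 2), the periodic function ln (k phi' / sqrt G + sqrt D),
   where k = sqrt 2, has derivative - (k / 2) y sqrt (G / D) with y = phi - s / 2,
   so that y sqrt (G / D) has zero mean. If s = a + b > 0, it is at most y, whose
   integral is - s L / 2 < 0. *)
Lemma profile_sum_le0 phi phi1 c xa xb : profile phi phi1 c ->
  (forall x, phi xa <= phi x) -> (forall x, phi x <= phi xb) ->
  phi xa < phi xb -> phi xa + phi xb <= 0.
Proof.
move=> P pa pb ab; have [d d1 p m] := P.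
have Pa : 0 < phi xa ^+ 3 - phi xa + c.
  by apply: (profile_min P) => //; exists xb; rewrite gt_eqF.
have Pb : phi xb ^+ 3 - phi xb + c < 0.
  have := @profile_min _ _ _ xb (profileN P).
  rewrite (_ : (- phi xb) ^+ 3 - - phi xb - c = - (phi xb ^+ 3 - phi xb + c)); last by ring.
  rewrite oppr_gt0; apply; first by move=> x; rewrite lerN2.
  by exists xa; rewrite eqr_opp lt_eqF.
have phib : phi1 xb = 0 by exact: (der_max d).
have phia : phi1 xa = 0.
  apply/eqP; rewrite -oppr_eq0; apply/eqP.
  by apply: (der_max (derN d)) => x /=; rewrite lerN2.
set a := phi xa in pa ab Pa *; set b := phi xb in pb ab Pb *.
set s := a + b; rewrite leNgt; apply/negP => s0.
pose e x := phi1 x ^+ 2 - (2^-1 * phi x ^+ 4 - phi x ^+ 2 + 2 * c * phi x).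
have eC x y : e x = e y.
  apply: der0_cst; rewrite /e; eapply der_ext; first by dert.
  by move=> z _ /=; field.
(* The first integral takes equal values at the two extrema, where phi' = 0; this equality is
   divided by b - a. *)
have cE : 2 * c = s - 2^-1 * s * (a ^+ 2 + b ^+ 2).
  have := eC xa xb; rewrite /e phia phib -/a -/b => E.
  have ba : b - a != 0 by rewrite subr_eq0 gt_eqF.
  apply: (mulfI ba); rewrite /s; move: E; lra.
(* The quartic has no cubic term, so the factor left beside (phi - a) (phi - b) has linear
   coefficient s; its constant term [mm] is read off from the coefficient of phi^2. *)
pose mm := s ^+ 2 - a * b - 2.
pose G x := - (phi x ^+ 2 + s * phi x + mm).
pose D x := - mm - s ^+ 2 + s * phi x - phi x ^+ 2.
have phi1E x : phi1 x ^+ 2 = 2^-1 * (phi x - a) * (b - phi x) * G x.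
  have := eC x xa; rewrite /e phia -/a.
  by rewrite cE /G /mm /s => E; lra.
have ba0 : 0 < b - a by rewrite subr_gt0.
have PaE : 4 * (a ^+ 3 - a + c) = (b - a) * - (a ^+ 2 + s * a + mm).
  by rewrite /mm /s in cE *; lra.
have PbE : 4 * (b ^+ 3 - b + c) = - ((b - a) * - (b ^+ 2 + s * b + mm)).
  by rewrite /mm /s in cE *; lra.
have Ga : 0 < - (a ^+ 2 + s * a + mm).
  by rewrite -(pmulr_rgt0 _ ba0) -PaE mulr_gt0.
have Gb : 0 < - (b ^+ 2 + s * b + mm).
  by rewrite -(pmulr_rgt0 _ ba0) -oppr_lt0 -PbE pmulr_rlt0.
have ge0 x : 0 <= (phi x - a) * (b - phi x) by rewrite mulr_ge0// subr_ge0.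
(* As a function of phi, G is concave, and phi'' > 0 at the minimum and phi'' < 0 at the maximum
   make it positive at both ends. *)
have G0 x : 0 < G x.
  rewrite -(pmulr_rgt0 _ ba0).
  rewrite (_ : _ * _ = (b - phi x) * - (a ^+ 2 + s * a + mm)
     + (phi x - a) * - (b ^+ 2 + s * b + mm)
     + (b - a) * ((phi x - a) * (b - phi x))); last by rewrite /G /s; ring.
  apply: ltr_wpDr; first by rewrite mulr_ge0// ltW.
  have := pa x; rewrite le_eqVlt => /predU1P[<-|ax].
    by rewrite subrr mul0r addr0 mulr_gt0.
  apply: ltr_wpDl; last by rewrite mulr_gt0// subr_gt0.
  by rewrite mulr_ge0 ?subr_ge0// ltW.
(* The left-hand side is 2 phi'^2 / G, so this says that k |phi'| / sqrt G < sqrt D, and the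
   argument of the logarithm is positive. *)
have D0 x : (phi x - a) * (b - phi x) < D x.
  rewrite -subr_gt0 (_ : _ - _ = 2^-1 * (- (a ^+ 2 + s * a + mm)
    - (b ^+ 2 + s * b + mm))); last by rewrite /D /mm /s; field.
  by rewrite mulr_gt0// addr_gt0.
have D0' x : 0 < D x by exact: le_lt_trans (ge0 x) (D0 x).
pose q x := Num.sqrt (G x); pose r x := Num.sqrt (D x).
have q0 x : 0 < q x by rewrite sqrtr_gt0.
have r0 x : 0 < r x by rewrite sqrtr_gt0.
have qn0 x : q x != 0 by rewrite gt_eqF.
have rn0 x : r x != 0 by rewrite gt_eqF.
have q2 x : q x ^+ 2 = G x by rewrite sqr_sqrtr// ltW.
have r2 x : r x ^+ 2 = D x by rewrite sqr_sqrtr// ltW.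
pose k : R := Num.sqrt 2.
have k0 : 0 < k by rewrite sqrtr_gt0.
have kn0 : k != 0 by rewrite gt_eqF.
have k2 : k ^+ 2 = 2 by rewrite sqr_sqrtr.
have dq : der setT q (fun x => (2 * q x)^-1 * - (2 * phi x * phi1 x + s * phi1 x)).
  eapply der_ext; first by eapply der_sqrt; [rewrite /G; dert|move=> x _; exact: G0].
  by move=> x _ /=; rewrite -/(G x) -/(q x); congr (_ * _); ring.
have dr : der setT r (fun x => (2 * r x)^-1 * (s * phi1 x - 2 * phi x * phi1 x)).
  eapply der_ext; first by eapply der_sqrt; [rewrite /D; dert|move=> x _; exact: D0'].
  by move=> x _ /=; rewrite -/(D x) -/(r x); congr (_ * _); ring.
pose B x := k * (phi1 x * (q x)^-1) + r x.
have B0 x : 0 < B x.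
  rewrite /B -ltrBlDl sub0r.
  apply: (@le_lt_trans _ _ `|k * (phi1 x * (q x)^-1)|).
    by rewrite lerNl lerNnormlW// normrN.
  rewrite -(@ltr_pXn2r _ 2)// ?nnegrE ?(ltW (r0 x))//.
  rewrite real_normK ?num_real// !exprMn k2 r2 phi1E exprVn q2.
  rewrite (_ : _ * _ = (phi x - a) * (b - phi x)); last first.
    by move: (lt0r_neq0 (G0 x)); generalize (G x) => gx gx0; field.
  exact: D0.
have Bn0 x : B x != 0 by rewrite gt_eqF.
pose y x := phi x - s / 2.
have dB0 : der setT B (fun x => - (k / 2) * (y x * (q x / r x)) * B x).
  rewrite /B; eapply der_ext.
    eapply derD; last exact: dr.
    eapply derM; first exact: der_cst.
    eapply derM; first exact: d1.
    by eapply derV; [exact: dq|move=> x _; exact: qn0].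
  move=> x _ /=.
  have E1 : (phi x ^+ 3 - phi x + c) * q x ^+ 2 + 2^-1 * phi1 x ^+ 2 * (2 * phi x + s)
      = - 2^-1 * y x * q x ^+ 4.
    rewrite phi1E (_ : q x ^+ 4 = (q x ^+ 2) ^+ 2); last by rewrite -exprM.
    rewrite q2 expr2 /G /y /mm.
    have -> : c = (s - 2^-1 * s * (a ^+ 2 + b ^+ 2)) / 2 by rewrite -cE; field.
    by rewrite /s; field.
  have E2 : (phi x ^+ 3 - phi x + c) =
      (- 2^-1 * y x * q x ^+ 4 - 2^-1 * phi1 x ^+ 2 * (2 * phi x + s)) / q x ^+ 2.
    by rewrite -E1; field; exact: qn0.
  rewrite E2 /y; have -> : (2 : R) = k ^+ 2 by rewrite k2.
  by field; rewrite ?qn0 ?rn0 ?kn0.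
have dB : der setT (fun x => ln (B x)) (fun x => - (k / 2) * (y x * (q x / r x))).
  eapply der_ext; first by eapply der_ln; [exact: dB0|move=> x _; exact: B0].
  by move=> x _ /=; rewrite mulrC mulfK.
have cp := der_continuous d; have cq := der_continuous dq.
have cr := der_continuous dr.
have cri : cts (fun x => (r x)^-1) by exact: continuousVr.
have cy : cts y by rewrite /y; cont.
have BL : periodic (fun x => ln (B x)) L.
  move=> x; rewrite /B /r /q /G /D !p; congr (ln (k * (_ / _) + _)).
  exact: (der_periodic d p).
have := cint_der L0 dB _ BL; rewrite cintZ; last by cont.
move=> yqr0; have {yqr0} := yqr0 ltac:(cont); move/eqP.
rewrite mulf_eq0 oppr_eq0 mulf_eq0 invr_eq0.
rewrite (negbTE kn0) pnatr_eq0/= => /eqP yqr0.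
(* Since D - G = 2 s y, the weight q / r is at most 1 where y >= 0 and at least 1 where y < 0. *)
have : J (fun x => y x * (q x / r x)) <= J y.
  apply: le_cint => //; first by cont.
  move=> x _; have [yx|yx] := leP 0 (y x).
    rewrite -[leRHS]mulr1 ler_wpM2l// ler_pdivrMr// mul1r.
    rewrite -(@ler_pXn2r _ 2)// ?nnegrE ?(ltW (q0 x)) ?(ltW (r0 x))//.
    rewrite q2 r2 -subr_ge0 (_ : _ - _ = 2 * s * y x); last by rewrite /D /G /y; field.
    by rewrite mulr_ge0// mulr_ge0// ltW.
  rewrite -[leRHS]mulr1 ler_wnM2l//; first exact: ltW.
  rewrite ler_pdivlMr// mul1r -(@ler_pXn2r _ 2)// ?nnegrE ?(ltW (q0 x)) ?(ltW (r0 x))//.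
  rewrite q2 r2 -subr_ge0 (_ : _ - _ = - (2 * s * y x)); last by rewrite /D /G /y; field.
  by rewrite oppr_ge0 ltW// pmulr_rlt0// mulr_gt0.
rewrite yqr0 /y cintB//; last by cont.
rewrite m cint_cst// sub0r oppr_ge0 leNgt mulr_gt0//.
by rewrite divr_gt0.
Qed.

End Profile.
End SteadyStates.

(** * A Lojasiewicz inequality near nonzero profiles *)

Section Lojasiewicz.
Context {R : realType} (L : R) (L0 : 0 < L).
Implicit Types (phi : R -> R).
Local Notation J := (cint L).

(** A nonzero profile with c = 0 oscillates between -b and b; [amplitude_der] is its first integral,
    with the constant fixed at the maximum point [x0]. *)
Record amplitude (phi phi1 : R -> R) (b x0 : R) : Prop := Amplitude {
  amplitude_gt0 : 0 < b;
  amplitude_lt1 : b < 1;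
  amplitude_max : phi x0 = b;
  amplitude_crit : phi1 x0 = 0;
  amplitude_bound : forall x, `|phi x| <= b;
  amplitude_der : forall x,
    phi1 x ^+ 2 = 2^-1 * (b ^+ 2 - phi x ^+ 2) * (2 - b ^+ 2 - phi x ^+ 2) }.

Lemma periodic_max f : cts f -> periodic f L -> exists x0, forall x, f x <= f x0.
Proof.
move=> cf fL.
have [c _ cmax] : exists2 c, c \in `[0, L]%R &
    forall t, t \in `[0, L]%R -> f t <= f c.
  apply: EVT_max; first exact: ltW.
  by apply: continuous_subspaceT => x; exact: cf.
exists c => x; have [y yL ->] := periodic_reduce 0 L0 fL x.
by apply: cmax; rewrite in_itv/= -[L]add0r.
Qed.

(** Applied to phi and to -phi, [profile_sum_le0] makes the extrema opposite; the first integral,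
    equal at both, then gives c b = 0. Strict concavity at the maximum gives b < 1. *)
Lemma profile_classification phi phi1 c : profile L phi phi1 c ->
  c = 0 /\ ((forall x, phi x = 0) \/ exists b x0, amplitude phi phi1 b x0).
Proof.
move=> P; have [d d1 p m] := P; have PN := profileN P.
have cp := der_continuous d.
have [xb pb] := periodic_max cp p.
have [xa pa'] := periodic_max (continuousNr cp) (profile_periodic PN).
have pa x : phi xa <= phi x by have := pa' x; rewrite lerN2.
have := pa xb; rewrite le_eqVlt => /predU1P[E|ab].
  have phC x : phi x = phi xa by apply/eqP; rewrite eq_le pa E pb.
  have ph0 : phi xa = 0.
    move: m; rewrite (eq_cint _ phC) cint_cst// => /eqP.
    by rewrite mulf_eq0 (gt_eqF L0) orbF => /eqP.
  have ph1 x : phi1 x = 0.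
    apply: (@der_uniq _ setT phi _ (fun=> 0) x I d).
    by rewrite (_ : phi = fun=> 0); [exact: der_cst|apply/funext => y; rewrite phC].
  split; last by left => x; rewrite phC.
  have : phi xa ^+ 3 - phi xa + c = 0.
    apply: (@der_uniq _ setT phi1 _ (fun=> 0) xa I d1).
    by rewrite (_ : phi1 = fun=> 0); [exact: der_cst|apply/funext => y; rewrite ph1].
  by rewrite ph0 expr0n/= subrr add0r.
have s1 := profile_sum_le0 L0 P pa pb ab.
have s2 : - phi xb + - phi xa <= 0.
  by apply: (profile_sum_le0 L0 PN) => [x|x|]; rewrite ?lerN2 ?ltrN2.
have ea : phi xa = - phi xb by lra.
have b0 : 0 < phi xb by lra.
have phib : phi1 xb = 0 by exact: (der_max d).
have phia : phi1 xa = 0.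
  apply/eqP; rewrite -oppr_eq0; apply/eqP.
  by apply: (der_max (derN d)) => x /=; rewrite lerN2.
pose e x := phi1 x ^+ 2 - (2^-1 * phi x ^+ 4 - phi x ^+ 2 + 2 * c * phi x).
have eC x y : e x = e y.
  apply: der0_cst; rewrite /e; eapply der_ext; first by dert.
  by move=> z _ /=; field.
have c0 : c = 0.
  have := eC xa xb; rewrite /e phia phib ea => E.
  have : c * phi xb = 0 by move: E; lra.
  by move/eqP; rewrite mulf_eq0 (gt_eqF b0) orbF => /eqP.
split => //; right; exists (phi xb), xb; split => //.
- have := @profile_min _ _ L0 _ _ _ xb PN.
  rewrite c0 oppr0 addr0 (_ : _ - _ = phi xb * (1 - phi xb ^+ 2)); last by ring.
  rewrite pmulr_rgt0// subr_gt0 => H.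
  rewrite -(@ltr_pXn2r _ 2) ?nnegrE ?(ltW b0)// expr1n; apply: H.
    by move=> x; rewrite lerN2.
  by exists xa; rewrite eqr_opp lt_eqF.
- by move=> x; rewrite ler_norml -ea pa pb.
- by move=> x; have := eC x xb; rewrite /e phib c0 => E; lra.
Qed.

(** A time slice of the flow, seen as a perturbed profile: the constant c becomes the potential m,
    and \int m2^2 measures how far m is from a constant. *)
Record state (U U1 m m1 m2 m3 : R -> R) : Prop := State {
  state_der : der setT U U1;
  state_der1 : der setT U1 (fun x => U x ^+ 3 - U x + m x);
  state_m : der setT m m1;
  state_m1 : der setT m1 m2;
  state_m2 : der setT m2 m3;
  state_m3 : cts m3;
  state_periodic : periodic U L;
  state_mean : J U = 0 }.

Lemma state_m_periodic U U1 m m1 m2 m3 : state U U1 m m1 m2 m3 -> periodic m L.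
Proof.
move=> [d d1 _ _ _ _ p _] x.
have := der_periodic d1 (der_periodic d p) x; rewrite p.
by move/addrI.
Qed.

Lemma state_m1_bound U U1 m m1 m2 m3 : state U U1 m m1 m2 m3 ->
  forall x, m1 x ^+ 2 <= L * J (fun x => m2 x ^+ 2).
Proof.
move=> S; have [d d1 dm dm1 dm2 cm3 p _] := S.
have mL := state_m_periodic S.
apply: (sobolev_sup L0 dm1 dm2 cm3); first exact: (der_periodic dm mL).
exact: (cint_der L0 dm (der_continuous dm1) mL).
Qed.

(** Only differences of values of m are controlled by m''; the number [m 0] must be bounded by other
    means. *)
Lemma state_m_oscillation U U1 m m1 m2 m3 : state U U1 m m1 m2 m3 ->
  forall x, `|m x - m 0| <= L * Num.sqrt (L * J (fun x => m2 x ^+ 2)).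
Proof.
move=> S x; have mL := state_m_periodic S.
have [y /andP[y0 yL] ->] := periodic_reduce 0 L0 mL x.
apply: (@le_trans _ _ (Num.sqrt (L * J (fun x => m2 x ^+ 2)) * (y - 0))).
  apply: (der_lipschitz y0 (fun _ _ => I) (state_m S)) => z _.
  by rewrite -sqrtr_sqr ler_wsqrtr// (state_m1_bound S).
by rewrite subr0 mulrC ler_wpM2r ?sqrtr_ge0//; lra.
Qed.

Definition energy (U U1 : R -> R) : R :=
  J (fun x => 2^-1 * U1 x ^+ 2 + 4^-1 * (U x ^+ 2 - 1) ^+ 2).

(* The difference w = U - phi solves w'' = (3 phi^2 - 1) w + g, where g is
   controlled by the dissipation and by w^2. The only obstruction to bounding w
   by g is the translation mode phi', and it is removed by U1 x0 = 0 at the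
   maximum x0 of phi: testing against 1 - phi^2 and phi bounds m 0 and the mean of
   phi^3 w, and the Wronskian of w and phi' then bounds w x0. *)
Section LinearEstimate.
Context (phi phi1 : R -> R) (b x0 : R) (U U1 m m1 m2 m3 : R -> R).
Hypotheses (P : profile L phi phi1 0) (A : amplitude phi phi1 b x0).
Hypotheses (S : state U U1 m m1 m2 m3) (U1x0 : U1 x0 = 0).
Let kappa := 1 - b ^+ 2.
Let w x := U x - phi x.
Let w1 x := U1 x - phi1 x.
Let eps0 := L * Num.sqrt (L * J (fun x => m2 x ^+ 2)).
Let g x := m x + 3 * phi x * w x ^+ 2 + w x ^+ 3.
Let Wr x := w1 x * phi1 x - w x * (phi x ^+ 3 - phi x).

Let dphi := profile_der P.
Let dphi1 : der setT phi1 (fun x => phi x ^+ 3 - phi x).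
Proof. by apply: (der_ext (profile_der1 P)) => x _; rewrite addr0. Qed.
Let dU := state_der S.
Let dU1 := state_der1 S.
Let cphi : cts phi := der_continuous dphi.
Let cphi1 : cts phi1 := der_continuous dphi1.
Let cU : cts U := der_continuous dU.
Let cU1 : cts U1 := der_continuous dU1.
Let cm : cts m := der_continuous (state_m S).
Let cw : cts w. Proof. by rewrite /w; cont. Qed.
Let cw1 : cts w1. Proof. by rewrite /w1; cont. Qed.
Let cg : cts g. Proof. by rewrite /g; cont. Qed.
Let phip := profile_periodic P.
Let phi1p : periodic phi1 L := der_periodic dphi phip.
Let wp : periodic w L. Proof. by move=> x; rewrite /w phip (state_periodic S). Qed.
Let w1p : periodic w1 L.
Proof. by move=> x; rewrite /w1 phi1p (der_periodic dU (state_periodic S)). Qed.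

Let dw : der setT w w1. Proof. by rewrite /w /w1; derr. Qed.
Let dw1 : der setT w1 (fun x => (3 * phi x ^+ 2 - 1) * w x + g x).
Proof.
rewrite /w1; eapply der_ext; first by dert.
by move=> x _ /=; rewrite /g /w; ring.
Qed.

Let kappa_gt0 : 0 < kappa.
Proof.
rewrite /kappa subr_gt0 -[1](expr1n _ 2) ltr_pXn2r ?nnegrE//.
  exact: amplitude_lt1 A.
by rewrite ltW // (amplitude_gt0 A).
Qed.

Let phi2b x : phi x ^+ 2 <= b ^+ 2.
Proof.
rewrite -(real_normK (num_real (phi x))) ler_sqr ?nnegrE ?(amplitude_bound A)//.
by rewrite ltW// (amplitude_gt0 A).
Qed.

Let phi_le1 x : `|phi x| <= 1.
Proof. exact: le_trans (amplitude_bound A x) (ltW (amplitude_lt1 A)). Qed.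

Let phi1_le1 x : `|phi1 x| <= 1.
Proof.
rewrite -(@ler_pXn2r _ 2)// ?nnegrE// real_normK ?num_real// (amplitude_der A) expr1n.
have := kappa_gt0; have := phi2b x; have := sqr_ge0 (phi x).
rewrite /kappa; set p := phi x ^+ 2; set q := b ^+ 2 => p0 pq q1.
apply: (@le_trans _ _ (2^-1 * 1 * 2)); last by lra.
by apply: ler_pM; rewrite ?mulr_ge0//; lra.
Qed.

Context (s : R).
Hypotheses (s0 : 0 <= s) (s1 : s <= 1) (ws : forall x, `|w x| <= s).

(** The bound for g: [eps0] for the oscillation of m, [4 * s ^+ 2] for the quadratic and cubic terms
    in w, and the share [kappa^-1] for [m 0]. *)
Let eps := (eps0 + 4 * s ^+ 2) * (1 + kappa^-1).

Let eps0_ge0 : 0 <= eps0.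
Proof. by rewrite /eps0 mulr_ge0 ?sqrtr_ge0// ltW. Qed.

Let small_term x : `|m x - m 0 + 3 * phi x * w x ^+ 2 + w x ^+ 3| <= eps0 + 4 * s ^+ 2.
Proof.
rewrite -addrA (le_trans (ler_normD _ _))// lerD ?(state_m_oscillation S)//.
rewrite (_ : _ + _ = (3 * phi x + w x) * w x ^+ 2); last by ring.
rewrite normrM (ger0_norm (sqr_ge0 (w x))).
apply: ler_pM => //; first exact: sqr_ge0.
  rewrite (le_trans (ler_normD _ _))// normrM ger0_norm//.
  have := phi_le1 x; have := le_trans (ws x) s1.
  by set p := `|phi x|; set q := `|w x|; lra.
rewrite -(real_normK (num_real (w x))) ler_sqr ?nnegrE//.
Qed.

(* The linearized operator maps 1 - phi^2 to a constant:
   (1 - phi^2)'' - (3 phi^2 - 1) (1 - phi^2) = kappa^2. *)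
Let m0_bound : `|m 0| <= (eps0 + 4 * s ^+ 2) / kappa.
Proof.
have dF : der setT (fun x => w1 x * (1 - phi x ^+ 2) + w x * (2 * phi x * phi1 x))
    (fun x => - kappa ^+ 2 * w x + (m 0 * (1 - phi x ^+ 2)
      + (m x - m 0 + 3 * phi x * w x ^+ 2 + w x ^+ 3) * (1 - phi x ^+ 2))).
  eapply der_ext; first by dert.
  move=> x _ /=; have E : w x * phi1 x ^+ 2 = w x *
      (2^-1 * (b ^+ 2 - phi x ^+ 2) * (2 - b ^+ 2 - phi x ^+ 2)).
    by rewrite (amplitude_der A).
  by rewrite /g /kappa; lra.
have Fp : periodic (fun x => w1 x * (1 - phi x ^+ 2) + w x * (2 * phi x * phi1 x)) L.
  by move=> x; rewrite w1p wp phip phi1p.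
have := cint_der L0 dF _ Fp; rewrite cintD; [|by cont|by cont].
rewrite cintZ// /w cintB// (state_mean S) (profile_mean P) subrr mulr0 add0r.
rewrite -/w cintD; [|by cont|by cont].
rewrite cintZ//; last by cont.
set a := J (fun x => 1 - phi x ^+ 2); set c := J _ => H.
have {}H : m 0 * a + c = 0 by apply: H; cont.
have cb : `|c| <= (eps0 + 4 * s ^+ 2) * L.
  rewrite /c; apply: cint_norm_le => //; first by cont.
  move=> x _; rewrite normrM -[leRHS]mulr1 ler_pM//.
  rewrite ger0_norm; have := phi2b x; have := kappa_gt0; rewrite /kappa.
    by have := sqr_ge0 (phi x); lra.
  by lra.
have ab : kappa * L <= a.
  rewrite -cint_cst//; apply: le_cint => //; [by cont|by cont|move=> x _].
  by rewrite /kappa lerD2l lerN2.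
rewrite ler_pdivlMr// -(ler_pM2r L0) -mulrA.
apply: (le_trans _ cb); rewrite (_ : c = - (m 0 * a)); last first.
  by apply/eqP; rewrite -addr_eq0 addrC H.
by rewrite normrN normrM ler_wpM2l// (le_trans ab)// ler_norm.
Qed.

Let eps_ge0 : 0 <= eps.
Proof.
apply: mulr_ge0; apply: addr_ge0 => //; first by rewrite mulr_ge0 ?sqr_ge0.
by rewrite invr_ge0 ltW.
Qed.

Let g_bound x : `|g x| <= eps.
Proof.
rewrite /g (_ : _ + _ = m 0 + (m x - m 0 + 3 * phi x * w x ^+ 2 + w x ^+ 3)); last by ring.
rewrite (le_trans (ler_normD _ _))// /eps mulrDr mulr1 [leRHS]addrC.
by apply: lerD.
Qed.

(** The linearized operator w'' - (3 phi^2 - 1) w maps phi to - 2 phi^3, so phi is used as test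
    function. *)
Let phi3w_bound : `|J (fun x => phi x ^+ 3 * w x)| <= 2^-1 * (eps * L).
Proof.
have dF : der setT (fun x => w1 x * phi x - w x * phi1 x)
    (fun x => 2 * (phi x ^+ 3 * w x) + g x * phi x).
  by derr.
have Fp : periodic (fun x => w1 x * phi x - w x * phi1 x) L.
  by move=> x; rewrite w1p wp phip phi1p.
have := cint_der L0 dF _ Fp; rewrite cintD; [|by cont|by cont].
rewrite cintZ; last by cont.
set a := J _; set c := J _ => H.
have {}H : 2 * a + c = 0 by apply: H; cont.
have cb : `|c| <= eps * L.
  rewrite /c; apply: cint_norm_le => //; first by cont.
  by move=> x _; rewrite normrM -[leRHS]mulr1 ler_pM.
rewrite (_ : a = 2^-1 * - c); last by lra.
by rewrite normrM normrN ger0_norm// ler_wpM2l.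
Qed.

(** Since phi' solves the homogeneous linearized equation, the Wronskian has derivative g phi'. *)
Let Wr_bound x : `|Wr x - Wr x0| <= eps * L.
Proof.
have dW : der setT Wr (fun x => g x * phi1 x) by rewrite /Wr; derr.
have Wp : periodic Wr L.
  by move=> y; rewrite /Wr w1p wp phip phi1p.
have [y /andP[y0 yL] ->] := periodic_reduce x0 L0 Wp x.
apply: (@le_trans _ _ (eps * (y - x0))).
  apply: (der_lipschitz y0 (fun _ _ => I) dW) => z _.
  by rewrite normrM -[leRHS]mulr1 ler_pM.
by rewrite ler_wpM2l//; lra.
Qed.

(** The factor 4 / b^2 comes from the lower bound on - \int h below, 1 / 2 from [phi3w_bound], and L
    / (2 kappa) from the variation of [Wr] times the supremum of |h|. *)
Let C1 := 4 / b ^+ 2 * (2^-1 + L / (2 * kappa)).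

(** [Wr] is constant up to [eps * L], so a weighted integral of it reveals its size. With the weight
    h, of constant sign, that integral equals - \int phi^3 w, which is already known to be small. *)
Let Wr_x0_bound : `|Wr x0| <= C1 * eps.
Proof.
pose G x := 2 - b ^+ 2 - phi x ^+ 2.
have Gk x : 2 * kappa <= G x by have := phi2b x; rewrite /G /kappa; lra.
have G0 x : 0 < G x by apply: lt_le_trans (Gk x); rewrite mulr_gt0.
have Gn0 x : G x != 0 by rewrite gt_eqF.
(* h is chosen so that (w phi1 h)' = Wr h + phi^3 w. *)
pose h x := - (2^-1 * (b ^+ 2 + phi x ^+ 2) * (G x)^-1).
have dG : der setT G (fun x => - (2 * phi x * phi1 x)) by rewrite /G; derr.
have cG := der_continuous dG.
have cGi : cts (fun x => (G x)^-1) by exact: continuousVr.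
have ch : cts h by rewrite /h; cont.
have b0 := amplitude_gt0 A; have b1 := amplitude_lt1 A.
have b20 : 0 < b ^+ 2 by rewrite exprn_gt0.
have b21 : b ^+ 2 <= 1 by have := kappa_gt0; rewrite /kappa; lra.
have dF : der setT (fun x => w x * phi1 x * h x)
    (fun x => Wr x * h x + phi x ^+ 3 * w x).
  rewrite /h; eapply der_ext.
    eapply derM; first by dert.
    eapply derN; eapply derM; first by dert.
    by eapply derV; [exact: dG|move=> x _; exact: Gn0].
  move=> x _ /=.
  have E : phi1 x ^+ 2 = 2^-1 * (b ^+ 2 - phi x ^+ 2) * G x by exact: (amplitude_der A).
  apply/eqP; rewrite -subr_eq0.
  have -> : phi x ^+ 3 = phi x - (2^-1 * phi x * (2 - 2 * phi x ^+ 2)) by field.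
  rewrite (_ : _ - _ = w x * phi x * (- (phi1 x ^+ 2) * (G x + (b ^+ 2 + phi x ^+ 2)) / G x ^+ 2
    - (phi x ^+ 2 - 1) * (b ^+ 2 + phi x ^+ 2) / G x - phi x ^+ 2)); last first.
    by rewrite /Wr; field; exact: Gn0.
  rewrite E (_ : G x + _ = 2); last by rewrite /G; ring.
  rewrite (_ : _ - phi x ^+ 2 = 0) ?mulr0//.
  apply: (mulfI (Gn0 x)); rewrite mulr0.
  transitivity (- (b ^+ 2 - phi x ^+ 2) - (phi x ^+ 2 - 1) * (b ^+ 2 + phi x ^+ 2)
    - phi x ^+ 2 * G x); last by rewrite /G; ring.
  by field; exact: Gn0.
have Fp : periodic (fun x => w x * phi1 x * h x) L.
  by move=> x; rewrite /h /G wp phip phi1p.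
have cWr : cts Wr by rewrite /Wr; cont.
have := cint_der L0 dF _ Fp; rewrite cintD; [|by cont|by cont].
have -> : J (fun x => Wr x * h x) = Wr x0 * J h + J (fun x => (Wr x - Wr x0) * h x).
  rewrite -cintZ// -cintD; [|by cont|by cont].
  by apply: eq_cint => x; ring.
set a := J h; set c := J (fun x => (Wr x - Wr x0) * h x).
set e := J (fun x => phi x ^+ 3 * w x) => H.
have {}H : Wr x0 * a + c + e = 0 by apply: H; cont.
have ab : b ^+ 2 / 4 * L <= - a.
  rewrite -cintN//; rewrite -cint_cst//; apply: le_cint => //; [by cont|by cont|move=> x _].
  rewrite /h opprK ler_pdivlMr//; have := Gk x; have := sqr_ge0 (phi x); rewrite /G => p1 p2.
  apply: (@le_trans _ _ (b ^+ 2 / 4 * 2)); last by lra.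
  by rewrite ler_wpM2l; lra.
have hb x : `|h x| <= (2 * kappa)^-1.
  rewrite /h normrN ger0_norm; last first.
    by rewrite mulr_ge0 ?invr_ge0 ?(ltW (G0 x))// mulr_ge0// addr_ge0// sqr_ge0.
  rewrite -[leRHS]mul1r ler_pM//.
  - by rewrite mulr_ge0// addr_ge0// sqr_ge0.
  - by rewrite invr_ge0 ltW.
  - by have := phi2b x; lra.
  - by rewrite lef_pV2 ?posrE ?mulr_gt0.
have cb : `|c| <= eps * L / (2 * kappa) * L.
  rewrite /c; apply: cint_norm_le => //; first by cont.
  by move=> x _; rewrite normrM ler_pM.
have E : `|Wr x0| * - a <= 2^-1 * (eps * L) + eps * L / (2 * kappa) * L.
  rewrite -[- a]ger0_norm; last by rewrite (le_trans _ ab)// mulr_ge0 ?ltW// divr_gt0.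
  rewrite -normrM (_ : Wr x0 * - a = e + c); last by move: H; lra.
  by rewrite (le_trans (ler_normD _ _))// lerD.
have {}E : `|Wr x0| * (b ^+ 2 / 4 * L) <= 2^-1 * (eps * L) + eps * L / (2 * kappa) * L.
  by apply: le_trans E; rewrite ler_wpM2l.
have k0 : kappa != 0 by rewrite gt_eqF.
rewrite -(@ler_pM2r _ (b ^+ 2 / 4 * L)); last by rewrite !mulr_gt0.
rewrite (le_trans E)// /C1 le_eqVlt; apply/orP; left; apply/eqP.
by field; rewrite k0 gt_eqF.
Qed.

Let C2 := C1 / (b * kappa).

(** At the maximum point phi' = 0, so the Wronskian reduces to - w phi'', with phi'' = - b kappa
    there. *)
Let w_x0_bound : `|w x0| <= C2 * eps.
Proof.
have b0 := amplitude_gt0 A.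
have bk : 0 < b * kappa by rewrite mulr_gt0.
have := Wr_x0_bound; rewrite /Wr (amplitude_crit A) (amplitude_max A) mulr0 sub0r.
rewrite (_ : - (w x0 * (b ^+ 3 - b)) = w x0 * (b * kappa)); last by rewrite /kappa; ring.
rewrite normrM (ger0_norm (ltW bk)) -ler_pdivlMr// => H.
by rewrite (le_trans H)// /C2 mulrAC.
Qed.

(** At [x0] the Cauchy data of w are (w x0, 0), both under control, and Gronwall spreads the bound
    from there. The nonlinear terms survive only as s^4, the square of a quadratic error. *)
Lemma linear_estimate_step x :
  w x ^+ 2 + w1 x ^+ 2 <= (C2 ^+ 2 + 1) * (1 + kappa^-1) ^+ 2 * expR ((2 + 2) * L)
    * (2 * (L ^+ 3 * J (fun x => m2 x ^+ 2) + 16 * s ^+ 4)).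
Proof.
have q2 y : `|(3 * phi y ^+ 2 - 1) * w y + g y| <= 2 * `|w y| + eps.
  rewrite (le_trans (ler_normD _ _))// lerD// normrM ler_wpM2r//.
  have := phi2b y; have := sqr_ge0 (phi y); have := kappa_gt0; rewrite /kappa => k p1 p2.
  by rewrite ler_norml; apply/andP; split; lra.
have two0 : (0 : R) <= 2 by [].
apply: (le_trans (gronwall_periodic x0 x L0 wp two0 eps_ge0 dw dw1 q2)).
rewrite [w1 x0]/w1 U1x0 (amplitude_crit A) subrr expr0n/= addr0.
set D := J _; set e := expR _.
have D0 : 0 <= D by apply: cint_ge0 => y _; exact: sqr_ge0.
have e0 : 0 <= e by exact: expR_ge0.
have eps0E : eps0 ^+ 2 = L ^+ 3 * D.
  by rewrite /eps0 exprMn sqr_sqrtr ?mulr_ge0 ?(ltW L0)// -/D; ring.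
have eps2 : eps ^+ 2 <= (1 + kappa^-1) ^+ 2 * (2 * (L ^+ 3 * D + 16 * s ^+ 4)).
  rewrite /eps exprMn mulrC ler_wpM2l ?sqr_ge0// -eps0E.
  have := sqr_ge0 (eps0 - 4 * s ^+ 2).
  by rewrite (_ : s ^+ 4 = (s ^+ 2) ^+ 2); [set t := s ^+ 2; lra|ring].
have w2 : w x0 ^+ 2 <= C2 ^+ 2 * eps ^+ 2.
  rewrite -exprMn -(real_normK (num_real (w x0))) ler_sqr ?nnegrE//.
  exact: le_trans (normr_ge0 _) w_x0_bound.
rewrite mulrAC ler_wpM2r//.
apply: (@le_trans _ _ ((C2 ^+ 2 + 1) * eps ^+ 2)); first by lra.
by rewrite -[leRHS]mulrA ler_wpM2l// addr_ge0 ?sqr_ge0.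
Qed.

End LinearEstimate.

Lemma state_difference_max phi phi1 U U1 m m1 m2 m3 c :
  profile L phi phi1 c -> state U U1 m m1 m2 m3 ->
  exists x0, forall x, `|U x - phi x| <= `|U x0 - phi x0|.
Proof.
move=> P S; apply: (@periodic_max (fun x => `|U x - phi x|)).
  have cU := der_continuous (state_der S); have cphi := der_continuous (profile_der P).
  by cont.
by move=> x; rewrite (state_periodic S) (profile_periodic P).
Qed.

(** The constants depend on b and L only, and so serve all translates of phi at once. The nonlinear
    error is absorbed at the point where |U - phi| is largest. *)
Lemma linear_estimate (b : R) : 0 < b -> b < 1 ->
  exists C sigma : R, [/\ 0 < C, 0 < sigma & forall phi phi1 x0 U U1 m m1 m2 m3,
    profile L phi phi1 0 -> amplitude phi phi1 b x0 -> state U U1 m m1 m2 m3 ->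
    U1 x0 = 0 -> (forall x, `|U x - phi x| <= sigma) ->
    forall x, (U x - phi x) ^+ 2 + (U1 x - phi1 x) ^+ 2 <=
      C * J (fun y => m2 y ^+ 2)].
Proof.
move=> b0 b1.
pose kappa := 1 - b ^+ 2.
have kappa0 : 0 < kappa.
  by rewrite /kappa subr_gt0 -[1](expr1n _ 2) ltr_pXn2r ?nnegrE// ltW.
pose C1 := 4 / b ^+ 2 * (2^-1 + L / (2 * kappa)).
pose C2 := C1 / (b * kappa).
pose C3 := (C2 ^+ 2 + 1) * (1 + kappa^-1) ^+ 2 * expR ((2 + 2) * L).
have C30 : 0 < C3.
  apply: mulr_gt0; last exact: expR_gt0.
  apply: mulr_gt0; first by rewrite ltr_wpDl ?sqr_ge0.
  by apply: exprn_gt0; apply: addr_gt0 => //; rewrite invr_gt0.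
(* For s <= sigma this gives 32 C3 s^4 <= s^2 / 2. At the maximum point of |w| it follows that s^2
   <= 4 C3 L^3 D, and the same bound then holds at every x. *)
pose sigma := Num.min 1 (64 * C3)^-1.
have sigma0 : 0 < sigma by rewrite lt_min ltr01 invr_gt0 mulr_gt0.
have sigma1 : sigma <= 1 by rewrite ge_min lexx.
have sigmaC : 64 * C3 * sigma <= 1.
  have C364 : 0 < 64 * C3 by rewrite mulr_gt0.
  have : sigma <= (64 * C3)^-1 by rewrite ge_min lexx orbT.
  by rewrite -(ler_pM2l C364) divff ?gt_eqF.
exists (4 * C3 * L ^+ 3), sigma; split => //.
  by apply: mulr_gt0; [apply: mulr_gt0|exact: exprn_gt0].
move=> phi phi1 x0 U U1 m m1 m2 m3 P A S U1x0 Us.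
have [xs Hxs] := state_difference_max P S.
set s := `|U xs - phi xs| in Hxs.
have s0 : 0 <= s by exact: normr_ge0.
have ss : s <= sigma by exact: Us.
have s1 : s <= 1 by exact: le_trans ss sigma1.
have step x := linear_estimate_step P A S U1x0 s0 s1 Hxs x.
move: step; rewrite -/kappa -/C1 -/C2 -/C3.
set D := J _ => step.
have s4 : 32 * C3 * s ^+ 4 <= 2^-1 * s ^+ 2.
  rewrite (_ : s ^+ 4 = s ^+ 2 * s ^+ 2); last by ring.
  rewrite mulrA ler_wpM2r ?sqr_ge0//.
  have h : s ^+ 2 <= sigma by rewrite expr2 (le_trans _ ss)// ler_piMl.
  have := ler_wpM2l (ltW C30) h; move: sigmaC.
  by set t := s ^+ 2; set r := C3 * sigma => H1 H2; rewrite /r in H2; lra.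
have s2 : s ^+ 2 <= 4 * C3 * L ^+ 3 * D.
  have := step xs; rewrite -(real_normK (num_real (U xs - phi xs))) -/s.
  have := sqr_ge0 (U1 xs - phi1 xs).
  by move: s4; set t := s ^+ 2; set v := s ^+ 4; set r := (U1 xs - phi1 xs) ^+ 2; lra.
move=> x; have := step x.
by move: s4 s2; set t := s ^+ 2; set v := s ^+ 4; lra.
Qed.

(** Exact Taylor expansion of the energy at phi; the first-order term is the derivative of phi' (U -
    phi) and integrates to zero. *)
Lemma energyE_gap phi phi1 c U U1 m m1 m2 m3 :
  profile L phi phi1 c -> c = 0 -> state U U1 m m1 m2 m3 ->
  energy U U1 - energy phi phi1 = J (fun x => 2^-1 * (U1 x - phi1 x) ^+ 2
    + (2^-1 * (3 * phi x ^+ 2 - 1) + phi x * (U x - phi x)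
       + 4^-1 * (U x - phi x) ^+ 2) * (U x - phi x) ^+ 2).
Proof.
move=> P c0 S; rewrite /energy.
have dphi := profile_der P; have dphi1 := profile_der1 P.
have dU := state_der S; have dU1 := state_der1 S.
have cphi := der_continuous dphi; have cphi1 := der_continuous dphi1.
have cU := der_continuous dU; have cU1 := der_continuous dU1.
have H : J (fun x => (phi x ^+ 3 - phi x) * (U x - phi x) + phi1 x * (U1 x - phi1 x)) = 0.
  apply: (@cint_der _ _ L0 (fun x => phi1 x * (U x - phi x))).
  - eapply der_ext; first by dert.
    by move=> x _ /=; rewrite c0; ring.
  - by cont.
  - move=> x; rewrite (der_periodic dphi (profile_periodic P)).
    by rewrite (state_periodic S) (profile_periodic P).
rewrite -cintB; [|by cont|by cont].
rewrite -[LHS]subr0 -H -cintB; [|by cont|by cont].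
by apply: eq_cint => x; field.
Qed.

(** The energy gap is quadratic in w and w', with coefficients at most 3, and [linear_estimate]
    bounds these squares by the dissipation. *)
Lemma lojasiewicz_crit (b : R) : 0 < b -> b < 1 ->
  exists C sigma : R, [/\ 0 < C, 0 < sigma & forall phi phi1 x0 U U1 m m1 m2 m3,
    profile L phi phi1 0 -> amplitude phi phi1 b x0 -> state U U1 m m1 m2 m3 ->
    U1 x0 = 0 -> (forall x, `|U x - phi x| <= sigma) ->
    energy U U1 - energy phi phi1 <= C * J (fun y => m2 y ^+ 2)].
Proof.
move=> b0 b1; have [C [sigma [C0 sigma0 H]]] := linear_estimate b0 b1.
exists (3 * C * L), (Num.min sigma 1); split.
- by rewrite !mulr_gt0.
- by rewrite lt_min sigma0 ltr01.
move=> phi phi1 x0 U U1 m m1 m2 m3 P A S U1x0 Us.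
have Us1 x : `|U x - phi x| <= sigma by have := Us x; rewrite le_min => /andP[].
have Us2 x : `|U x - phi x| <= 1 by have := Us x; rewrite le_min => /andP[].
have {}H := H _ _ _ _ _ _ _ _ _ P A S U1x0 Us1.
rewrite (energyE_gap P erefl S) (_ : 3 * C * L * _ = 3 * (C * J (fun y => m2 y ^+ 2)) * L); last by ring.
rewrite -cint_cst//.
have cphi := der_continuous (profile_der P); have cphi1 := der_continuous (profile_der1 P).
have cU := der_continuous (state_der S); have cU1 := der_continuous (state_der1 S).
apply: le_cint => //; [by cont|by cont|move=> x _].
apply: (le_trans _ (ler_wpM2l (ler0n _ 3) (H x))).
have phi1' : `|phi x| <= 1 by exact: le_trans (amplitude_bound A x) (ltW b1).
have := sqr_ge0 (U1 x - phi1 x); have := sqr_ge0 (U x - phi x).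
have : 2^-1 * (3 * phi x ^+ 2 - 1) + phi x * (U x - phi x) + 4^-1 * (U x - phi x) ^+ 2 <= 3.
  have h1 : phi x ^+ 2 <= 1.
    by rewrite -(real_normK (num_real (phi x))) -[leRHS](expr1n _ 2) ler_sqr ?nnegrE.
  have h2 : (U x - phi x) ^+ 2 <= 1.
    by rewrite -(real_normK (num_real (U x - phi x))) -[leRHS](expr1n _ 2) ler_sqr ?nnegrE.
  have h3 : phi x * (U x - phi x) <= 1.
    rewrite (le_trans (ler_norm _))// normrM -[leRHS]mulr1 ler_pM//.
  by lra.
set t := (U x - phi x) ^+ 2; set r := (U1 x - phi1 x) ^+ 2; set q := 2^-1 * _ + _ + _.
move=> q3 t0 r0; have := ler_wpM2r t0 q3.
by set v := q * t; lra.
Qed.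

Lemma profile_shift phi phi1 c (h : R) : profile L phi phi1 c ->
  profile L (fun x => phi (x + h)) (fun x => phi1 (x + h)) c.
Proof.
move=> P; have [d d1 p m] := P; split.
- exact: der_shift.
- exact: (der_shift h d1).
- by move=> x; rewrite addrAC p.
- by rewrite (cint_shift L0 h d)//; exact: der_continuous d1.
Qed.

Lemma energy_shift phi phi1 c (h : R) : profile L phi phi1 c ->
  energy (fun x => phi (x + h)) (fun x => phi1 (x + h)) = energy phi phi1.
Proof.
move=> P; have [d d1 p m] := P; have p1 := der_periodic d p.
have c0 := der_continuous d; have c1 := der_continuous d1.
rewrite /energy (@cint_shift _ _ L0
  (fun x => 2^-1 * phi1 x ^+ 2 + 4^-1 * (phi x ^+ 2 - 1) ^+ 2)
  (fun x => phi1 x * (2 * (phi x ^+ 3 - phi x) + c)))//.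
- eapply der_ext; first by dert.
  by move=> x _ /=; field.
- by cont.
- by move=> x; rewrite p p1.
Qed.

(* U1 vanishes near x0, so that after a small translation of phi the maximum of
   phi is a critical point of U; this fixes the translation mode. *)
Lemma lojasiewicz_near phi phi1 b x0 :
  profile L phi phi1 0 -> amplitude phi phi1 b x0 ->
  exists C rho : R, [/\ 0 < C, 0 < rho & forall U U1 m m1 m2 m3,
    state U U1 m m1 m2 m3 -> (forall x, `|U x - phi x| <= rho) ->
    (forall x, `|U1 x - phi1 x| <= rho) ->
    energy U U1 - energy phi phi1 <= C * J (fun y => m2 y ^+ 2)].
Proof.
move=> P A; have b0 := amplitude_gt0 A; have b1 := amplitude_lt1 A.
have [C [sigma [C0 sigma0 H]]] := lojasiewicz_crit b0 b1.
have [d d1 p _] := P; have cphi := der_continuous d; have cphi1 := der_continuous d1.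
have bb : b ^+ 3 - b < 0.
  rewrite (_ : _ - _ = - (b * (1 - b ^+ 2))); last by ring.
  by rewrite oppr_lt0 mulr_gt0// subr_gt0 -[1](expr1n _ 2) ltr_pXn2r ?nnegrE// ltW.
have c2 : continuous (fun x => phi x ^+ 3 - phi x).
  have : cts (fun x => phi x ^+ 3 - phi x) by cont.
  by [].
have : phi x0 ^+ 3 - phi x0 < 0 by rewrite (amplitude_max A).
move=> neg; have /cvgr_lt /(_ 0 neg) := c2 x0.
case/nbhs_ballP => r /= r0 Hr.
have [M M0 HM] := cts_bounded 0 (0 + L) cphi1.
have {}HM x : `|phi1 x| <= M.
  have [y yL ->] := periodic_reduce 0 L0 (der_periodic d p) x.
  exact: HM.
(* The first bound keeps phi'' negative within distance [del] of [x0]; the second makes a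
   translation of phi by at most [del] cost at most sigma / 2 in sup norm. *)
pose del := Num.min (r / 2) (sigma / (2 * (M + 1))).
have del0 : 0 < del by rewrite lt_min !divr_gt0// mulr_gt0//; lra.
have delr : del < r by rewrite gt_min; apply/orP; left; lra.
have delM : M * del <= sigma / 2.
  have : (M + 1) * del <= sigma / 2.
    rewrite mulrC -ler_pdivlMr; last by lra.
    by rewrite ge_min -mulrA invfM [2^-1 * _]mulrC lexx orbT.
  by move: del0; lra.
have Hr' x : `|x - x0| < r -> phi x ^+ 3 - phi x < 0.
  by move=> xr; apply: Hr; rewrite /ball/= distrC.
have left_pos : 0 < phi1 (x0 - del).
  have ll : x0 - del < x0 by rewrite gtrDl oppr_lt0.
  have [z /andP[z1 z2] zE] := der_mvt ll (fun _ _ => I) d1.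
  have : phi z ^+ 3 - phi z < 0 by apply: Hr'; rewrite ltr_norml; apply/andP; split; lra.
  move: zE; rewrite (amplitude_crit A) addr0 opprB addrCA subrr addr0 sub0r => zE h.
  by rewrite -oppr_lt0 zE pmulr_llt0.
have right_neg : phi1 (x0 + del) < 0.
  have ll : x0 < x0 + del by rewrite ltrDl.
  have [z /andP[z1 z2] zE] := der_mvt ll (fun _ _ => I) d1.
  have : phi z ^+ 3 - phi z < 0 by apply: Hr'; rewrite ltr_norml; apply/andP; split; lra.
  move: zE; rewrite (amplitude_crit A) addr0 subr0 addrAC subrr add0r => zE h.
  by rewrite zE pmulr_llt0.
(* At half the size of phi' at the points x0 - del and x0 + del, a perturbation cannot change the
   sign of [U1] there, so [U1] has a zero in between. *)
pose rho := Num.min (sigma / 2) (Num.min (phi1 (x0 - del)) (- phi1 (x0 + del)) / 2).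
exists C, rho; split => //.
  by rewrite lt_min !divr_gt0// lt_min left_pos oppr_gt0.
move=> U U1 m m1 m2 m3 S Ur U1r.
have rs : rho <= sigma / 2 by rewrite ge_min lexx.
have rl : rho <= phi1 (x0 - del) / 2.
  by rewrite ge_min; apply/orP; right; rewrite ler_pM2r ?invr_gt0// ge_min lexx.
have rr : rho <= - phi1 (x0 + del) / 2.
  by rewrite ge_min; apply/orP; right; rewrite ler_pM2r ?invr_gt0// ge_min lexx orbT.
have [z zI U1z] : exists2 z, z \in `[x0 - del, x0 + del]%R & U1 z = 0.
  have cU1 := der_continuous (state_der1 S).
  have dd : x0 - del <= x0 + del by lra.
  apply: (IVT dd); first by apply: continuous_subspaceT => x; exact: cU1.
  have := U1r (x0 - del); have := U1r (x0 + del); rewrite !ler_norml => /andP[h1 h2] /andP[h3 h4].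
  by rewrite ge_min le_max; apply/andP; split; apply/orP; [right|left]; lra.
pose h := x0 - z.
have Ph := profile_shift h P.
have Ah : amplitude (fun x => phi (x + h)) (fun x => phi1 (x + h)) b z.
  have hz : z + h = x0 by rewrite /h addrC subrK.
  split.
  - exact: b0.
  - exact: b1.
  - by rewrite hz (amplitude_max A).
  - by rewrite hz (amplitude_crit A).
  - by move=> x; exact: (amplitude_bound A).
  - by move=> x; exact: (amplitude_der A).
have hd : `|h| <= del.
  by move: zI; rewrite in_itv/= /h => /andP[z1 z2]; rewrite ler_norml; apply/andP; split; lra.
rewrite -(energy_shift h P).
apply: (H _ _ _ _ _ _ _ _ _ Ph Ah S U1z) => x.
rewrite (_ : _ - _ = (U x - phi x) + (phi x - phi (x + h))); last by ring.
rewrite (le_trans (ler_normD _ _))// [sigma]splitr lerD ?(le_trans (Ur x))//.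
apply: (@le_trans _ _ (M * `|h|)); last by rewrite (le_trans _ delM)// ler_wpM2l.
have [h0|h0] := leP 0 h.
  rewrite distrC (ger0_norm h0).
  have xh : x <= x + h by rewrite lerDl.
  have := der_lipschitz xh (fun _ _ => I) d (fun y _ => HM y).
  by rewrite [x + h - x]addrAC subrr add0r.
rewrite (ltr0_norm h0).
have xh : x + h <= x by rewrite gerDl ltW.
have := der_lipschitz xh (fun _ _ => I) d (fun y _ => HM y).
by rewrite (_ : x - (x + h) = - h)//; ring.
Qed.

End Lojasiewicz.

(** * Energy and second-order estimates along the flow *)

Section Flow.
Context {R : realType} (L : R) (L0 : 0 < L).
Local Notation J := (cint L).

Section Potential.
Context (U : nat -> R -> R -> R).
(** [U j] stands for the j-th space derivative of u; [mu0] to [mu4] are m, m', ..., m'''' as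
    polynomials in these. *)
Definition mu0 t x := U 2 t x - (U 0 t x ^+ 3 - U 0 t x).
Definition mu1 t x := U 3 t x - (3 * U 0 t x ^+ 2 - 1) * U 1 t x.
Definition mu2 t x := U 4 t x - (3 * U 0 t x ^+ 2 - 1) * U 2 t x
  - 6 * U 0 t x * U 1 t x ^+ 2.
Definition mu3 t x := U 5 t x - (3 * U 0 t x ^+ 2 - 1) * U 3 t x
  - 18 * U 0 t x * U 1 t x * U 2 t x - 6 * U 1 t x ^+ 3.
Definition mu4 t x := U 6 t x - (3 * U 0 t x ^+ 2 - 1) * U 4 t x
  - 24 * U 0 t x * U 1 t x * U 3 t x - 18 * U 0 t x * U 2 t x ^+ 2
  - 36 * U 1 t x ^+ 2 * U 2 t x.
Definition dissipation t := J (fun x => mu2 t x ^+ 2).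
Definition flow_energy t := energy L (U 0 t) (U 1 t).
End Potential.

(** What the energy method takes from a solution: space derivatives up to order six at positive
    times, and a time derivative of [U 0] alone. *)
Record flow (U : nat -> R -> R -> R) : Prop := Flow {
  flow_der : forall t j, 0 < t -> (j < 6)%N -> der setT (U j t) (U j.+1 t);
  flow_jc : forall t j, 0 < t -> (j <= 6)%N -> jointly_continuous t (U j);
  flow_eq : forall x, der [set t | 0 < t] (fun t => U 0 t x) (fun t => mu4 U t x);
  flow_periodic : forall t, 0 < t -> periodic (U 0 t) L;
  flow_mean : forall t, 0 < t -> J (U 0 t) = 0 }.

Context (U : nat -> R -> R -> R) (F : flow U).
Local Notation D := (dissipation U).
Local Notation E := (flow_energy U).

Lemma flow_cts t j : 0 < t -> (j <= 6)%N -> cts (U j t).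
Proof. by move=> t0 j6; exact: jc_cts (flow_jc F t0 j6). Qed.

Section FixedTime.
Context (t : R) (t0 : 0 < t).
Let d0 : der setT (U 0 t) (U 1 t) := flow_der F t0 (isT : (0 < 6)%N).
Let d1 : der setT (U 1 t) (U 2 t) := flow_der F t0 (isT : (1 < 6)%N).
Let d2 : der setT (U 2 t) (U 3 t) := flow_der F t0 (isT : (2 < 6)%N).
Let d3 : der setT (U 3 t) (U 4 t) := flow_der F t0 (isT : (3 < 6)%N).
Let d4 : der setT (U 4 t) (U 5 t) := flow_der F t0 (isT : (4 < 6)%N).
Let d5 : der setT (U 5 t) (U 6 t) := flow_der F t0 (isT : (5 < 6)%N).

Lemma der_mu0 : der setT (mu0 U t) (mu1 U t).
Proof. by unfold mu0, mu1; derr. Qed.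
Lemma der_mu1 : der setT (mu1 U t) (mu2 U t).
Proof. by unfold mu1, mu2; derr. Qed.
Lemma der_mu2 : der setT (mu2 U t) (mu3 U t).
Proof. by unfold mu2, mu3; derr. Qed.
Lemma der_mu3 : der setT (mu3 U t) (mu4 U t).
Proof. by unfold mu3, mu4; derr. Qed.

Lemma cts_mu4 : cts (mu4 U t).
Proof.
have [c0 c1 c2] : [/\ cts (U 0 t), cts (U 1 t) & cts (U 2 t)].
  by split; apply: flow_cts.
have [c3 c4 c6] : [/\ cts (U 3 t), cts (U 4 t) & cts (U 6 t)].
  by split; apply: flow_cts.
by unfold mu4; cont.
Qed.

Lemma flow_periodic_jet j : (j <= 6)%N -> periodic (U j t) L.
Proof.
elim: j => [_|j IH j6]; first exact: (flow_periodic F).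
by apply: (der_periodic (flow_der F t0 j6)); apply: IH; exact: ltnW.
Qed.

Lemma flow_state : state L (U 0 t) (U 1 t) (mu0 U t) (mu1 U t) (mu2 U t) (mu3 U t).
Proof.
split.
- exact: d0.
- by apply: (der_ext d1) => x _; rewrite /mu0; ring.
- exact: der_mu0.
- exact: der_mu1.
- exact: der_mu2.
- exact: der_continuous der_mu3.
- exact: (flow_periodic F).
- exact: (flow_mean F).
Qed.

Let mu0_periodic : periodic (mu0 U t) L := state_m_periodic flow_state.
Let mu1_periodic : periodic (mu1 U t) L := der_periodic der_mu0 mu0_periodic.
Let mu2_periodic : periodic (mu2 U t) L := der_periodic der_mu1 mu1_periodic.
Let mu3_periodic : periodic (mu3 U t) L := der_periodic der_mu2 mu2_periodic.
Let cmu0 := der_continuous der_mu0.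
Let cmu1 := der_continuous der_mu1.
Let cmu2 := der_continuous der_mu2.
Let cmu3 := der_continuous der_mu3.
Let cmu4 := cts_mu4.

(** Two integrations by parts at once: z m''' - z' m'' is a primitive of the difference of the
    integrands. *)
Lemma cint_mu4_test z z1 z2 : der setT z z1 -> der setT z1 z2 -> cts z2 ->
  periodic z L -> J (fun x => z x * mu4 U t x) = J (fun x => z2 x * mu2 U t x).
Proof.
move=> dz dz1 cz2 zp; have z1p := der_periodic dz zp.
have cz := der_continuous dz; have cz1 := der_continuous dz1.
have h0 := der_mu0; have h1 := der_mu1; have h2 := der_mu2; have h3 := der_mu3.
apply/eqP; rewrite -subr_eq0 -cintB; [|by cont|by cont]; apply/eqP.
apply: (@cint_der _ _ L0 (fun x => z x * mu3 U t x - z1 x * mu2 U t x)).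
- by derr.
- by cont.
- by move=> x; rewrite zp z1p mu3_periodic mu2_periodic.
Qed.

Lemma dissipation_ge0 : 0 <= D t.
Proof. by apply: cint_ge0 => x _; exact: sqr_ge0. Qed.

Lemma mu1_l2 : J (fun x => mu1 U t x ^+ 2) <= L ^+ 2 * D t.
Proof.
apply: (poincare L0 der_mu1 der_mu2 cmu3 mu1_periodic).
exact: (cint_der L0 der_mu0 cmu1 mu0_periodic).
Qed.

Lemma mu4_jc : jointly_continuous t (mu4 U).
Proof.
have j i (i6 : (i <= 6)%N) := flow_jc F t0 i6.
have j0 := j 0 isT; have j1 := j 1 isT; have j2 := j 2 isT.
have j3 := j 3 isT; have j4 := j 4 isT; have j6 := j 6 isT.
by unfold mu4; jcont.
Qed.

Lemma flow_functional_is_derive (K : R -> R -> R) (Q : R -> R) :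
  (forall s, 0 < s -> cts (K s)) -> jointly_continuous t K ->
  (forall s, 0 < s -> Q s - Q t = J (fun x => K s x * (U 0 s x - U 0 t x))) ->
  is_derive t 1 Q (J (fun x => K t x * mu4 U t x)).
Proof.
move=> cK jK QE.
apply: (@parametric_is_derive _ L L0 [set s | 0 < s] (U 0) (mu4 U) K _ t t) => //.
- by move=> s /=; rewrite ltr_norml => /andP[h _]; lra.
- exact: (flow_eq F).
- by move=> s s0; exact: flow_cts.
- exact: mu4_jc.
Qed.

(** The basis of all drift estimates: tested against a fixed z, the time derivative of u involves
    only z'' and m'', the latter being what the dissipation measures. *)
Lemma pairing_is_derive z z1 z2 : der setT z z1 -> der setT z1 z2 -> cts z2 ->
  periodic z L ->
  is_derive t 1 (fun s => J (fun x => z x * U 0 s x)) (J (fun x => z2 x * mu2 U t x)).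
Proof.
move=> dz dz1 cz2 zp; have cz := der_continuous dz.
rewrite -(cint_mu4_test dz dz1 cz2 zp).
apply: (@flow_functional_is_derive (fun _ => z)) => //.
- exact: jc_space.
- move=> s s0; have c0 := flow_cts s0 (isT : (0 <= 6)%N).
  have c0' := flow_cts t0 (isT : (0 <= 6)%N).
  rewrite -cintB; [|by cont|by cont].
  by apply: eq_cint => x; ring.
Qed.

End FixedTime.
End Flow.

(** * Time derivatives of the energy and of the second-order gap *)

Section FlowDerivatives.
Context {R : realType} (L : R) (L0 : 0 < L).
Local Notation J := (cint L).
Context (U : nat -> R -> R -> R) (F : flow L U).
Local Notation D := (dissipation L U).
Local Notation E := (flow_energy L U).

Lemma der_flow_energy : der [set t | 0 < t] E (fun t => - D t).
Proof.
move=> t /= t0.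
have c j (j6 : (j <= 6)%N) := flow_cts F t0 j6.
have c0 := c 0 isT; have c1 := c 1 isT; have c2 := c 2 isT; clear c.
have h0 := der_mu0 F t0; have h1 := der_mu1 F t0.
have h2 := der_mu2 F t0; have h3 := der_mu3 F t0.
have cm0 := der_continuous h0; have cm1 := der_continuous h1.
have cm2 := der_continuous h2; have cm3 := der_continuous h3.
have cm4 := cts_mu4 F t0.
have p0 := state_m_periodic (flow_state F t0).
have p1 := der_periodic h0 p0; have p2 := der_periodic h1 p1.
have p3 := der_periodic h2 p2.
(* Differences of squares are factored and one derivative is moved off u(s) - u(t), so that E(s) -
   E(t) = \int K (u(s) - u(t)). At s = t, K is - m. *)
pose K s x := - (2^-1 * (U 2 s x + U 2 t x)) +
  4^-1 * (U 0 s x + U 0 t x) * (U 0 s x ^+ 2 + U 0 t x ^+ 2 - 2).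
have -> : - D t = J (fun x => K t x * mu4 U t x).
  rewrite /dissipation -cintN; last by cont.
  apply/eqP; rewrite eq_sym -subr_eq0 -cintB; last 2 first.
  - by rewrite /K; cont.
  - by cont.
  apply/eqP; apply: (@cint_der _ _ L0
    (fun x => - (mu0 U t x * mu3 U t x - mu1 U t x * mu2 U t x))).
  - eapply der_ext; first by dert.
    by move=> x _ /=; rewrite /K /mu0; field.
  - by rewrite /K; cont.
  - by move=> x; rewrite p0 p1 p2 p3.
apply: (flow_functional_is_derive L0 F t0) => //.
- move=> s s0; have e0 := flow_cts F s0 (isT : (0 <= 6)%N).
  by have e2 := flow_cts F s0 (isT : (2 <= 6)%N); rewrite /K; cont.
- have j i (i6 : (i <= 6)%N) := flow_jc F t0 i6.
  have j0 := j 0 isT; have j2 := j 2 isT.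
  have k0 := @jc_space _ t _ c0; have k2 := @jc_space _ t _ c2.
  by unfold K; jcont.
- move=> s s0; have e0 := flow_cts F s0 (isT : (0 <= 6)%N).
  have e1 := flow_cts F s0 (isT : (1 <= 6)%N); have e2 := flow_cts F s0 (isT : (2 <= 6)%N).
  rewrite /flow_energy /energy -cintB; [|by cont|by cont].
  apply/eqP; rewrite -subr_eq0 -cintB; [|by cont|by rewrite /K; cont].
  have f0 := flow_der F s0 (isT : (0 < 6)%N); have f1 := flow_der F s0 (isT : (1 < 6)%N).
  have g0 := flow_der F t0 (isT : (0 < 6)%N); have g1 := flow_der F t0 (isT : (1 < 6)%N).
  apply/eqP; apply: (@cint_der _ _ L0
    (fun x => 2^-1 * (U 1 s x + U 1 t x) * (U 0 s x - U 0 t x))).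
  + eapply der_ext; first by dert.
    by move=> x _ /=; rewrite /K; field.
  + by rewrite /K; cont.
  + have q := flow_periodic_jet F.
    by move=> x; rewrite !(q _ s0)// !(q _ t0).
Qed.

Section Gap.
Context (phi phi1 : R -> R) (P : profile L phi phi1 0).
(** [jet2] to [jet5] are the derivatives of phi of orders 2 to 5, reduced by the profile equation to
    polynomials in phi and phi'. *)
Definition jet2 (phi : R -> R) (x : R) : R := phi x ^+ 3 - phi x.
Definition jet3 (phi phi1 : R -> R) (x : R) : R := (3 * phi x ^+ 2 - 1) * phi1 x.
Definition jet4 (phi phi1 : R -> R) (x : R) : R :=
  (3 * phi x ^+ 2 - 1) * (phi x ^+ 3 - phi x) + 6 * phi x * phi1 x ^+ 2.
Definition jet5 (phi phi1 : R -> R) (x : R) : R := (3 * phi x ^+ 2 - 1) * jet3 phi phi1 x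
  + 18 * phi x * phi1 x * (phi x ^+ 3 - phi x) + 6 * phi1 x ^+ 3.

Lemma der_jet1 : der setT phi1 (jet2 phi).
Proof. by apply: (der_ext (profile_der1 P)) => x _; rewrite addr0. Qed.
Lemma der_jet2 : der setT (jet2 phi) (jet3 phi phi1).
Proof. by have d := profile_der P; unfold jet2, jet3; derr. Qed.
Lemma der_jet3 : der setT (jet3 phi phi1) (jet4 phi phi1).
Proof.
have d := profile_der P; have d1 := der_jet1; unfold jet3, jet4.
by derr; rewrite /jet2; ring.
Qed.
Lemma der_jet4 : der setT (jet4 phi phi1) (jet5 phi phi1).
Proof.
have d := profile_der P; have d1 := der_jet1; unfold jet4, jet5, jet3.
by derr; rewrite /jet2; ring.
Qed.

Definition h2_gap t := J (fun x => (U 2 t x - jet2 phi x) ^+ 2).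

Definition h2_gap_rate (t : R) :=
  - (2 * J (fun x => (U 5 t x - jet5 phi phi1 x) * mu3 U t x)).

Lemma der_h2_gap : der [set t | 0 < t] h2_gap h2_gap_rate.
Proof.
move=> t /= t0; rewrite /h2_gap_rate.
have c j (j6 : (j <= 6)%N) := flow_cts F t0 j6.
have c4 := c 4 isT; have c5 := c 5 isT; have c6 := c 6 isT.
have e1 := der_jet1; have e2 := der_jet2; have e3 := der_jet3; have e4 := der_jet4.
have c0' := der_continuous (profile_der P).
have c1' := der_continuous e1; have c2' := der_continuous e2.
have c3' := der_continuous e3; have c4' := der_continuous e4.
have c5' : cts (jet5 phi phi1) by unfold jet5; cont.
have q1 := der_periodic (profile_der P) (profile_periodic P).
have q2 := der_periodic e1 q1; have q3 := der_periodic e2 q2.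
have q4 := der_periodic e3 q3.
have h2 := der_mu2 F t0; have h3 := der_mu3 F t0.
have cm3 := der_continuous h3; have cm4 := cts_mu4 F t0.
have p0 := state_m_periodic (flow_state F t0).
have p1 := der_periodic (der_mu0 F t0) p0; have p2 := der_periodic (der_mu1 F t0) p1.
have p3 := der_periodic h2 p2.
(* The fourth derivative of u(s) + u(t) - 2 phi: the difference of the squared gaps is factored, and
   two integrations by parts leave u(s) - u(t) undifferentiated. *)
pose K s x := U 4 s x + U 4 t x - 2 * jet4 phi phi1 x.
have -> : - (2 * J (fun x => (U 5 t x - jet5 phi phi1 x) * mu3 U t x)) =
    J (fun x => K t x * mu4 U t x).
  rewrite -cintZ -?cintN; [|by cont|by cont].
  apply/eqP; rewrite eq_sym -subr_eq0 -cintB; last 2 first.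
  - by rewrite /K; cont.
  - by cont.
  have g4 := flow_der F t0 (isT : (4 < 6)%N).
  apply/eqP; apply: (@cint_der _ _ L0
    (fun x => 2 * (U 4 t x - jet4 phi phi1 x) * mu3 U t x)).
  - eapply der_ext; first by dert.
    by move=> x _ /=; rewrite /K; ring.
  - by rewrite /K; cont.
  - by move=> x; rewrite p3 q4 (flow_periodic_jet F t0 (isT : (4 <= 6)%N)).
apply: (flow_functional_is_derive L0 F t0) => //.
- by move=> s s0; have f4 := flow_cts F s0 (isT : (4 <= 6)%N); rewrite /K; cont.
- have j4 := flow_jc F t0 (isT : (4 <= 6)%N).
  have k4 := @jc_space _ t _ c4; have k4' := @jc_space _ t _ c4'.
  by unfold K; jcont.
- move=> s s0.
  have f0 := flow_der F s0 (isT : (0 < 6)%N); have f1 := flow_der F s0 (isT : (1 < 6)%N).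
  have f2 := flow_der F s0 (isT : (2 < 6)%N); have f3 := flow_der F s0 (isT : (3 < 6)%N).
  have g0 := flow_der F t0 (isT : (0 < 6)%N); have g1 := flow_der F t0 (isT : (1 < 6)%N).
  have g2 := flow_der F t0 (isT : (2 < 6)%N); have g3 := flow_der F t0 (isT : (3 < 6)%N).
  have s1 := der_continuous f1; have s2 := der_continuous f2; have s3 := der_continuous f3.
  have s4 := flow_cts F s0 (isT : (4 <= 6)%N).
  have r1 := der_continuous g1; have r2 := der_continuous g2; have r3 := der_continuous g3.
  have s00 := der_continuous f0; have r00 := der_continuous g0.
  rewrite /h2_gap -cintB; [|by cont|by cont].
  apply/eqP; rewrite -subr_eq0 -cintB; [|by cont|by rewrite /K; cont].
  apply/eqP; apply: (@cint_der _ _ L0 (fun x =>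
    (U 2 s x + U 2 t x - 2 * jet2 phi x) * (U 1 s x - U 1 t x)
    - (U 3 s x + U 3 t x - 2 * jet3 phi phi1 x) * (U 0 s x - U 0 t x))).
  + eapply der_ext; first by dert.
    by move=> x _ /=; rewrite /K; ring.
  + by rewrite /K; cont.
  + have q := flow_periodic_jet F.
    by move=> x; rewrite !(q _ s0)// !(q _ t0)// q2 q3.
Qed.

(* The rate is - 2 \int a b with b = m''' and a = (u - phi)^(5), where a - b is of
   lower order; and - 2 a b <= (a - b)^2 / 2. *)
Lemma h2_gap_rate_le (t : R) : 0 < t -> h2_gap_rate t <=
  2^-1 * J (fun x => (U 5 t x - jet5 phi phi1 x - mu3 U t x) ^+ 2).
Proof.
move=> t0; have c5 := flow_cts F t0 (isT : (5 <= 6)%N).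
have cm3 := der_continuous (der_mu3 F t0).
have c0' := der_continuous (profile_der P).
have c1' := der_continuous der_jet1; have c3' := der_continuous der_jet3.
have c5' : cts (jet5 phi phi1) by unfold jet5; cont.
rewrite /h2_gap_rate -subr_ge0 opprK -!cintZ; [|by cont|by cont].
rewrite -cintD; [|by cont|by cont].
apply: cint_ge0 => x _; set a := _ - jet5 _ _ x; set b := mu3 U t x.
have := sqr_ge0 (a + b); have := sqr_ge0 (a - b); lra.
Qed.

End Gap.
End FlowDerivatives.

(** * A differential inequality for the second-order gap *)

Section GapEstimate.
Context {R : realType} (L : R) (L0 : 0 < L).
Local Notation J := (cint L).
Context (U : nat -> R -> R -> R) (F : flow L U).
Context (phi phi1 : R -> R) (P : profile L phi phi1 0).
Local Notation D := (dissipation L U).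

Definition h1_gap (t : R) := J (fun x => (U 0 t x - phi x) ^+ 2)
  + J (fun x => (U 1 t x - phi1 x) ^+ 2).

Lemma h1_gap_ge0 (t : R) : 0 <= h1_gap t.
Proof. by apply: addr_ge0; apply: cint_ge0 => x _; exact: sqr_ge0. Qed.

Lemma h2_gap_ge0 (t : R) : 0 <= h2_gap L U phi t.
Proof. by apply: cint_ge0 => x _; exact: sqr_ge0. Qed.

Context (M : R) (M1 : 1 <= M).
Hypothesis phiM : forall x, [/\ `|phi x| <= M, `|phi1 x| <= M,
  `|jet2 phi x| <= M & `|jet3 phi phi1 x| <= M].

Section FixedTime.
Context (t : R) (t0 : 0 < t) (UM : forall x, `|U 0 t x| <= M).

Let M0 : 0 <= M. Proof. by rewrite (le_trans _ M1). Qed.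
Let M2 : 1 <= M ^+ 2. Proof. by rewrite expr_ge1. Qed.
Let MM : M <= M ^+ 2. Proof. by rewrite expr2 ler_peMr. Qed.
Let c0 : cts (U 0 t) := flow_cts F t0 (isT : (0 <= 6)%N).
Let c1 : cts (U 1 t) := flow_cts F t0 (isT : (1 <= 6)%N).
Let c2 : cts (U 2 t) := flow_cts F t0 (isT : (2 <= 6)%N).
Let c3 : cts (U 3 t) := flow_cts F t0 (isT : (3 <= 6)%N).
Let c4 : cts (U 4 t) := flow_cts F t0 (isT : (4 <= 6)%N).
Let c5 : cts (U 5 t) := flow_cts F t0 (isT : (5 <= 6)%N).
Let p0 : cts phi := der_continuous (profile_der P).
Let p1 : cts phi1 := der_continuous (der_jet1 P).
Let p2 : cts (jet2 phi) := der_continuous (der_jet2 P).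
Let p3 : cts (jet3 phi phi1) := der_continuous (der_jet3 P).
Let p4 : cts (jet4 phi phi1) := der_continuous (der_jet4 P).
Let p5 : cts (jet5 phi phi1). Proof. by unfold jet5; cont. Qed.
Let cm1 : cts (mu1 U t) := der_continuous (der_mu1 F t0).
Let cm3 : cts (mu3 U t) := der_continuous (der_mu3 F t0).

Let w1p : periodic (fun x => U 1 t x - phi1 x) L.
Proof.
move=> x; rewrite (flow_periodic_jet F t0)//.
by rewrite (der_periodic (profile_der P) (profile_periodic P)).
Qed.
Let w2p : periodic (fun x => U 2 t x - jet2 phi x) L.
Proof.
by move=> x; rewrite (flow_periodic_jet F t0)// /jet2 (profile_periodic P).
Qed.
Let dw0 : der setT (fun x => U 0 t x - phi x) (fun x => U 1 t x - phi1 x).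
Proof. exact: derD (flow_der F t0 (isT : (0 < 6)%N)) (derN (profile_der P)). Qed.
Let dw1 : der setT (fun x => U 1 t x - phi1 x) (fun x => U 2 t x - jet2 phi x).
Proof. exact: derD (flow_der F t0 (isT : (1 < 6)%N)) (derN (der_jet1 P)). Qed.
Let dw2 : der setT (fun x => U 2 t x - jet2 phi x) (fun x => U 3 t x - jet3 phi phi1 x).
Proof. exact: derD (flow_der F t0 (isT : (2 < 6)%N)) (derN (der_jet2 P)). Qed.
Let dw3 : der setT (fun x => U 3 t x - jet3 phi phi1 x)
  (fun x => U 4 t x - jet4 phi phi1 x).
Proof. exact: derD (flow_der F t0 (isT : (3 < 6)%N)) (derN (der_jet3 P)). Qed.

Let normM (a b c d : R) : `|a| <= c -> `|b| <= d -> `|a * b| <= c * d.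
Proof. by move=> ac bd; rewrite normrM ler_pM. Qed.

(** For phi the potential is constant, so (u - phi)''' is m' plus multiples of u - phi and (u -
    phi)' with coefficients at most 6 M^2; Poincare bounds m' by the dissipation. *)
Lemma h3_gap_le : J (fun x => (U 3 t x - jet3 phi phi1 x) ^+ 2) <=
  3 * (L ^+ 2 + 36 * M ^+ 4) * (D t + h1_gap t).
Proof.
have D0 := dissipation_ge0 L U t; have h0 := h1_gap_ge0 t.
have m0 := M0; have m2 := M2; have mm := MM.
apply: (@le_trans _ _ (J (fun x => 3 * (mu1 U t x ^+ 2 + 36 * M ^+ 4 *
   ((U 0 t x - phi x) ^+ 2 + (U 1 t x - phi1 x) ^+ 2))))).
  apply: le_cint => //; [by cont|by cont|move=> x _].
  have [f0 f1 _ _] := phiM x.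
  set w := U 0 t x - phi x; set w1 := U 1 t x - phi1 x.
  have -> : U 3 t x - jet3 phi phi1 x = mu1 U t x + (3 * U 0 t x ^+ 2 - 1) * w1
     + (3 * (U 0 t x + phi x) * phi1 x) * w.
    by rewrite /mu1 /jet3 /w /w1; ring.
  set a := mu1 U t x; set b := _ * w1; set c := _ * w.
  have bb : b ^+ 2 <= 36 * M ^+ 4 * w1 ^+ 2.
    rewrite /b exprMn ler_wpM2r ?sqr_ge0// (_ : 36 * M ^+ 4 = (6 * M ^+ 2) ^+ 2); last by ring.
    rewrite -(real_normK (num_real (_ - 1))) ler_sqr ?nnegrE ?mulr_ge0 ?exprn_ge0//.
    have hu : U 0 t x ^+ 2 <= M ^+ 2.
      by rewrite -(real_normK (num_real (U 0 t x))) ler_sqr ?nnegrE.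
    have := sqr_ge0 (U 0 t x); rewrite ler_norml => h.
    by apply/andP; split; lra.
  have cc : c ^+ 2 <= 36 * M ^+ 4 * w ^+ 2.
    rewrite /c exprMn ler_wpM2r ?sqr_ge0// (_ : 36 * M ^+ 4 = (6 * M ^+ 2) ^+ 2); last by ring.
    rewrite -(real_normK (num_real (_ * phi1 x))) ler_sqr ?nnegrE ?mulr_ge0 ?exprn_ge0//.
    rewrite (_ : 6 * M ^+ 2 = 3 * (M + M) * M); last by ring.
    apply: normM => //; rewrite normrM ger0_norm// ler_wpM2l//.
    by rewrite (le_trans (ler_normD _ _))// lerD.
  have := sqr_ge0 (a - b); have := sqr_ge0 (a - c); have := sqr_ge0 (b - c).
  by lra.
rewrite cintZ; last by cont.
rewrite cintD; [|by cont|by cont].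
rewrite cintZ; last by cont.
rewrite cintD; [|by cont|by cont].
rewrite -/(h1_gap t) -[leRHS]mulrA ler_wpM2l//.
have := mu1_l2 L0 F t0.
have : 0 <= 36 * M ^+ 4 * D t by rewrite !mulr_ge0// exprn_ge0.
have : 0 <= L ^+ 2 * h1_gap t by rewrite mulr_ge0// sqr_ge0.
by set x := J _; lra.
Qed.

(** Poincare applied to [h3_gap_le]: at a time of small dissipation, closeness in H^1 improves to
    closeness in H^2. *)
Lemma h2_gap_le : h2_gap L U phi t <=
  L ^+ 2 * (3 * (L ^+ 2 + 36 * M ^+ 4) * (D t + h1_gap t)).
Proof.
apply: (@le_trans _ _ (L ^+ 2 * J (fun x => (U 3 t x - jet3 phi phi1 x) ^+ 2))).
  apply: (poincare L0 dw2 dw3); [by cont|exact: w2p|].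
  by apply: (cint_der L0 dw1); [cont|exact: w1p].
by rewrite ler_wpM2l ?sqr_ge0// h3_gap_le.
Qed.

(** With w = u - phi, the remainder is linear in w, ..., w''' with coefficients at most quadratic in
    w'. Agmon bounds w'^2 by a multiple of the L^2 norm of w'' when that of w' is bounded, so the
    squared coefficients grow only linearly in the second-order gap. *)
Lemma remainder_le (N : R) : J (fun x => (U 1 t x - phi1 x) ^+ 2) <= N ->
  J (fun x => (U 5 t x - jet5 phi phi1 x - mu3 U t x) ^+ 2) <=
  14400 * M ^+ 4 * (2 + 18 * N) * (1 + 3 * (L ^+ 2 + 1) * (L ^+ 2 + 36 * M ^+ 4))
  * ((1 + h2_gap L U phi t) * (D t + h1_gap t)).
Proof.
move=> w1N.
have D0 := dissipation_ge0 L U t; have h0 := h1_gap_ge0 t.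
have m0 := M0; have m2 := M2; have mm := MM.
have y0 := h2_gap_ge0 t.
set a := 3 * (l2 L (fun x => U 1 t x - phi1 x) * l2 L (fun x => U 2 t x - jet2 phi x)).
have a0 : 0 <= a by rewrite !mulr_ge0 ?l2_ge0.
have w1a x : (U 1 t x - phi1 x) ^+ 2 <= a.
  apply: (agmon L0 dw1 dw2); [by cont|exact: w1p|].
  apply: (cint_der L0 dw0); first by cont.
  by move=> z; rewrite (flow_periodic F t0) (profile_periodic P).
have N0 : 0 <= N by rewrite (le_trans _ w1N)//; apply: cint_ge0 => x _; exact: sqr_ge0.
have A2 : (1 + a) ^+ 2 <= (2 + 18 * N) * (1 + h2_gap L U phi t).
  have a2 : a ^+ 2 <= 9 * (N * h2_gap L U phi t).
    by rewrite /a !exprMn !sqr_l2 -/(h2_gap L U phi t) -natrX ler_wpM2l// ler_wpM2r.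
  have : 0 <= N * h2_gap L U phi t by rewrite mulr_ge0.
  have := sqr_ge0 (1 - a); lra.
(* A common bound for the coefficients [k0] to [k3], the largest being [k1], where w'^2 <= a enters.
   The constant 14400 is 4 * 60^2, with 4 from squaring a sum of four terms. *)
set B := 60 * M ^+ 2 * (1 + a).
have B0 : 0 <= B by rewrite !mulr_ge0 ?sqr_ge0//; lra.
apply: (@le_trans _ _ (J (fun x => 4 * B ^+ 2 * (((U 0 t x - phi x) ^+ 2
    + (U 1 t x - phi1 x) ^+ 2) + ((U 2 t x - jet2 phi x) ^+ 2
    + (U 3 t x - jet3 phi phi1 x) ^+ 2))))).
  apply: le_cint => //; [by cont|by cont|move=> x _].
  have [f0 f1 f2 f3] := phiM x; have u0 := UM x.
  have aw := w1a x.
  set w := U 0 t x - phi x; set w1 := U 1 t x - phi1 x in aw *.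
  set w2 := U 2 t x - jet2 phi x; set w3 := U 3 t x - jet3 phi phi1 x.
  have w1le : `|w1| <= 1 + a.
    have := sqr_ge0 (`|w1| - 1); move: aw; rewrite -(real_normK (num_real w1)).
    by have := normr_ge0 w1; set q := `|w1|; lra.
  pose k0 := 3 * (U 0 t x + phi x) * jet3 phi phi1 x + 18 * phi1 x * jet2 phi x.
  pose k1 := 18 * U 0 t x * jet2 phi x + 6 * (w1 ^+ 2 + 3 * phi1 x * w1 + 3 * phi1 x ^+ 2).
  pose k2 := 18 * U 0 t x * (phi1 x + w1).
  pose k3 := 3 * U 0 t x ^+ 2 - 1.
  have -> : U 5 t x - jet5 phi phi1 x - mu3 U t x = k0 * w + k1 * w1 + k2 * w2 + k3 * w3.
    rewrite /k0 /k1 /k2 /k3 /w /w1 /w2 /w3 /mu3 /jet5 /jet3 /jet2; ring.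
  have Ma : 0 <= M ^+ 2 * a by rewrite mulr_ge0 ?sqr_ge0.
  have n2 (c d e : R) : 0 <= c -> `|d| <= M -> `|e| <= M -> `|c * d * e| <= c * M ^+ 2.
    move=> cc dM eM; rewrite -mulrA normrM (ger0_norm cc) ler_wpM2l// expr2.
    exact: normM.
  have b0 : `|k0| <= B.
    rewrite /k0 (le_trans (ler_normD _ _))//.
    have h1 : `|3 * (U 0 t x + phi x) * jet3 phi phi1 x| <= 3 * (M + M) * M.
      apply: normM => //; rewrite normrM ger0_norm// ler_wpM2l//.
      by rewrite (le_trans (ler_normD _ _))// lerD.
    have h2 := n2 18 _ _ (ler0n _ _) f1 f2.
    by rewrite /B; lra.
  have b3 : `|k3| <= B.
    have hu : U 0 t x ^+ 2 <= M ^+ 2.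
      by rewrite -(real_normK (num_real (U 0 t x))) ler_sqr ?nnegrE.
    have := sqr_ge0 (U 0 t x); rewrite /k3 ler_norml /B => h.
    by apply/andP; split; lra.
  have mw : `|phi1 x * w1| <= M * (1 + a) by exact: normM.
  have Mal : M * a <= M ^+ 2 * a by rewrite ler_wpM2r.
  have b2 : `|k2| <= B.
    rewrite /k2 (_ : _ * (_ + _) = 18 * U 0 t x * phi1 x + 18 * (U 0 t x * w1)); last by ring.
    rewrite (le_trans (ler_normD _ _))//.
    have h1 := n2 18 _ _ (ler0n _ _) u0 f1.
    have h2 : `|18 * (U 0 t x * w1)| <= 18 * (M * (1 + a)).
      by rewrite normrM ger0_norm// ler_wpM2l// normM.
    by rewrite /B; lra.
  have b1 : `|k1| <= B.
    rewrite /k1 (le_trans (ler_normD _ _))//.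
    have h1 := n2 18 _ _ (ler0n _ _) u0 f2.
    have h2 : `|6 * (w1 ^+ 2 + 3 * phi1 x * w1 + 3 * phi1 x ^+ 2)| <=
        6 * (a + 3 * (M * (1 + a)) + 3 * M ^+ 2).
      rewrite normrM ger0_norm// ler_wpM2l// (le_trans (ler_normD _ _))// lerD//.
        rewrite (le_trans (ler_normD _ _))// lerD//; first by rewrite ger0_norm ?sqr_ge0.
        by rewrite -mulrA normrM ger0_norm// ler_wpM2l.
      rewrite normrM ger0_norm// ler_wpM2l// normrX ler_sqr ?nnegrE//.
    have ha : a <= M ^+ 2 * a by rewrite ler_peMl.
    by rewrite /B; lra.
  set Q := k0 * w + k1 * w1 + k2 * w2 + k3 * w3.
  have Qle : `|Q| <= B * (`|w| + `|w1| + `|w2| + `|w3|).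
    have kB (c d : R) : `|c| <= B -> `|c * d| <= B * `|d|.
      by move=> cB; rewrite normrM ler_wpM2r.
    rewrite !mulrDr /Q.
    rewrite (le_trans (ler_normD _ _))//; apply: lerD; last exact: kB.
    rewrite (le_trans (ler_normD _ _))//; apply: lerD; last exact: kB.
    by rewrite (le_trans (ler_normD _ _))//; apply: lerD; exact: kB.
  rewrite -(real_normK (num_real Q)).
  apply: (@le_trans _ _ ((B * (`|w| + `|w1| + `|w2| + `|w3|)) ^+ 2)).
    by rewrite ler_sqr ?nnegrE// (le_trans _ Qle).
  rewrite exprMn -[leRHS]mulrA [leRHS]mulrCA ler_wpM2l ?sqr_ge0//.
  rewrite -(real_normK (num_real w)) -(real_normK (num_real w1)).
  rewrite -(real_normK (num_real w2)) -(real_normK (num_real w3)).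
  set a0' := `|w|; set a1' := `|w1|; set a2' := `|w2|; set a3' := `|w3|.
  have := sqr_ge0 (a0' - a1'); have := sqr_ge0 (a0' - a2'); have := sqr_ge0 (a0' - a3').
  have := sqr_ge0 (a1' - a2'); have := sqr_ge0 (a1' - a3'); have := sqr_ge0 (a2' - a3').
  by lra.
rewrite cintZ; last by cont.
rewrite cintD; [|by cont|by cont].
rewrite cintD; [|by cont|by cont].
rewrite cintD; [|by cont|by cont].
rewrite -/(h1_gap t) -/(h2_gap L U phi t).
have := h3_gap_le; have := h2_gap_le.
set y := h2_gap L U phi t in y0 A2 *; set h := h1_gap t in h0 *; set d := D t in D0 *.
set z := J _; set k := L ^+ 2 + 36 * M ^+ 4 => yle zle.
have k0 : 0 <= k by rewrite addr_ge0 ?mulr_ge0 ?exprn_ge0// ltW.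
have S1 : h + (y + z) <= (1 + 3 * (L ^+ 2 + 1) * k) * (d + h) by lra.
have B2 : 4 * B ^+ 2 <= 14400 * M ^+ 4 * ((2 + 18 * N) * (1 + y)).
  rewrite /B !exprMn (_ : 4 * _ = 14400 * M ^+ 4 * (1 + a) ^+ 2); last by ring.
  apply: ler_wpM2l; last exact: A2.
  by apply: mulr_ge0; [exact: ler0n|exact: exprn_ge0].
apply: (le_trans (ler_pM _ _ B2 S1)).
- by rewrite mulr_ge0// sqr_ge0.
- by rewrite addr_ge0// addr_ge0// /z; apply: cint_ge0 => x _; exact: sqr_ge0.
- by rewrite le_eqVlt; apply/orP; left; apply/eqP; ring.
Qed.

End FixedTime.

(** Linearity in 1 + gap is essential: the growth rate of ln (1 + gap) is at most a multiple of the
    dissipation, integrable in time, plus the H^1 gap. *)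
Lemma h2_gap_differential_inequality (N : R) : 0 <= N -> exists2 C : R, 0 < C & forall t : R,
  0 < t -> (forall x, `|U 0 t x| <= M) ->
  J (fun x => (U 1 t x - phi1 x) ^+ 2) <= N ->
  h2_gap_rate L U phi phi1 t <= C * ((1 + h2_gap L U phi t) * (D t + h1_gap t)).
Proof.
move=> N0; have M0 : 0 <= M by rewrite (le_trans _ M1).
exists (2^-1 * (14400 * M ^+ 4 * (2 + 18 * N)
  * (1 + 3 * (L ^+ 2 + 1) * (L ^+ 2 + 36 * M ^+ 4)))).
  have M4 : 0 < M ^+ 4 by rewrite exprn_gt0// (lt_le_trans _ M1).
  apply: mulr_gt0; first by rewrite invr_gt0 ltr0n.
  apply: mulr_gt0.
    apply: mulr_gt0; last by lra.
    by apply: mulr_gt0; [rewrite ltr0n|exact: M4].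
  rewrite ltr_wpDr// mulr_ge0//; first by rewrite mulr_ge0// addr_ge0 ?sqr_ge0.
  by rewrite addr_ge0 ?sqr_ge0// mulr_ge0// ltW.
move=> t t0 UM w1N.
apply: (le_trans (h2_gap_rate_le F P t0)).
rewrite -[leRHS]mulrA; apply: ler_wpM2l; first by rewrite invr_ge0 ler0n.
exact: (remainder_le t0 UM w1N).
Qed.

End GapEstimate.

(** * Convergence of the flow *)

Section RealLimits.
Context {R : realType}.
Implicit Types (u : nat -> R) (l e : R).

Definition tends u l := forall e, 0 < e -> exists N, forall n, (N <= n)%N -> `|u n - l| <= e.

Lemma tends_cvg u l : u @ \oo --> l -> tends u l.
Proof.
move=> /cvgrPdist_le H e e0; have [N _ HN] := H e e0.
by exists N => n Nn; rewrite distrC; exact: HN.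
Qed.

Lemma cauchy_tends u :
  (forall e, 0 < e -> exists N, forall m n, (N <= m)%N -> (N <= n)%N -> `|u m - u n| <= e) ->
  exists l, tends u l.
Proof.
move=> H; suff /cvg_ex[l ul] : cvg (u @ \oo) by exists l; exact: tends_cvg.
apply: cauchy_cvg; apply: cauchy_exP => e e0.
have e2 : 0 < e / 2 by rewrite divr_gt0.
have [N HN] := H _ e2; exists (u N), N => //= n Nn.
rewrite /ball/=; apply: (le_lt_trans (HN _ _ (leqnn N) Nn)).
by rewrite ltr_pdivrMr// ltr_pMr// ltr1n.
Qed.

Lemma tends_unique u l l' : tends u l -> tends u l' -> l = l'.
Proof.
move=> ul ul'; apply/eqP; rewrite -subr_eq0 -normr_le0.
apply/ler_addgt0Pl => e e0; rewrite addr0.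
have e2 : 0 < e / 2 by rewrite divr_gt0.
have [N HN] := ul _ e2; have [N' HN'] := ul' _ e2.
rewrite (_ : l - l' = (u (maxn N N') - l') - (u (maxn N N') - l)); last by ring.
by rewrite (le_trans (ler_normB _ _))// [e]splitr lerD// ?HN ?HN' ?leq_maxl ?leq_maxr.
Qed.

Lemma increasing_ge (f : nat -> nat) : increasing_seq f -> forall n, (n <= f n)%N.
Proof.
move=> fi; elim=> // n IH; apply: (leq_ltn_trans IH).
by rewrite ltnNge; have := fi n.+1 n; rewrite /Order.le/= => ->; rewrite ltnn.
Qed.

Lemma bounded_subsequence u B : (forall n, `|u n| <= B) ->
  exists (f : nat -> nat) l, increasing_seq f /\ tends (u \o f) l.
Proof.
move=> uB; have ub : bounded_fun u.
  exists B; split; first exact: num_real.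
  by move=> x Bx n _ /=; exact: le_trans (uB n) (ltW Bx).
have [f fi /cvg_ex[l ul]] := bolzano_weierstrass ub.
by exists f, l; split => //; exact: tends_cvg.
Qed.

Lemma tends_sub u l (f : nat -> nat) : increasing_seq f -> tends u l -> tends (u \o f) l.
Proof.
move=> fi ul e /ul[N HN]; exists N => n Nn.
by apply: HN; exact: leq_trans Nn (increasing_ge fi n).
Qed.

Lemma bounded_subsequence3 u v w B : (forall n, `|u n| <= B) ->
  (forall n, `|v n| <= B) -> (forall n, `|w n| <= B) ->
  exists (f : nat -> nat) a b c, [/\ forall n, (n <= f n)%N,
    tends (u \o f) a, tends (v \o f) b & tends (w \o f) c].
Proof.
move=> uB vB wB.
have [f1 [a [f1i ua]]] := bounded_subsequence uB.
have [|f2 [b [f2i vb]]] := @bounded_subsequence (v \o f1) B; first by move=> n; exact: vB.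
have [|f3 [c [f3i wc]]] := @bounded_subsequence (w \o (f1 \o f2)) B.
  by move=> n; exact: wB.
exists (f1 \o (f2 \o f3)), a, b, c; split => //.
- move=> n /=; apply: leq_trans (increasing_ge f3i n) _.
  by apply: leq_trans (increasing_ge f2i _) _; exact: increasing_ge f1i _.
- have := tends_sub f2i ua => /(tends_sub f3i); exact.
- by have := tends_sub f3i vb.
Qed.

Definition uniformly (f : nat -> R -> R) (g : R -> R) := forall e, 0 < e ->
  exists N, forall n, (N <= n)%N -> forall x, `|f n x - g x| <= e.

Lemma uniformly_tends f g x : uniformly f g -> tends (fun n => f n x) (g x).
Proof. by move=> fg e /fg[N HN]; exists N => n Nn; exact: HN. Qed.

Lemma uniformly_cauchy f :
  (forall e, 0 < e -> exists N, forall m n, (N <= m)%N -> (N <= n)%N ->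
    forall x, `|f m x - f n x| <= e) -> exists g, uniformly f g.
Proof.
move=> H.
have /choice[g Hg] : forall x, exists l, tends (fun n => f n x) l.
  move=> x; apply: cauchy_tends => e /H[N HN]; exists N => m n Nm Nn.
  exact: HN.
exists g => e e0; have e2 : 0 < e / 2 by rewrite divr_gt0.
have [N HN] := H _ e2; exists N => n Nn x.
apply/ler_addgt0Pl => d d0.
have [N' HN'] := Hg x d d0.
rewrite (_ : _ - _ = (f (maxn N N') x - g x) + (f n x - f (maxn N N') x)); last by ring.
rewrite (le_trans (ler_normD _ _))// lerD ?HN' ?leq_maxr//.
rewrite (le_trans (HN _ _ Nn (leq_maxl _ _) x))//.
by rewrite ler_pdivrMr// ler_peMr ?ler1n ?ltW.
Qed.

(** The mean value theorem for [f n] leaves four errors: three are uniform convergence of g, the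
    fourth is the continuity at x of the single function [g N]. *)
Lemma uniformly_der (f g : nat -> R -> R) F G : (forall n, der setT (f n) (g n)) ->
  (forall n, cts (g n)) -> uniformly f F -> uniformly g G -> der setT F G.
Proof.
move=> fg cg fF gG x _; apply: is_derive_eps => e e0.
have e4 : 0 < e / 4 by rewrite divr_gt0.
have [N HN] := gG _ e4.
have cgN : continuous (g N) := cg N.
have /cvgrPdist_le /(_ _ e4) := cgN x.
case/nbhs_ballP => d /= d0 Hd; exists d => // h h0 hd.
have near_x y : `|y - x| <= `|h| -> `|g N y - g N x| <= e / 4.
  by move=> yx; rewrite distrC; apply: Hd; rewrite /ball/= distrC; exact: le_lt_trans yx hd.
have key n : (N <= n)%N -> `|f n (x + h) - f n x - h * G x| <= `|h| * e.
  move=> Nn.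
  have [y yh ->] : exists2 y, `|y - x| <= `|h| & f n (x + h) - f n x = h * g n y.
    have [hp|hn] := ltP 0 h.
      have xh : x < x + h by rewrite ltrDl.
      have [y /andP[y1 y2] ->] := der_mvt xh (fun _ _ => I) (fg n).
      exists y; last by rewrite addrAC subrr add0r mulrC.
      by rewrite (gtr0_norm hp) ger0_norm; lra.
    have {}hn : h < 0 by rewrite lt_neqAle h0.
    have xh : x + h < x by rewrite gtrDl.
    have [y /andP[y1 y2] E] := der_mvt xh (fun _ _ => I) (fg n).
    exists y; first by rewrite (ltr0_norm hn) ler0_norm; lra.
    by rewrite -opprB E; ring.
  rewrite -mulrBr normrM ler_wpM2l//.
  rewrite (_ : _ - _ = (g n y - G y) - (g N y - G y) + (g N y - g N x) + (g N x - G x)); last by ring.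
  rewrite (_ : e = e / 4 + e / 4 + e / 4 + e / 4); last by field.
  rewrite (le_trans (ler_normD _ _))// lerD ?HN//.
  rewrite (le_trans (ler_normD _ _))// lerD ?near_x//.
  by rewrite (le_trans (ler_normB _ _))// lerD ?HN.
have {}key : `|F (x + h) - F x - h * G x| <= `|h| * e.
  apply/ler_addgt0Pl => d' d'0; have d2 : 0 < d' / 2 by rewrite divr_gt0.
  have [N' HN'] := fF _ d2.
  pose n := maxn N N'.
  rewrite (_ : _ - _ = (f n x - F x) - (f n (x + h) - F (x + h))
    + (f n (x + h) - f n x - h * G x)); last by ring.
  rewrite (le_trans (ler_normD _ _))// lerD ?key ?leq_maxl//.
  by rewrite (le_trans (ler_normB _ _))// [d']splitr lerD ?HN' ?leq_maxr.
have hn : 0 < `|h| by rewrite normr_gt0.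
rewrite -(ler_pM2l hn) (le_trans _ key)// -normrM le_eqVlt; apply/orP; left.
by apply/eqP; congr (`|_|); field.
Qed.

(** Let z be the infimum of the times at which f is at least e. By continuity f <= e on [s, z], so
    [step] gives f z < e, which persists beyond z and contradicts the choice of z. *)
Lemma bootstrap (f : R -> R) (s e : R) : (forall t, s <= t -> {for t, continuous f}) ->
  f s < e ->
  (forall t, s <= t -> (forall r, s <= r <= t -> f r <= e) -> f t < e) ->
  forall t, s <= t -> f t <= e.
Proof.
move=> cf fs step t st; rewrite leNgt; apply/negP => ft.
pose A := [set r | s <= r <= t /\ e <= f r].
have At : A t by split; [rewrite st lexx|exact: ltW].
have hA : has_inf A by split; [exists t|exists s => r [] /andP[]].
set z := inf A.
have sz : s <= z by apply: lb_le_inf; [exists t|move=> r [] /andP[]].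
have zt : z <= t by apply: ge_inf => //; case: hA.
have below r : s <= r -> r < z -> f r < e.
  move=> sr rz; rewrite ltNge; apply/negP => er.
  suff : z <= r by rewrite leNgt rz.
  apply: ge_inf; first by case: hA.
  by split => //; rewrite sr (le_trans (ltW rz)).
have fz : f z <= e.
  rewrite leNgt; apply/negP => fz.
  have sz' : s < z.
    by rewrite lt_neqAle sz andbT; apply: contraTneq fz => <-; rewrite -leNgt ltW.
  have /cvgr_gt /(_ _ fz) := cf z sz.
  case/nbhs_ballP => d /= d0 Hd.
  pose r := Num.max s (z - d / 2).
  have rz : r < z by rewrite gt_max sz' ltrBlDr ltrDl divr_gt0.
  have sr : s <= r by rewrite le_max lexx.
  have := below r sr rz; rewrite ltNge ltW//; apply: Hd.
  have : z - d / 2 <= r by rewrite le_max lexx orbT.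
  by rewrite /ball/= => h; rewrite gtr0_norm ?subr_gt0//; lra.
have {}fz : f z < e.
  apply: step => // r /andP[sr]; rewrite le_eqVlt => /predU1P[->//|rz].
  exact: ltW (below r sr rz).
have /cvgr_lt /(_ _ fz) := cf z sz.
case/nbhs_ballP => d /= d0 Hd.
have [r [/andP[sr rt] er] rz] := inf_adherent d0 hA.
have zr : z <= r by apply: ge_inf; [case: hA|split; rewrite ?sr].
have : f r < e by apply: Hd; rewrite /ball/= ler0_norm; move: rz; rewrite -/z; lra.
by rewrite ltNge er.
Qed.

End RealLimits.

(** * A priori bounds and drift *)

Section Compactness.
Context {R : realType} (L : R) (L0 : 0 < L).
Local Notation J := (cint L).
Context (U : nat -> R -> R -> R) (F : flow L U).
Local Notation D := (dissipation L U).
Local Notation E := (flow_energy L U).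

Lemma flow_energy_ge0 (t : R) : 0 <= E t.
Proof.
apply: cint_ge0 => x _; apply: addr_ge0; apply: mulr_ge0; rewrite ?sqr_ge0//.
Qed.

Lemma flow_energy_nonincreasing (a b : R) : 0 < a -> a <= b -> E b <= E a.
Proof.
move=> a0 ab; apply: (der_nonincreasing ab _ (der_flow_energy L0 F)).
  by move=> x /= /andP[ax _]; exact: lt_le_trans ax.
by move=> x _; rewrite oppr_le0; exact: dissipation_ge0.
Qed.

(** The mean value theorem for the energy on a unit interval; since the energy converges, such times
    have small dissipation for large t. *)
Lemma good_time (t : R) : 1 < t -> exists s, [/\ t - 1 < s, s < t & D s = E (t - 1) - E t].
Proof.
move=> t1; have tt : t - 1 < t by rewrite gtrBl.
have [|s /andP[s1 s2] H] := der_mvt tt _ (der_flow_energy L0 F).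
  by move=> x /= /andP[tx _]; rewrite (lt_le_trans _ tx)// subr_gt0.
exists s; split => //; move: H; rewrite (_ : t - (t - 1) = 1) ?mulr1; last by ring.
by move=> H; lra.
Qed.

(** [e8] is the energy at infinity. The condition [2 <= T] leaves room for the bounds that start at
    times 1 and 2. *)
Lemma flow_energy_limit : exists e8 : R, (forall t, 0 < t -> e8 <= E t) /\
  forall e : R, 0 < e -> exists2 T : R, 2 <= T & forall t : R, T <= t -> E t <= e8 + e.
Proof.
pose A := [set E t | t in [set t | 0 < t]].
have hA : has_inf A.
  split; first by exists (E 1), 1 => //=; exact: ltr01.
  by exists 0 => _ [t _ <-]; exact: flow_energy_ge0.
exists (inf A); split.
  by move=> t t0; apply: ge_inf; [case: hA|exists t].
move=> e e0; have [_ [t t0 <-] te] := inf_adherent e0 hA.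
exists (Num.max 2 t); first by rewrite le_max lexx.
move=> r; rewrite ge_max => /andP[_ tr].
exact: le_trans (flow_energy_nonincreasing t0 tr) (ltW te).
Qed.

Lemma flow_h1_bound (t : R) : 1 <= t -> J (fun x => U 1 t x ^+ 2) <= 2 * E 1.
Proof.
move=> t1; have t0 : 0 < t by exact: lt_le_trans t1.
have c0 := flow_cts F t0 (isT : (0 <= 6)%N); have c1 := flow_cts F t0 (isT : (1 <= 6)%N).
apply: (@le_trans _ _ (2 * E t)); last first.
  by rewrite ler_wpM2l// flow_energy_nonincreasing.
rewrite /flow_energy /energy -cintZ; last by cont.
apply: le_cint => //; [by cont|by cont|move=> x _].
by have := sqr_ge0 (U 0 t x ^+ 2 - 1); lra.
Qed.

(** With a = L (2 E(1)), Sobolev gives u^2 <= a, and a <= (1 + a)^2; the 1 avoids a square root and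
    keeps the bound at least 1. *)
Definition sup_bound : R := 1 + L * (2 * E 1).

Lemma sup_bound_ge1 : 1 <= sup_bound.
Proof. by rewrite /sup_bound lerDl !mulr_ge0 ?flow_energy_ge0// ltW. Qed.

Lemma flow_sup_bound (t : R) : 1 <= t -> forall x, `|U 0 t x| <= sup_bound.
Proof.
move=> t1 x; have t0 : 0 < t by exact: lt_le_trans t1.
have E0 := flow_energy_ge0 1.
have a0 : 0 <= L * (2 * E 1) by rewrite !mulr_ge0// ltW.
rewrite -ler_sqr ?nnegrE ?(le_trans _ sup_bound_ge1)// real_normK ?num_real//.
have := sobolev_sup L0 (flow_der F t0 (isT : (0 < 6)%N)) (flow_der F t0 (isT : (1 < 6)%N))
  (flow_cts F t0 (isT : (2 <= 6)%N)) (flow_periodic F t0) (flow_mean F t0) x.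
move=> H; apply: (le_trans H); rewrite /sup_bound.
apply: (@le_trans _ _ (L * (2 * E 1))).
  by rewrite ler_wpM2l ?(ltW L0)//; exact: flow_h1_bound.
by have := sqr_ge0 (L * (2 * E 1)); move: a0; set a := L * _; lra.
Qed.

(** Gaps to the zero profile are norms of u itself, so the gap estimates also yield a priori
    bounds. *)
Lemma profile0 : profile L (fun=> 0) (fun=> 0) 0.
Proof.
split.
- exact: der_cst.
- by apply: (der_ext (@der_cst _ _ 0)) => x _; rewrite expr0n/= subrr addr0.
- by [].
- by rewrite cint_cst// mul0r.
Qed.

Lemma profile_jets_bounded phi phi1 : profile L phi phi1 0 ->
  exists2 M : R, 0 <= M & forall x, [/\ `|phi x| <= M, `|phi1 x| <= M,
    `|jet2 phi x| <= M & `|jet3 phi phi1 x| <= M].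
Proof.
move=> P; have phip := profile_periodic P.
have phi1p := der_periodic (profile_der P) phip.
have phi2p := der_periodic (der_jet1 P) phi1p.
have phi3p := der_periodic (der_jet2 P) phi2p.
have B (f : R -> R) : cts f -> periodic f L -> exists2 M : R, 0 <= M & forall x, `|f x| <= M.
  move=> cf fp; have [M M0 HM] := cts_bounded 0 (0 + L) cf.
  by exists M => // x; have [y yL ->] := periodic_reduce 0 L0 fp x; exact: HM.
have [M0 M00 H0] := B _ (der_continuous (profile_der P)) phip.
have [M1 M10 H1] := B _ (der_continuous (der_jet1 P)) phi1p.
have [M2 M20 H2] := B _ (der_continuous (der_jet2 P)) phi2p.
have [M3 M30 H3] := B _ (der_continuous (der_jet3 P)) phi3p.
exists (M0 + M1 + M2 + M3); first by rewrite !addr_ge0.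
by move=> x; have := H0 x; have := H1 x; have := H2 x; have := H3 x; split; lra.
Qed.

Lemma h1_gap_bound phi phi1 N t : cts phi -> cts phi1 ->
  (forall x, `|phi x| <= N) -> (forall x, `|phi1 x| <= N) -> 0 <= N -> 1 <= t ->
  h1_gap L U phi phi1 t <= (sup_bound + N) ^+ 2 * L + 4 * E 1 + 2 * N ^+ 2 * L.
Proof.
move=> cp cp1 pN p1N N0 t1; have t0 : 0 < t by exact: lt_le_trans t1.
have c0 := flow_cts F t0 (isT : (0 <= 6)%N); have c1 := flow_cts F t0 (isT : (1 <= 6)%N).
rewrite /h1_gap -addrA; apply: lerD.
  rewrite -cint_cst//; apply: le_cint => //; [by cont|by cont|move=> x _].
  rewrite -(real_normK (num_real (U 0 t x - phi x))) ler_sqr ?nnegrE//; last first.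
    by rewrite addr_ge0// (le_trans _ sup_bound_ge1).
  by rewrite (le_trans (ler_normB _ _))// lerD// flow_sup_bound.
apply: (@le_trans _ _ (J (fun x => 2 * U 1 t x ^+ 2 + 2 * N ^+ 2))).
  apply: le_cint => //; [by cont|by cont|move=> x _].
  have : phi1 x ^+ 2 <= N ^+ 2.
    by rewrite -(real_normK (num_real (phi1 x))) ler_sqr ?nnegrE.
  by have := sqr_ge0 (U 1 t x + phi1 x); lra.
rewrite cintD; [|by cont|by cont].
rewrite cint_cst// cintZ; last by cont.
by have := flow_h1_bound t1; lra.
Qed.

(* ln (1 + y) + C E - C K t is nonincreasing for y = |u''|^2, and y is bounded at
   some time of each unit interval, where the dissipation is at most E 1. *)
Lemma flow_h2_bound : exists2 Y : R, 0 < Y & forall t : R, 2 <= t -> J (fun x => U 2 t x ^+ 2) <= Y.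
Proof.
have yE t : h2_gap L U (fun=> 0) t = J (fun x => U 2 t x ^+ 2).
  by apply: eq_cint => x; rewrite /jet2 expr0n/= !subr0.
have E0 := flow_energy_ge0 1; have M1 := sup_bound_ge1.
have PM x : [/\ `|(0 : R)| <= sup_bound, `|(0 : R)| <= sup_bound,
    `|jet2 (fun=> 0) x| <= sup_bound & `|jet3 (fun=> 0) (fun=> 0) x| <= sup_bound].
  have M0 : `|(0 : R)| <= sup_bound by rewrite normr0 (le_trans _ M1).
  by split => //; rewrite /jet2 /jet3 ?mulr0// expr0n/= subr0.
have N0 : 0 <= 2 * E 1 by rewrite mulr_ge0.
have [C C0 HC] := h2_gap_differential_inequality L0 F profile0 M1 PM N0.
pose K := (sup_bound + 0) ^+ 2 * L + 4 * E 1 + 2 * 0 ^+ 2 * L.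
have hK t : 1 <= t -> h1_gap L U (fun=> 0) (fun=> 0) t <= K.
  move=> t1; apply: h1_gap_bound => //; try exact: continuous_cstr.
  - by move=> _; rewrite normr0.
  - by move=> _; rewrite normr0.
have L0' : 0 <= L by exact: ltW.
have K0 : 0 <= K.
  apply: addr_ge0; first apply: addr_ge0.
  - by apply: mulr_ge0 => //; exact: sqr_ge0.
  - exact: mulr_ge0.
  - by apply: mulr_ge0 => //; apply: mulr_ge0 => //; exact: sqr_ge0.
have M4 : 0 <= 3 * (L ^+ 2 + 36 * sup_bound ^+ 4).
  apply: mulr_ge0 => //; apply: addr_ge0; first exact: sqr_ge0.
  by apply: mulr_ge0 => //; apply: exprn_ge0; exact: le_trans M1.
pose Y0 := L ^+ 2 * (3 * (L ^+ 2 + 36 * sup_bound ^+ 4) * (E 1 + K)).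
have Y00 : 0 <= Y0.
  apply: mulr_ge0; first exact: sqr_ge0.
  by apply: mulr_ge0 => //; exact: addr_ge0.
exists (expR (ln (1 + Y0) + C * E 1 + C * K)); first exact: expR_gt0.
move=> t t2.
have [|s [s1 s2 Ds]] := @good_time t; first by lra.
have s1' : 1 <= s by lra.
have s0 : 0 < s by lra.
have ys : h2_gap L U (fun=> 0) s <= Y0.
  apply: (le_trans (h2_gap_le L0 F profile0 M1 PM s0 (flow_sup_bound s1'))).
  apply: ler_wpM2l; first exact: sqr_ge0.
  apply: ler_wpM2l => //; apply: lerD; last exact: hK.
  rewrite Ds lerBlDr (le_trans (flow_energy_nonincreasing _ (_ : 1 <= t - 1)))//; first by lra.
  by rewrite lerDl flow_energy_ge0.
have y0 r : 0 <= h2_gap L U (fun=> 0) r by exact: h2_gap_ge0.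
pose V r := ln (1 + h2_gap L U (fun=> 0) r) + C * E r + r * - (C * K).
have dy := der_h2_gap L0 F profile0; have dE := der_flow_energy L0 F.
have dV : der [set r | 0 < r] V (fun r => (1 + h2_gap L U (fun=> 0) r)^-1
    * h2_gap_rate L U (fun=> 0) (fun=> 0) r - C * D r - C * K).
  rewrite /V; eapply der_ext.
    eapply derD; last by dert.
    eapply derD; last by dert.
    eapply der_ln; first by dert.
    by move=> r _; rewrite ltr_pwDl.
  by move=> r _ /=; ring.
have : V t <= V s.
  apply: (der_nonincreasing (ltW s2) _ dV).
    by move=> r /= /andP[sr _]; exact: lt_le_trans s0 sr.
  move=> r /andP[sr _].
  have r1 : 1 <= r by exact: le_trans s1' sr.
  have r0 : 0 < r by exact: lt_le_trans r1.
  have yp : 0 < 1 + h2_gap L U (fun=> 0) r by rewrite ltr_pwDl.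
  have Nr : J (fun x => (U 1 r x - 0) ^+ 2) <= 2 * E 1.
    rewrite (eq_cint L (g := fun x => U 1 r x ^+ 2)); last by move=> x; rewrite subr0.
    exact: flow_h1_bound.
  have := HC r r0 (flow_sup_bound r1) Nr.
  rewrite mulrCA => H.
  have {}H : (1 + h2_gap L U (fun=> 0) r)^-1 * h2_gap_rate L U (fun=> 0) (fun=> 0) r
      <= C * (D r + h1_gap L U (fun=> 0) (fun=> 0) r).
    by rewrite ler_pdivrMl.
  have := ler_wpM2l (ltW C0) (hK r r1); move: H.
  by set a := _ * h2_gap_rate _ _ _ _ _; set b := h1_gap _ _ _ _ _; lra.
rewrite /V => H.
have h1 : ln (1 + h2_gap L U (fun=> 0) s) <= ln (1 + Y0).
  by rewrite ler_ln ?posrE ?lerD2l//; [rewrite ltr_pwDl|rewrite ltr_pwDl].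
have h2 : C * E s <= C * E 1.
  by rewrite ler_wpM2l ?(ltW C0)// flow_energy_nonincreasing.
have h3 : 0 <= C * E t by rewrite mulr_ge0 ?flow_energy_ge0// ltW.
have h4 : C * K * (t - s) <= C * K.
  by rewrite ler_piMr ?mulr_ge0 ?(ltW C0)//; lra.
have h5 : ln (1 + h2_gap L U (fun=> 0) t) <= ln (1 + Y0) + C * E 1 + C * K by lra.
rewrite -yE; apply: (@le_trans _ _ (1 + h2_gap L U (fun=> 0) t)); first by rewrite lerDr.
rewrite -[leLHS]lnK ?ler_expR// posrE ltr_pwDl//.
Qed.

Section Drift.
Context (Y : R) (Y0 : 0 < Y) (HY : forall t : R, 2 <= t -> J (fun x => U 2 t x ^+ 2) <= Y).

Lemma h2_difference_bound (s t : R) : 2 <= s -> 2 <= t ->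
  J (fun x => (U 2 t x - U 2 s x) ^+ 2) <= 4 * Y.
Proof.
move=> s2 t2; have s0 : 0 < s by lra. have t0 : 0 < t by lra.
have a := flow_cts F s0 (isT : (2 <= 6)%N); have b := flow_cts F t0 (isT : (2 <= 6)%N).
apply: (@le_trans _ _ (J (fun x => 2 * U 2 t x ^+ 2 + 2 * U 2 s x ^+ 2))).
  apply: le_cint => //; [by cont|by cont|move=> x _].
  by have := sqr_ge0 (U 2 t x + U 2 s x); lra.
rewrite cintD; [|by cont|by cont].
rewrite !cintZ; [|by cont|by cont].
by have := HY s2; have := HY t2; lra.
Qed.

Lemma der_pairing_difference (s t : R) : 2 <= s -> 2 <= t -> der [set r | 0 < r]
  (fun r => J (fun x => (U 0 t x - U 0 s x) * U 0 r x))
  (fun r => J (fun x => (U 2 t x - U 2 s x) * mu2 U r x)).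
Proof.
move=> s2 t2; have s0 : 0 < s by lra. have t0 : 0 < t by lra.
have c j (j6 : (j <= 6)%N) := flow_cts F s0 j6.
have e j (j6 : (j <= 6)%N) := flow_cts F t0 j6.
move=> r /= r0.
have d j (j6 : (j < 6)%N) : der setT (fun x => U j t x - U j s x)
    (fun x => U j.+1 t x - U j.+1 s x).
  by have d1 := flow_der F s0 j6; have d2 := flow_der F t0 j6; derr.
apply: (pairing_is_derive L0 F r0 (d 0 isT) (d 1 isT)).
- by have := c 2 isT; have := e 2 isT => a b; cont.
- by move=> x; rewrite (flow_periodic F s0) (flow_periodic F t0).
Qed.

Lemma cint_difference_sqr (s t : R) : 2 <= s -> 2 <= t ->
  J (fun x => (U 0 t x - U 0 s x) ^+ 2) = J (fun x => (U 0 t x - U 0 s x) * U 0 t x)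
   - J (fun x => (U 0 t x - U 0 s x) * U 0 s x).
Proof.
move=> s2 t2; have s0 : 0 < s by lra. have t0 : 0 < t by lra.
have a := flow_cts F s0 (isT : (0 <= 6)%N); have b := flow_cts F t0 (isT : (0 <= 6)%N).
rewrite -cintB; [|by cont|by cont].
by apply: eq_cint => x; ring.
Qed.

(** With s and t fixed, (u(t) - u(s), u(r)) + (k / 2) E(r) - (2 Y / k) r is nonincreasing in r, by
    the weighted inequality between (u(t) - u(s))'' and m''. A large k favours elapsed time, a small
    k the energy drop. *)
Lemma drift (s t k : R) : 2 <= s -> s <= t -> 0 < k ->
  J (fun x => (U 0 t x - U 0 s x) ^+ 2) <= k / 2 * (E s - E t) + (t - s) * (2 * Y / k).
Proof.
move=> s2 st k0; have t2 : 2 <= t by exact: le_trans st.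
have dp := der_pairing_difference s2 t2; have dE := der_flow_energy L0 F.
pose V r := J (fun x => (U 0 t x - U 0 s x) * U 0 r x) + k / 2 * E r + - (2 * Y / k) * r.
have dV : der [set r | 0 < r] V (fun r => J (fun x => (U 2 t x - U 2 s x) * mu2 U r x)
    - k / 2 * D r - 2 * Y / k).
  by rewrite /V; derr.
have : V t <= V s.
  apply: (der_nonincreasing st _ dV) => r /andP[sr _] /=; first by lra.
  have r0 : 0 < r by lra.
  have s0 : 0 < s by lra. have t0 : 0 < t by lra.
  have a := flow_cts F s0 (isT : (2 <= 6)%N); have b := flow_cts F t0 (isT : (2 <= 6)%N).
  have cz : cts (fun x => U 2 t x - U 2 s x) by cont.
  have cm := der_continuous (der_mu2 F r0).
  have := cint_amgm L k^-1 cz cm; rewrite -/(D r).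
  have := ler_wpM2l (sqr_ge0 k^-1) (h2_difference_bound s2 t2).
  set A := J (fun x => _ ^+ 2); set B := J _ => h1 h2.
  have h3 : 2 * k^-1 * B <= k^-1 ^+ 2 * (4 * Y) + D r by lra.
  have := ler_wpM2l (ltW (divr_gt0 k0 (ltr0n _ 2))) h3.
  rewrite (_ : k / 2 * (2 * k^-1 * B) = B); last by field; rewrite gt_eqF.
  rewrite (_ : k / 2 * (k^-1 ^+ 2 * (4 * Y) + D r) = 2 * Y / k + k / 2 * D r); last first.
    by field; rewrite gt_eqF.
  by lra.
by rewrite /V cint_difference_sqr//; lra.
Qed.

End Drift.
End Compactness.

(** * A limit profile along times of small dissipation *)

Section LimitProfile.
Context {R : realType} (L : R) (L0 : 0 < L).
Local Notation J := (cint L).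
Context (U : nat -> R -> R -> R) (F : flow L U).
Local Notation D := (dissipation L U).
Local Notation E := (flow_energy L U).

Lemma profile_of_limit (u u1 m : nat -> R -> R) (phi phi1 : R -> R) (c M : R) :
  (forall n, der setT (u n) (u1 n)) ->
  (forall n, der setT (u1 n) (fun x => u n x ^+ 3 - u n x + m n x)) ->
  (forall n, cts (m n)) -> (forall n, periodic (u n) L) -> (forall n, J (u n) = 0) ->
  (forall n x, `|u n x| <= M) ->
  uniformly u phi -> uniformly u1 phi1 -> uniformly m (fun=> c) ->
  profile L phi phi1 c.
Proof.
move=> du du1 cm up um uM uphi u1phi1 mc.
have M0 : 0 <= M by exact: le_trans (normr_ge0 _) (uM 0 0).
have cu n := der_continuous (du n); have cu1 n := der_continuous (du1 n).
have phiM x : `|phi x| <= M.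
  apply/ler_addgt0Pr => e e0; have [N HN] := uphi e e0.
  rewrite -[phi x](subKr (u N x)) (le_trans (ler_normB _ _))// lerD//.
  exact: HN.
have dphi : der setT phi phi1 by exact: uniformly_der du cu1 uphi u1phi1.
have cphi := der_continuous dphi.
split => //.
- apply: (uniformly_der du1 _ u1phi1) => [n|e e0].
    by have a := cu n; have b := cm n; cont.
  pose k := 3 * M ^+ 2 + 1.
  have k0 : 0 < k by rewrite ltr_wpDl// mulr_ge0// sqr_ge0.
  have e1 : 0 < e / (2 * k) by rewrite divr_gt0// mulr_gt0.
  have e2 : 0 < e / 2 by rewrite divr_gt0.
  have [N1 HN1] := uphi _ e1; have [N2 HN2] := mc _ e2.
  exists (maxn N1 N2) => n; rewrite geq_max => /andP[n1 n2] x.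
  rewrite (_ : _ - _ = (u n x ^+ 2 + u n x * phi x + phi x ^+ 2 - 1) * (u n x - phi x)
    + (m n x - c)); last by ring.
  rewrite (le_trans (ler_normD _ _))// [e]splitr lerD ?HN2//.
  have -> : e / 2 = k * (e / (2 * k)) by field; rewrite gt_eqF.
  rewrite normrM ler_pM ?HN1// /k (le_trans (ler_normB _ _))// normr1 lerD//.
  rewrite (_ : 3 * M ^+ 2 = M ^+ 2 + M * M + M ^+ 2); last by ring.
  rewrite (le_trans (ler_normD _ _))// lerD//.
    rewrite (le_trans (ler_normD _ _))// lerD//.
      by rewrite normrX ler_sqr ?nnegrE.
    by rewrite normrM ler_pM.
  by rewrite normrX ler_sqr ?nnegrE.
- move=> x; apply: (tends_unique (uniformly_tends (x + L) uphi)).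
  have := uniformly_tends x uphi.
  by rewrite (_ : (fun n => u n x) = (fun n => u n (x + L)))//; apply/funext => n; rewrite up.
- apply/eqP; rewrite -normr_le0; apply/ler_addgt0Pl => e e0; rewrite addr0.
  have eL : 0 < e / L by rewrite divr_gt0.
  have [N HN] := uphi _ eL.
  have a := cu N.
  rewrite -[J phi]subr0 -(um N) -cintB//.
  rewrite (le_trans (@cint_norm_le _ _ L0 _ (e / L) _ _))//; first by cont.
    by move=> x _; rewrite distrC HN.
  by rewrite divfK// gt_eqF.
Qed.

Lemma energy_of_limit (u u1 : nat -> R -> R) (phi phi1 : R -> R) (M : R) :
  (forall n, cts (u n)) -> (forall n, cts (u1 n)) -> cts phi -> cts phi1 ->
  1 <= M -> (forall n x, `|u n x| <= M) -> (forall n x, `|u1 n x| <= M) ->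
  uniformly u phi -> uniformly u1 phi1 ->
  tends (fun n => energy L (u n) (u1 n)) (energy L phi phi1).
Proof.
move=> cu cu1 cphi cphi1 M1 uM u1M uphi u1phi1 e e0.
have M0 : 0 <= M by exact: le_trans M1.
have bnd (f : nat -> R -> R) g : (forall n x, `|f n x| <= M) -> uniformly f g ->
    forall x, `|g x| <= M.
  move=> fM fg x; apply/ler_addgt0Pr => d d0; have [N HN] := fg d d0.
  rewrite -[g x](subKr (f N x)) (le_trans (ler_normB _ _))// lerD//.
  exact: HN.
have phiM := bnd _ _ uM uphi; have phi1M := bnd _ _ u1M u1phi1.
pose k := M + M * (M ^+ 2 + 1).
have k0 : 0 < k.
  by rewrite ltr_wpDr ?mulr_ge0 ?addr_ge0 ?sqr_ge0// (lt_le_trans ltr01).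
have ek : 0 < e / (k * L) by rewrite divr_gt0// mulr_gt0.
have [N1 HN1] := uphi _ ek; have [N2 HN2] := u1phi1 _ ek.
exists (maxn N1 N2) => n; rewrite geq_max => /andP[n1 n2].
have a := cu n; have b := cu1 n.
rewrite /energy -cintB; [|by cont|by cont].
have -> : e = k * (e / (k * L)) * L by field; rewrite !gt_eqF.
apply: cint_norm_le => //; first by cont.
move=> x _; set d := e / (k * L) in ek HN1 HN2 *.
rewrite (_ : _ - _ = 2^-1 * ((u1 n x + phi1 x) * (u1 n x - phi1 x))
  + 4^-1 * (((u n x + phi x) * (u n x ^+ 2 + phi x ^+ 2 - 2)) * (u n x - phi x))); last by ring.
have h1 : `|(u1 n x + phi1 x) * (u1 n x - phi1 x)| <= (M + M) * d.
  by rewrite normrM ler_pM ?HN2// (le_trans (ler_normD _ _))// lerD.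
have h2 : `|((u n x + phi x) * (u n x ^+ 2 + phi x ^+ 2 - 2)) * (u n x - phi x)|
    <= ((M + M) * (M ^+ 2 + M ^+ 2 + 2)) * d.
  rewrite normrM ler_pM ?HN1// normrM ler_pM//.
    by rewrite (le_trans (ler_normD _ _))// lerD.
  rewrite (le_trans (ler_normB _ _))// (ger0_norm (ler0n _ 2)) lerD//.
  by rewrite (le_trans (ler_normD _ _))// lerD// normrX ler_sqr ?nnegrE.
rewrite (le_trans (ler_normD _ _))// (normrM 2^-1) (normrM 4^-1).
rewrite (ger0_norm (_ : 0 <= 2^-1))// (ger0_norm (_ : 0 <= 4^-1))// /k.
by move: h1 h2; set p := `|_|; set q := `|_|; lra.
Qed.

(** Since \int u'' = 0, the integral of m is - \int (u^3 - u), which the sup bound controls; the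
    oscillation bound passes from the mean to the value at 0. *)
Lemma mu0_origin_bound (t : R) : 1 <= t ->
  `|mu0 U t 0| <= L * Num.sqrt (L * D t) + sup_bound L U ^+ 3 + sup_bound L U.
Proof.
move=> t1; have t0 : 0 < t by exact: lt_le_trans t1.
have M1 := sup_bound_ge1 L0 U; set M := sup_bound L U in M1 *.
have M0 : 0 <= M by exact: le_trans M1.
have c0 := flow_cts F t0 (isT : (0 <= 6)%N); have c2 := flow_cts F t0 (isT : (2 <= 6)%N).
have S := flow_state F t0; have cm := der_continuous (state_m S).
rewrite -(ler_pM2r L0) -[X in _ * X <= _](ger0_norm (ltW L0)) -normrM.
rewrite -(cint_cst L0 (mu0 U t 0)).
have -> : J (fun=> mu0 U t 0) =
    J (fun x => - (mu0 U t x - mu0 U t 0) - (U 0 t x ^+ 3 - U 0 t x)).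
  apply/eqP; rewrite -subr_eq0 -cintB; [|by cont|by cont].
  apply/eqP; apply: (@cint_der _ _ L0 (U 1 t)).
  - apply: (der_ext (flow_der F t0 (isT : (1 < 6)%N))) => x _.
    by rewrite /mu0; ring.
  - by cont.
  - exact: flow_periodic_jet.
apply: cint_norm_le => //; first by cont.
move=> x _; have ux := flow_sup_bound L0 F t1 x.
have h1 : `|mu0 U t x - mu0 U t 0| <= L * Num.sqrt (L * D t).
  exact (state_m_oscillation L0 S x).
have h2 : `|U 0 t x ^+ 3 - U 0 t x| <= M ^+ 3 + M.
  rewrite (le_trans (ler_normB _ _))// lerD//.
  by rewrite normrX lerXn2r ?nnegrE.
have := ler_normB (- (mu0 U t x - mu0 U t 0)) (U 0 t x ^+ 3 - U 0 t x).
by rewrite normrN; lra.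
Qed.

(** Compactness through the differential equation: at the chosen times u solves a second-order
    equation with nearly constant forcing m, so convergence of the three numbers u(0), u'(0), m(0)
    along a subsequence spreads to the whole period by Gronwall. *)
Lemma limit_profile : exists phi phi1 c (s : nat -> R),
  [/\ profile L phi phi1 c, forall n, n%:R + 2 <= s n,
      uniformly (fun n => U 0 (s n)) phi, uniformly (fun n => U 1 (s n)) phi1 &
      tends (fun n => E (s n)) (energy L phi phi1)].
Proof.
have [Y Y0 HY] := flow_h2_bound L0 F.
have [e8 [e8E Ee8]] := flow_energy_limit L0 F.
have M1 := sup_bound_ge1 L0 U; set M := sup_bound L U in M1.
have M0 : 0 <= M by exact: le_trans M1.
have /choice[s0 Hs0] : forall n : nat, exists s, [/\ n%:R + 2 < s & D s <= E (n%:R + 2) - e8].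
  move=> n; have n0 : 0 <= n%:R :> R by [].
  have [|s [s1 s2 Ds]] := @good_time _ _ L0 _ F (n%:R + 3); first by lra.
  exists s; split; first by lra.
  rewrite Ds (_ : n%:R + 3 - 1 = n%:R + 2); last by ring.
  by rewrite lerD2l lerN2; apply: e8E; lra.
have s0ge n : 2 <= s0 n.
  by have [h _] := Hs0 n; have : 0 <= n%:R :> R by []; lra.
have s0ge1 n : 1 <= s0 n by have := s0ge n; lra.
have s0gt0 n : 0 < s0 n by have := s0ge n; lra.
have Dsmall e : 0 < e -> exists N, forall n, (N <= n)%N -> D (s0 n) <= e.
  move=> e0; have [T T2 HT] := Ee8 e e0.
  exists (Num.truncn T) => n Tn; have [_ h] := Hs0 n; apply: (le_trans h).
  rewrite lerBlDl; apply: HT.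
  have /andP[_ h2] := truncn_itv (le_trans (ler0n _ 2) T2).
  have : (Num.truncn T)%:R <= n%:R :> R by rewrite ler_nat.
  by rewrite -natr1 in h2; lra.
pose osc n := L * Num.sqrt (L * D (s0 n)).
have osc0 n : 0 <= osc n by rewrite mulr_ge0 ?sqrtr_ge0// ltW.
have D0 n : 0 <= D (s0 n) by exact: dissipation_ge0.
have oscsmall e : 0 < e -> exists N, forall n, (N <= n)%N -> osc n <= e.
  move=> e0; have e1 : 0 < e ^+ 2 / L ^+ 3 by rewrite divr_gt0// exprn_gt0.
  have [N HN] := Dsmall _ e1; exists N => n Nn.
  rewrite -ler_sqr ?nnegrE ?(ltW e0)// /osc exprMn sqr_sqrtr; last by rewrite mulr_ge0 ?(ltW L0).
  have := HN n Nn; rewrite ler_pdivlMr ?exprn_gt0// => h.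
  by rewrite (_ : L ^+ 2 * (L * D (s0 n)) = D (s0 n) * L ^+ 3)//; ring.
have oscL n : osc n <= L * Num.sqrt (L * E 1).
  rewrite ler_wpM2l ?(ltW L0)// ler_wsqrtr// ler_wpM2l ?(ltW L0)//.
  have [_ h] := Hs0 n; apply: (le_trans h).
  have : 0 <= e8.
    apply/ler_addgt0Pr => e /Ee8[T T2 /(_ T (lexx _))].
    by apply: le_trans; exact: flow_energy_ge0.
  have n0 : 0 <= n%:R :> R by [].
  have : E (n%:R + 2) <= E 1 by apply: (flow_energy_nonincreasing L0 F) => //; lra.
  by lra.
have U1b n x : `|U 1 (s0 n) x| <= Num.sqrt (L * Y).
  rewrite -sqrtr_sqr ler_wsqrtr//.
  have p1 := flow_periodic_jet F (s0gt0 n).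
  apply: (le_trans (sobolev_sup L0 (flow_der F (s0gt0 n) (isT : (1 < 6)%N))
     (flow_der F (s0gt0 n) (isT : (2 < 6)%N)) (flow_cts F (s0gt0 n) (isT : (3 <= 6)%N))
     (p1 1 isT) _ x)).
    exact: (cint_der L0 (flow_der F (s0gt0 n) (isT : (0 < 6)%N))
      (flow_cts F (s0gt0 n) (isT : (1 <= 6)%N)) (p1 0 isT)).
  by rewrite ler_wpM2l ?(ltW L0)// HY.
pose B := M + Num.sqrt (L * Y) + (L * Num.sqrt (L * E 1) + M ^+ 3 + M).
have M3 : 0 <= M ^+ 3 by exact: exprn_ge0.
have q1 : 0 <= Num.sqrt (L * Y) by exact: sqrtr_ge0.
have q2 : 0 <= L * Num.sqrt (L * E 1) by rewrite mulr_ge0 ?sqrtr_ge0// ltW.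
have [f [a [b [c [fge fa fb fc]]]]] := @bounded_subsequence3 _
  (fun n => U 0 (s0 n) 0) (fun n => U 1 (s0 n) 0) (fun n => mu0 U (s0 n) 0) B
  ltac:(by move=> n; have := flow_sup_bound L0 F (s0ge1 n) 0; rewrite -/M /B; lra)
  ltac:(by move=> n; have := U1b n 0; rewrite /B; lra)
  ltac:(by move=> n; have := mu0_origin_bound (s0ge1 n); have := oscL n; rewrite -/M /B /osc; lra).
pose s n := s0 (f n).
have S n := flow_state F (s0gt0 (f n)).
have uM n x : `|U 0 (s n) x| <= M := flow_sup_bound L0 F (s0ge1 (f n)) x.
have mosc n x : `|mu0 U (s n) x - mu0 U (s n) 0| <= osc (f n).
  exact (state_m_oscillation L0 (S n) x).
pose G := expR ((2 + (3 * M ^+ 2 + 1)) * L).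
have G0 : 0 < G by exact: expR_gt0.
have key e : 0 < e -> exists N, forall m n, (N <= m)%N -> (N <= n)%N -> forall x,
    (U 0 (s m) x - U 0 (s n) x) ^+ 2 + (U 1 (s m) x - U 1 (s n) x) ^+ 2 <= e ^+ 2.
  (* Gronwall will give 3 d^2 G, and 3 G <= 4 (1 + G)^2. *)
  move=> e0; pose d := e / (2 * (1 + G)).
  have d0 : 0 < d by rewrite divr_gt0// mulr_gt0// addr_gt0.
  have d2 : 0 < d / 2 by rewrite divr_gt0.
  have d4 : 0 < d / 4 by rewrite divr_gt0.
  have [Na Ha] := fa _ d2; have [Nb Hb] := fb _ d2; have [Nc Hc] := fc _ d4.
  have [No Ho] := oscsmall _ d4.
  exists (maxn (maxn Na Nb) (maxn Nc No)) => m n.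
  rewrite !geq_max => /andP[/andP[ma mb] /andP[mc mo]] /andP[/andP[na nb] /andP[nc no]] x.
  have fo k : (No <= k)%N -> osc (f k) <= d / 4.
    by move=> kN; apply: Ho; exact: leq_trans kN (fge k).
  have da : `|U 0 (s m) 0 - U 0 (s n) 0| <= d.
    rewrite (_ : _ - _ = (U 0 (s m) 0 - a) - (U 0 (s n) 0 - a)); last by ring.
    rewrite (le_trans (ler_normB _ _))// [d]splitr lerD//; [exact: Ha|exact: Ha].
  have db : `|U 1 (s m) 0 - U 1 (s n) 0| <= d.
    rewrite (_ : _ - _ = (U 1 (s m) 0 - b) - (U 1 (s n) 0 - b)); last by ring.
    rewrite (le_trans (ler_normB _ _))// [d]splitr lerD//; [exact: Hb|exact: Hb].
  have dm y : `|mu0 U (s m) y - mu0 U (s n) y| <= d.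
    rewrite (_ : _ - _ = (mu0 U (s m) y - mu0 U (s m) 0) - (mu0 U (s n) y - mu0 U (s n) 0)
      + (mu0 U (s m) 0 - c) - (mu0 U (s n) 0 - c)); last by ring.
    rewrite (_ : d = d / 4 + d / 4 + d / 4 + d / 4); last by field.
    apply: (le_trans (ler_normB _ _)); apply: lerD; last exact: Hc.
    apply: (le_trans (ler_normD _ _)); apply: lerD; last exact: Hc.
    apply: (le_trans (ler_normB _ _)); apply: lerD.
      by apply: (le_trans (mosc _ _)); exact: fo.
    by apply: (le_trans (mosc _ _)); exact: fo.
  have dw : der setT (fun y => U 0 (s m) y - U 0 (s n) y) (fun y => U 1 (s m) y - U 1 (s n) y).
    by have h1 := state_der (S m); have h2 := state_der (S n); rewrite /s; derr.
  have dw1 : der setT (fun y => U 1 (s m) y - U 1 (s n) y)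
      (fun y => (U 0 (s m) y ^+ 2 + U 0 (s m) y * U 0 (s n) y + U 0 (s n) y ^+ 2 - 1)
        * (U 0 (s m) y - U 0 (s n) y) + (mu0 U (s m) y - mu0 U (s n) y)).
    by have h1 := state_der1 (S m); have h2 := state_der1 (S n); rewrite /s; derr.
  have K0 : 0 <= 3 * M ^+ 2 + 1 by rewrite addr_ge0// mulr_ge0// sqr_ge0.
  apply: (le_trans (@gronwall_periodic _ L _ _ _ (3 * M ^+ 2 + 1) d 0 x L0 _ K0 (ltW d0) dw dw1 _)).
  - by move=> y; rewrite !(flow_periodic F)// /s.
  - move=> y; rewrite (le_trans (ler_normD _ _))// lerD// normrM ler_wpM2r//.
    rewrite (le_trans (ler_normB _ _))// normr1 lerD//.
    rewrite (_ : 3 * M ^+ 2 = M ^+ 2 + M * M + M ^+ 2); last by ring.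
    rewrite (le_trans (ler_normD _ _))// lerD//.
      rewrite (le_trans (ler_normD _ _))// lerD//.
        by rewrite normrX ler_sqr ?nnegrE.
      by rewrite normrM ler_pM.
    by rewrite normrX ler_sqr ?nnegrE.
  - rewrite -/G.
    have h1 : (U 0 (s m) 0 - U 0 (s n) 0) ^+ 2 <= d ^+ 2.
      by rewrite -(real_normK (num_real (_ - _))) ler_sqr ?nnegrE// ltW.
    have h2 : (U 1 (s m) 0 - U 1 (s n) 0) ^+ 2 <= d ^+ 2.
      by rewrite -(real_normK (num_real (_ - _))) ler_sqr ?nnegrE// ltW.
    apply: (@le_trans _ _ (3 * d ^+ 2 * G)); first by rewrite ler_wpM2r ?(ltW G0)//; lra.
    have -> : e = d * (2 * (1 + G)) by rewrite /d divfK// gt_eqF// mulr_gt0// addr_gt0.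
    rewrite (_ : (d * (2 * (1 + G))) ^+ 2 = d ^+ 2 * (2 * (1 + G)) ^+ 2); last by ring.
    rewrite (_ : 3 * d ^+ 2 * G = d ^+ 2 * (3 * G)); last by ring.
    rewrite ler_wpM2l ?sqr_ge0//.
    by have := sqr_ge0 G; move: G0; lra.
have sqr_le (p q e : R) : 0 < e -> p ^+ 2 + q ^+ 2 <= e ^+ 2 -> `|p| <= e /\ `|q| <= e.
  move=> e0 pq; split; rewrite -ler_sqr ?nnegrE ?(ltW e0)// real_normK ?num_real//.
    by have := sqr_ge0 q; lra.
  by have := sqr_ge0 p; lra.
have [phi uphi] : exists phi, uniformly (fun n => U 0 (s n)) phi.
  apply: uniformly_cauchy => e e0; have [N HN] := key e e0; exists N => m n Nm Nn x.
  by have [] := sqr_le _ _ _ e0 (HN m n Nm Nn x).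
have [phi1 u1phi1] : exists phi1, uniformly (fun n => U 1 (s n)) phi1.
  apply: uniformly_cauchy => e e0; have [N HN] := key e e0; exists N => m n Nm Nn x.
  by have [] := sqr_le _ _ _ e0 (HN m n Nm Nn x).
have mc : uniformly (fun n => mu0 U (s n)) (fun=> c).
  move=> e e0; have e2 : 0 < e / 2 by rewrite divr_gt0.
  have [N1 H1] := oscsmall _ e2; have [N2 H2] := fc _ e2.
  exists (maxn N1 N2) => n; rewrite geq_max => /andP[n1 n2] x.
  rewrite (_ : _ - _ = (mu0 U (s n) x - mu0 U (s n) 0) + (mu0 U (s n) 0 - c)); last by ring.
  rewrite (le_trans (ler_normD _ _))// [e]splitr lerD//; last exact: H2.
  by rewrite (le_trans (mosc _ _))// H1// (leq_trans n1).
have P : profile L phi phi1 c.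
  apply: (@profile_of_limit _ _ _ phi phi1 c M _ _ _ _ _ uM uphi u1phi1 mc) => n.
  - exact: state_der (S n).
  - exact: state_der1 (S n).
  - exact: der_continuous (state_m (S n)).
  - exact: state_periodic (S n).
  - exact: state_mean (S n).
exists phi, phi1, c, s; split => //.
- move=> n; have [h _] := Hs0 (f n); have : n%:R <= (f n)%:R :> R by rewrite ler_nat.
  by rewrite /s; lra.
- apply: (@energy_of_limit _ _ phi phi1 (M + Num.sqrt (L * Y))) => //.
  + by move=> n; exact: der_continuous (state_der (S n)).
  + by move=> n; exact: der_continuous (state_der1 (S n)).
  + exact: der_continuous (profile_der P).
  + exact: der_continuous (profile_der1 P).
  + by lra.
  + by move=> n x; have := uM n x; lra.
  + by move=> n x; have := U1b (f n) x; rewrite /s; lra.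
Qed.

End LimitProfile.

(** * Convergence in L^2 *)

Section Convergence.
Context {R : realType} (L : R) (L0 : 0 < L).
Local Notation J := (cint L).
Context (U : nat -> R -> R -> R) (F : flow L U).
Local Notation D := (dissipation L U).
Local Notation E := (flow_energy L U).

Lemma cint_triangle (f g h : R -> R) : cts f -> cts g -> cts h ->
  J (fun x => (f x - h x) ^+ 2) <=
  2 * J (fun x => (f x - g x) ^+ 2) + 2 * J (fun x => (g x - h x) ^+ 2).
Proof.
move=> cf cg ch; rewrite -!cintZ; [|by cont|by cont].
rewrite -cintD; [|by cont|by cont].
apply: le_cint => //; [by cont|by cont|move=> x _].
by have := sqr_ge0 ((f x - g x) - (g x - h x)); lra.
Qed.

Context (Y : R) (Y0 : 0 < Y) (HY : forall t : R, 2 <= t -> J (fun x => U 2 t x ^+ 2) <= Y).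
Context (e8 : R) (e8E : forall t : R, 0 < t -> e8 <= E t).
Hypothesis Ee8 : forall e : R, 0 < e -> exists2 T : R, 2 <= T & forall t : R, T <= t -> E t <= e8 + e.

(** Testing u'' = u^3 - u + m with u eliminates \int u'^2, and the quadratic terms cancel; no
    information on the linearization at 0 is needed afterwards. *)
Lemma energy_quartic (t : R) : 0 < t ->
  E t = L / 4 - 2^-1 * J (fun x => mu0 U t x * U 0 t x) - 4^-1 * J (fun x => U 0 t x ^+ 4).
Proof.
move=> t0; have S := flow_state F t0.
have c0 := der_continuous (state_der S); have c1 := der_continuous (state_der1 S).
have cm := der_continuous (state_m S).
have d0 := state_der S; have d1 := state_der1 S.
rewrite -!cintZ; [|by cont|by cont].
rewrite (_ : L / 4 = J (fun=> 4^-1)); last by rewrite cint_cst// mulrC.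
rewrite -cintB; [|by cont|by cont].
rewrite -cintB; [|by cont|by cont].
rewrite /flow_energy /energy.
apply/eqP; rewrite -subr_eq0 -cintB; [|by cont|by cont].
apply/eqP; apply: (@cint_der _ _ L0 (fun x => 2^-1 * (U 0 t x * U 1 t x))).
- eapply der_ext; first by dert.
  by move=> x _ /=; field.
- by cont.
- by move=> x; rewrite !(flow_periodic_jet F t0).
Qed.

(* Around phi = 0 the linearization may be degenerate; here the quartic term of
   the energy identity controls u at times of small dissipation. *)
Lemma converges_to_zero : L / 4 <= e8 -> forall e : R, 0 < e ->
  exists T, forall t : R, T <= t -> J (fun x => U 0 t x ^+ 2) <= e.
Proof.
move=> Le8 e e0; have M1 := sup_bound_ge1 L0 U; set M := sup_bound L U in M1.
have M0 : 0 < M by exact: lt_le_trans M1.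
(* Chosen so that (\int u^2)^2 <= L \int u^4 <= 2 M L^3 q = (e / 4)^2 at a good time. *)
pose q := (e / 4) ^+ 2 / (2 * M * L ^+ 3).
have L3 : 0 < L ^+ 3 by rewrite exprn_gt0.
have q0 : 0 < q by rewrite divr_gt0 ?exprn_gt0 ?divr_gt0// !mulr_gt0.
have good s : 1 <= s -> L * D s <= q ^+ 2 -> J (fun x => U 0 s x ^+ 2) <= e / 4.
  move=> s1 Dq; have s0 : 0 < s by lra.
  have S := flow_state F s0.
  have c0 := der_continuous (state_der S); have cm := der_continuous (state_m S).
  (* From E >= L / 4 the quartic integral is at most - 2 \int m u, and since u has zero mean, m may
     be replaced there by m - m(0), which the dissipation controls. *)
  have H4 : J (fun x => U 0 s x ^+ 4) <= 2 * (L * q * M * L).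
    have -> : J (fun x => U 0 s x ^+ 4) = L - 4 * E s - 2 * J (fun x => mu0 U s x * U 0 s x).
      by have := energy_quartic s0; lra.
    have -> : J (fun x => mu0 U s x * U 0 s x) =
        J (fun x => (mu0 U s x - mu0 U s 0) * U 0 s x).
      apply/eqP; rewrite -subr_eq0 -cintB; [|by cont|by cont].
      rewrite (@eq_cint _ _ _ (fun x => mu0 U s 0 * U 0 s x)); last by move=> x; ring.
      by rewrite cintZ// (flow_mean F s0) mulr0.
    have : `|J (fun x => (mu0 U s x - mu0 U s 0) * U 0 s x)| <= (L * q * M) * L.
      apply: cint_norm_le => //; first by cont.
      move=> x _; rewrite normrM ler_pM//; last exact: (flow_sup_bound L0 F s1 x).
      apply: (le_trans (state_m_oscillation L0 S x)).
      rewrite ler_wpM2l ?(ltW L0)// -[leRHS]ger0_norm ?(ltW q0)// -sqrtr_sqr.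
      exact: ler_wsqrtr.
    rewrite ler_norml => /andP[h _].
    by have := e8E s0; lra.
  have e4 : 0 <= e / 4 by rewrite divr_ge0// ltW.
  have J0 : 0 <= J (fun x => U 0 s x ^+ 2) by apply: cint_ge0 => x _; exact: sqr_ge0.
  rewrite -ler_sqr ?nnegrE//.
  have c2 : cts (fun x => U 0 s x ^+ 2) by cont.
  apply: (le_trans (cint_sqr L0 c2)).
  rewrite (@eq_cint _ _ _ (fun x => U 0 s x ^+ 4)); last by move=> x; ring.
  apply: (le_trans (ler_wpM2l (ltW L0) H4)).
  rewrite (_ : L * (2 * (L * q * M * L)) = q * (2 * M * L ^+ 3)); last by ring.
  by rewrite /q divfK// gt_eqF// !mulr_gt0.
(* Then 2 Y / k = e / 8, the allowance for a drift over less than one unit of time. *)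
pose k := 16 * Y / e.
have k0 : 0 < k by rewrite divr_gt0// mulr_gt0.
have q2 : 0 < q ^+ 2 / L by rewrite divr_gt0// exprn_gt0.
have [T1 T12 HT1] := Ee8 q2.
have ek : 0 < e / (4 * k) by rewrite divr_gt0// mulr_gt0.
have [T2 T22 HT2] := Ee8 ek.
exists (T1 + T2 + 1) => t tT.
have [|s [s1 s2 Ds]] := @good_time _ _ L0 _ F t; first by lra.
have s0 : 0 < s by lra. have t0 : 0 < t by lra.
have Dq : L * D s <= q ^+ 2.
  rewrite mulrC -ler_pdivlMr// Ds.
  have h2 : E (t - 1) <= e8 + q ^+ 2 / L by apply: HT1; lra.
  by have := e8E t0; lra.
have s1' : 1 <= s by lra.
have {}good := good s s1' Dq.
have s2' : 2 <= s by lra.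
have := drift L0 F HY s2' (ltW s2) k0.
have := cint_triangle (flow_cts F t0 (isT : (0 <= 6)%N)) (flow_cts F s0 (isT : (0 <= 6)%N))
  (@continuous_cstr _ 0).
rewrite (eq_cint L (g := fun x => U 0 t x ^+ 2)); last by move=> x; rewrite subr0.
rewrite (eq_cint L (f := fun x => (U 0 s x - 0) ^+ 2) (g := fun x => U 0 s x ^+ 2)); last first.
  by move=> x; rewrite subr0.
set a := J (fun x => (_ - _) ^+ 2); set b := J (fun x => U 0 t x ^+ 2).
set d := J (fun x => U 0 s x ^+ 2) in good * => h1 h2.
have h3 : k / 2 * (E s - E t) <= e / 8.
  have -> : e / 8 = k / 2 * (e / (4 * k)) by field; rewrite gt_eqF.
  rewrite ler_wpM2l//; first by rewrite divr_ge0// ltW.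
  have h4 : E s <= e8 + e / (4 * k) by apply: HT2; lra.
  by have := e8E t0; lra.
have h4 : (t - s) * (2 * Y / k) <= e / 8.
  rewrite (_ : 2 * Y / k = e / 8); last by rewrite /k; field; rewrite !gt_eqF.
  by rewrite ler_piMl// ?divr_ge0 ?(ltW e0)//; lra.
by lra.
Qed.

Section NonzeroLimit.
Context (phi phi1 : R -> R) (P : profile L phi phi1 0).
Let cphi : cts phi := der_continuous (profile_der P).

Definition l2_gap (t : R) := J (fun x => (U 0 t x - phi x) ^+ 2).

Lemma l2_gap_continuous (t : R) : 0 < t -> {for t, continuous l2_gap}.
Proof.
move=> t0; have c0 := flow_cts F t0 (isT : (0 <= 6)%N).
apply: (@is_derive_continuous _ _ _ (J (fun x => (U 0 t x + U 0 t x - 2 * phi x) * mu4 U t x))).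
apply: (flow_functional_is_derive L0 F t0 (K := fun s x => U 0 s x + U 0 t x - 2 * phi x)).
- by move=> s s0; have f0 := flow_cts F s0 (isT : (0 <= 6)%N); cont.
- have j0 := flow_jc F t0 (isT : (0 <= 6)%N).
  have k0 := @jc_space _ t _ c0; have k1 := @jc_space _ t _ cphi.
  by jcont.
- move=> s s0; have f0 := flow_cts F s0 (isT : (0 <= 6)%N).
  rewrite /l2_gap -cintB; [|by cont|by cont].
  by apply: eq_cint => x; ring.
Qed.

Lemma h2_gap_bounded : exists2 B : R, 0 < B & forall t : R, 2 <= t -> h2_gap L U phi t <= B.
Proof.
have c2 : cts (jet2 phi) := der_continuous (der_jet2 P).
have J0 : 0 <= J (fun x => jet2 phi x ^+ 2) by apply: cint_ge0 => x _; exact: sqr_ge0.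
exists (2 * Y + 2 * J (fun x => jet2 phi x ^+ 2)); first by rewrite ltr_pwDl ?mulr_gt0 ?mulr_ge0.
move=> t t2; have t0 : 0 < t by lra.
have d2 := flow_cts F t0 (isT : (2 <= 6)%N).
have := cint_triangle d2 (@continuous_cstr _ 0) c2.
rewrite (eq_cint L (f := fun x => (U 2 t x - 0) ^+ 2) (g := fun x => U 2 t x ^+ 2)); last first.
  by move=> x; rewrite subr0.
rewrite (eq_cint L (f := fun x => (0 - jet2 phi x) ^+ 2) (g := fun x => jet2 phi x ^+ 2)); last first.
  by move=> x; rewrite sub0r sqrrN.
by rewrite -/(h2_gap L U phi t); have := HY t2; lra.
Qed.

Section FixedTime.
Context (t : R) (t0 : 0 < t).
Let d0 : der setT (fun x => U 0 t x - phi x) (fun x => U 1 t x - phi1 x).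
Proof. exact: derD (flow_der F t0 (isT : (0 < 6)%N)) (derN (profile_der P)). Qed.
Let d1 : der setT (fun x => U 1 t x - phi1 x) (fun x => U 2 t x - jet2 phi x).
Proof. exact: derD (flow_der F t0 (isT : (1 < 6)%N)) (derN (der_jet1 P)). Qed.
Let d2 : der setT (fun x => U 2 t x - jet2 phi x) (fun x => U 3 t x - jet3 phi phi1 x).
Proof. exact: derD (flow_der F t0 (isT : (2 < 6)%N)) (derN (der_jet2 P)). Qed.
Let c2 := der_continuous d2.
Let c3 : cts (fun x => U 3 t x - jet3 phi phi1 x).
Proof.
have a := flow_cts F t0 (isT : (3 <= 6)%N); have b := der_continuous (der_jet3 P).
by cont.
Qed.
Let p0 : periodic (fun x => U 0 t x - phi x) L.
Proof. by move=> x; rewrite (flow_periodic F t0) (profile_periodic P). Qed.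
Let p1 : periodic (fun x => U 1 t x - phi1 x) L := der_periodic d0 p0.
Let w0 := l2 L (fun x => U 0 t x - phi x).
Let w1 := l2 L (fun x => U 1 t x - phi1 x).
Let w2 := l2 L (fun x => U 2 t x - jet2 phi x).
Let mean0 : J (fun x => U 0 t x - phi x) = 0.
Proof.
rewrite cintB ?(flow_mean F t0) ?(profile_mean P) ?subrr//.
exact: flow_cts F _ _ t0 _.
Qed.
Let mean1 : J (fun x => U 1 t x - phi1 x) = 0.
Proof. exact: (cint_der L0 d0 (der_continuous d1) p0). Qed.

Lemma gap_interpolation : J (fun x => (U 1 t x - phi1 x) ^+ 2) <= w0 * w2.
Proof. by rewrite -sqr_l2; exact: (l2_interpolation L0 d0 d1 c2 p0). Qed.

Lemma gap_sup0 x : (U 0 t x - phi x) ^+ 2 <= 3 * (w0 * (L * w2)).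
Proof.
apply: (le_trans (agmon L0 d0 d1 c2 p0 mean0 x)).
rewrite !ler_wpM2l ?l2_ge0//.
exact: (l2_poincare L0 d1 d2 c3 p1 mean1).
Qed.

(** Agmon for the derivative, squared so that [gap_interpolation] applies without a square root. *)
Lemma gap_sup1 x : (U 1 t x - phi1 x) ^+ 4 <= 9 * (w0 * w2 * w2 ^+ 2).
Proof.
have H := agmon L0 d1 d2 c3 p1 mean1 x; rewrite -/w1 -/w2 in H.
have h0 : 0 <= w1 * w2 by rewrite mulr_ge0 ?l2_ge0.
rewrite (_ : _ ^+ 4 = ((U 1 t x - phi1 x) ^+ 2) ^+ 2); last by ring.
apply: (@le_trans _ _ ((3 * (w1 * w2)) ^+ 2)).
  by rewrite ler_sqr ?nnegrE ?sqr_ge0// mulr_ge0.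
rewrite (_ : (3 * (w1 * w2)) ^+ 2 = 9 * (w1 ^+ 2 * w2 ^+ 2)); last by ring.
rewrite ler_wpM2l// ler_wpM2r ?sqr_ge0// sqr_l2; exact: gap_interpolation.
Qed.

End FixedTime.

(** The bridge between the L^2 norm of the drift estimates and the C^1 closeness demanded by
    [lojasiewicz_near], by interpolation with the H^2 bound. The two entries of [d] invert
    [gap_sup0] and [gap_sup1]. *)
Lemma l2_gap_small_C1 (B rho : R) : 0 < B -> 0 < rho -> exists2 eta : R, 0 < eta &
  forall t : R, 0 < t -> h2_gap L U phi t <= B -> l2_gap t <= eta -> forall x,
    `|U 0 t x - phi x| <= rho /\ `|U 1 t x - phi1 x| <= rho.
Proof.
move=> B0 rho0; pose b := Num.sqrt B.
have b0 : 0 < b by rewrite sqrtr_gt0.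
pose d := Num.min (rho ^+ 2 / (3 * (L * b))) (rho ^+ 4 / (9 * b ^+ 3)).
have d0 : 0 < d by rewrite lt_min !divr_gt0 ?exprn_gt0// !mulr_gt0// exprn_gt0.
exists (d ^+ 2); first by rewrite exprn_gt0.
move=> t t0 hB hd x.
set w0 := l2 L (fun x => U 0 t x - phi x); set w2 := l2 L (fun x => U 2 t x - jet2 phi x).
have w00 : 0 <= w0 by exact: l2_ge0. have w20 : 0 <= w2 by exact: l2_ge0.
have w0d : w0 <= d by rewrite -ler_sqr ?nnegrE ?(ltW d0)// sqr_l2.
have w2b : w2 <= b by rewrite /w2 /l2 ler_wsqrtr.
have h1 : d * (3 * (L * b)) <= rho ^+ 2.
  by rewrite -ler_pdivlMr ?mulr_gt0// ge_min lexx.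
have h2 : d * (9 * b ^+ 3) <= rho ^+ 4.
  by rewrite -ler_pdivlMr ?mulr_gt0 ?exprn_gt0// ge_min lexx orbT.
have r0 := ltW rho0.
split.
  rewrite -ler_sqr ?nnegrE// real_normK ?num_real// (le_trans (gap_sup0 t0 x))//.
  apply: (le_trans _ h1); rewrite mulrCA -/w0 -/w2.
  apply: ler_pM => //; first by rewrite mulr_ge0// mulr_ge0// ltW.
  by rewrite ler_wpM2l// ler_wpM2l// ltW.
rewrite -(@ler_pXn2r _ 4)// ?nnegrE// -normrX.
have -> : `|(U 1 t x - phi1 x) ^+ 4| = (U 1 t x - phi1 x) ^+ 4.
  by rewrite ger0_norm// exprn_even_ge0.
apply: (le_trans (gap_sup1 t0 x)); apply: (le_trans _ h2).
rewrite -/w0 -/w2 (_ : 9 * _ = w0 * (9 * w2 ^+ 3)); last by ring.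
apply: ler_pM => //; first by rewrite mulr_ge0// exprn_ge0.
by rewrite ler_wpM2l// lerXn2r ?nnegrE// ltW.
Qed.

Context (s : nat -> R) (s_ge : forall n, n%:R + 2 <= s n).
Hypothesis (Us : uniformly (fun n => U 0 (s n)) phi).
Hypothesis (phiE : energy L phi phi1 = e8).

Let s_ge2 n : 2 <= s n.
Proof. by have := s_ge n; have : 0 <= n%:R :> R by []; lra. Qed.

Lemma l2_gap_subsequence e T : 0 < e -> exists2 n, T <= s n & l2_gap (s n) <= e.
Proof.
move=> e0; have r0 : 0 < Num.sqrt (e / L) by rewrite sqrtr_gt0 divr_gt0.
have [N HN] := Us r0.
pose n := maxn N (Num.truncn `|T|).+1; exists n.
  have /andP[_ h] := truncn_itv (normr_ge0 T).
  have h2 : (Num.truncn `|T|).+1%:R <= n%:R :> R by rewrite ler_nat leq_maxr.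
  by have := s_ge n; have := ler_norm T; lra.
have c0 : cts (U 0 (s n)).
  by apply: (flow_cts F _ (isT : (0 <= 6)%N)); have := s_ge2 n; lra.
have -> : e = e / L * L by rewrite divfK// gt_eqF.
rewrite -cint_cst//; apply: le_cint => //; [by cont|by cont|move=> x _].
rewrite -[leRHS](@sqr_sqrtr _ (e / L)) ?divr_ge0 ?(ltW e0) ?(ltW L0)//.
rewrite -(real_normK (num_real (_ - _))) ler_sqr ?nnegrE ?(ltW r0)//.
by apply: HN; rewrite leq_maxl.
Qed.

(** The case where the energy attains its limit in finite time, set apart because sqrt (E - e8) must
    be differentiated in the other one. The energy is then constant, and [drift] with k arbitrarily
    large excludes any motion. *)
Lemma converges_stationary t0 : 2 <= t0 -> E t0 <= e8 -> forall e : R, 0 < e ->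
  exists T, forall t : R, T <= t -> l2_gap t <= e.
Proof.
move=> t02 Et0 e e0; exists t0 => t tt0.
have [n nt sn] := l2_gap_subsequence t (divr_gt0 e0 (ltr0n _ 4)).
have st : 2 <= t by lra.
(* Makes the elapsed-time term of [drift] at most e / 4; the summand 1 keeps k positive when s n =
   t. *)
pose k := (s n - t + 1) * (2 * Y) / (e / 4).
have k0 : 0 < k by rewrite !divr_gt0// mulr_gt0 ?mulr_gt0//; lra.
have := drift L0 F HY st nt k0.
have Et r : t0 <= r -> E r = e8.
  move=> rt; apply/eqP; rewrite eq_le e8E ?andbT; last by lra.
  by rewrite (le_trans _ Et0)// (flow_energy_nonincreasing L0 F)//; lra.
rewrite !Et//; last by lra.
rewrite subrr mulr0 add0r.
have -> : (s n - t) * (2 * Y / k) = (s n - t) / (s n - t + 1) * (e / 4).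
  by rewrite /k; field; rewrite !gt_eqF//; lra.
have h : (s n - t) / (s n - t + 1) <= 1 by rewrite ler_pdivrMr; lra.
have {h} := ler_wpM2r (ltW (divr_gt0 e0 (ltr0n _ 4))) h; rewrite mul1r => h1 h2.
have t0' : 0 < t by lra. have s0' : 0 < s n by lra.
have := cint_triangle (flow_cts F t0' (isT : (0 <= 6)%N)) (flow_cts F s0' (isT : (0 <= 6)%N)) cphi.
rewrite -/(l2_gap t) -/(l2_gap (s n)).
rewrite (eq_cint L (f := fun x => (U 0 t x - U 0 (s n) x) ^+ 2)
  (g := fun x => (U 0 (s n) x - U 0 t x) ^+ 2)); last by move=> x; ring.
by move: h1 h2; set a := J _; set b := _ / _ * (e / 4); lra.
Qed.

(* For fixed s < t, the functional (u t - u s, u r) + kap sqrt (E r - e8) is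
   nonincreasing in r on [s, t] by the Lojasiewicz inequality, as long as u r
   stays close to phi; at r = s, t this bounds |u t - u s|^2. *)
Lemma converges_nonstationary b x0 : amplitude phi phi1 b x0 ->
  (forall t : R, 2 <= t -> e8 < E t) -> forall e : R, 0 < e ->
  exists T, forall t : R, T <= t -> l2_gap t <= e.
Proof.
move=> A He8 e e0.
have [C [rho [C0 rho0 HL]]] := lojasiewicz_near L0 P A.
have [B B0 HB] := h2_gap_bounded.
have [eta eta0 Heta] := l2_gap_small_C1 B0 rho0.
pose d := Num.min e eta.
have d0 : 0 < d by rewrite lt_min e0.
have de : d <= e by rewrite ge_min lexx.
have deta : d <= eta by rewrite ge_min lexx orbT.
pose a := Num.sqrt (4 * Y); have a0 : 0 < a by rewrite sqrtr_gt0 mulr_gt0.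
pose c := Num.sqrt C; have c0 : 0 < c by rewrite sqrtr_gt0.
(* The square root decreases at the rate D / (2 sqrt (E - e8)) >= sqrt D / (2 c), so the factor 2 c
   a makes it dominate the pairing, which grows at most at the rate a sqrt D. *)
pose kap := 2 * c * a; have kap0 : 0 < kap by rewrite !mulr_gt0.
(* The drift from s0 will be at most d / 8, like the gap at s0, so the triangle inequality gives d /
   2 < d and closes the bootstrap. *)
have dk : 0 < (d / (8 * kap)) ^+ 2 by rewrite exprn_gt0// divr_gt0// mulr_gt0.
have [T T2 HT] := Ee8 dk.
have [n Tn sn] := l2_gap_subsequence T (divr_gt0 d0 (ltr0n _ 8)).
have s2 := s_ge2 n; set s0 := s n in Tn sn s2.
exists s0 => t st; apply: le_trans de; move: t st.
apply: bootstrap => [t st|| t st Hr].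
- by apply: l2_gap_continuous; lra.
- by apply: (le_lt_trans sn); lra.
have t2 : 2 <= t by lra.
have dp := der_pairing_difference L0 F s2 t2.
have dE := der_flow_energy L0 F.
pose V r := J (fun x => (U 0 t x - U 0 s0 x) * U 0 r x) + kap * Num.sqrt (E r - e8).
have dV : der [set r | 2 <= r] V (fun r => J (fun x => (U 2 t x - U 2 s0 x) * mu2 U r x)
    - kap * (2 * Num.sqrt (E r - e8))^-1 * D r).
  have sub : [set r : R | 2 <= r] `<=` [set r | 0 < r] by move=> r /= r2; lra.
  have dp' := der_sub dp sub; have dE' := der_sub dE sub.
  rewrite /V; eapply der_ext.
    eapply derD; first exact: dp'.
    eapply derM; first exact: der_cst.
    by eapply der_sqrt; [dert|move=> r /= r2; rewrite subr_gt0 He8].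
  by move=> r _ /=; ring.
have VV : V t <= V s0.
  apply: (der_nonincreasing st _ dV) => r /andP[sr rt] /=; first by lra.
  have r2 : 2 <= r by lra. have r0 : 0 < r by lra.
  have s00 : 0 < s0 by lra. have t0 : 0 < t by lra.
  have gr : l2_gap r <= eta by rewrite (le_trans _ deta)// Hr// sr rt.
  have near := Heta r r0 (HB r r2) gr.
  have := HL _ _ _ _ _ _ (flow_state F r0) (fun x => (near x).1) (fun x => (near x).2).
  rewrite phiE -/(E r) -/(D r) => HC.
  have D0 : 0 <= D r by exact: dissipation_ge0.
  set h := Num.sqrt (E r - e8); pose dd := Num.sqrt (D r).
  have h0 : 0 < h by rewrite sqrtr_gt0 subr_gt0 He8.
  have dd0 : 0 <= dd by exact: sqrtr_ge0.
  have hcd : h <= c * dd by rewrite /h /c /dd -sqrtrM ?(ltW C0)// ler_wsqrtr.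
  have dd2 : D r = dd ^+ 2 by rewrite sqr_sqrtr.
  have p2 := flow_cts F s00 (isT : (2 <= 6)%N); have q2 := flow_cts F t0 (isT : (2 <= 6)%N).
  have cz : cts (fun x => U 2 t x - U 2 s0 x) by cont.
  have JJ : J (fun x => (U 2 t x - U 2 s0 x) * mu2 U r x) <= a * dd.
    apply: (le_trans (ler_norm _)).
    apply: (le_trans (l2_CS L cz (der_continuous (der_mu2 F r0)))).
    apply: ler_wpM2r => //; rewrite /l2 ler_wsqrtr//.
    exact: (h2_difference_bound F HY s2 t2).
  rewrite subr_le0 (le_trans JJ)// dd2.
  rewrite (_ : kap * (2 * h)^-1 * dd ^+ 2 = a * dd * (c * dd / h)); last first.
    by rewrite /kap; field; rewrite gt_eqF.
  by rewrite ler_peMr ?mulr_ge0 ?(ltW a0)// ler_pdivlMr// mul1r.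
have h0 : kap * Num.sqrt (E s0 - e8) <= d / 8.
  have -> : d / 8 = kap * (d / (8 * kap)) by field; rewrite gt_eqF.
  rewrite ler_wpM2l ?(ltW kap0)//.
  rewrite -[leRHS]ger0_norm; last by rewrite divr_ge0 ?mulr_ge0 ?(ltW kap0)// ltW.
  by rewrite -sqrtr_sqr ler_wsqrtr// lerBlDl; exact: HT.
have h1 : 0 <= kap * Num.sqrt (E t - e8) by rewrite mulr_ge0 ?sqrtr_ge0// ltW.
have h2 := cint_difference_sqr F s2 t2.
have t0 : 0 < t by lra. have s00 : 0 < s0 by lra.
have := cint_triangle (flow_cts F t0 (isT : (0 <= 6)%N)) (flow_cts F s00 (isT : (0 <= 6)%N)) cphi.
rewrite -/(l2_gap t) -/(l2_gap s0) h2; move: VV; rewrite /V.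
by set A1 := J _; set A2 := J _; lra.
Qed.

End NonzeroLimit.

End Convergence.

(** * Convergence in H^2 *)

Section GapConvergence.
Context {R : realType} (L : R) (L0 : 0 < L).
Local Notation J := (cint L).
Context (U : nat -> R -> R -> R) (F : flow L U).
Local Notation D := (dissipation L U).
Local Notation E := (flow_energy L U).
Context (Y : R) (Y0 : 0 < Y) (HY : forall t : R, 2 <= t -> J (fun x => U 2 t x ^+ 2) <= Y).
Context (e8 : R) (e8E : forall t : R, 0 < t -> e8 <= E t).
Hypothesis Ee8 : forall e : R, 0 < e -> exists2 T : R, 2 <= T & forall t : R, T <= t -> E t <= e8 + e.

(** At a time of small dissipation less than one unit before t, [h2_gap_le] makes the gap small. Up
    to t it grows little: the gap is already bounded, the energy drop is small, and the H^1 gap is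
    small by interpolation. *)
Lemma h2_gap_converges phi phi1 : profile L phi phi1 0 ->
  (forall e : R, 0 < e -> exists T, forall t : R, T <= t -> l2_gap L U phi t <= e) ->
  forall e : R, 0 < e -> exists T, forall t : R, T <= t -> h2_gap L U phi t <= e.
Proof.
move=> P HN e e0.
have [N N0 HN'] := profile_jets_bounded L0 P.
have E0 := flow_energy_ge0 L U 1.
have M1 := sup_bound_ge1 L0 U.
pose M := sup_bound L U + N.
have M1' : 1 <= M by rewrite /M; lra.
have PM x : [/\ `|phi x| <= M, `|phi1 x| <= M,
    `|jet2 phi x| <= M & `|jet3 phi phi1 x| <= M].
  by have [h1 h2 h3 h4] := HN' x; split; rewrite /M; lra.
have UM t x : 1 <= t -> `|U 0 t x| <= M.
  by move=> t1; have := flow_sup_bound L0 F t1 x; rewrite /M; lra.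
have [B B0 HB] := h2_gap_bounded F Y0 HY P.
have [N2 N20 HN2] : exists2 N2 : R, 0 <= N2 & forall t : R, 1 <= t ->
    J (fun x => (U 1 t x - phi1 x) ^+ 2) <= N2.
  exists ((sup_bound L U + N) ^+ 2 * L + 4 * E 1 + 2 * N ^+ 2 * L).
    apply: addr_ge0; first apply: addr_ge0.
    - by apply: mulr_ge0; [exact: sqr_ge0|exact: ltW].
    - exact: mulr_ge0.
    - by apply: mulr_ge0; [apply: mulr_ge0 => //; exact: sqr_ge0|exact: ltW].
  move=> t t1.
  have := h1_gap_bound L0 F (der_continuous (profile_der P)) (der_continuous (der_jet1 P))
    (fun x => let: And4 h _ _ _ := HN' x in h) (fun x => let: And4 _ h _ _ := HN' x in h) N0 t1.
  apply: le_trans; rewrite /h1_gap lerDr; apply: cint_ge0 => x _; exact: sqr_ge0.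
have [C C0 HC] := h2_gap_differential_inequality L0 F P M1' PM N20.
pose b := Num.sqrt B; have b0 : 0 < b by rewrite sqrtr_gt0.
have h1small d : 0 < d -> exists T, forall t : R, T <= t -> h1_gap L U phi phi1 t <= d.
  move=> d0; pose q := Num.min (d / 2) (d / (2 * b)).
  have q0 : 0 < q by rewrite lt_min !divr_gt0// mulr_gt0.
  have [T1 HT1] := HN _ (divr_gt0 d0 (ltr0n _ 2)).
  have db : 0 < d / (2 * b) by rewrite divr_gt0// mulr_gt0.
  have db2 : 0 < (d / (2 * b)) ^+ 2 by rewrite exprn_gt0.
  have [T2 HT2] := HN _ db2.
  exists (`|T1| + `|T2| + 2) => t tT.
  have n1 := ler_norm T1; have n2 := ler_norm T2; have n3 := normr_ge0 T1; have n4 := normr_ge0 T2.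
  have t0 : 0 < t by lra. have t2 : 2 <= t by lra.
  rewrite /h1_gap [d]splitr lerD ?HT1//; first by lra.
  apply: (le_trans (gap_interpolation L0 F P t0)).
  have -> : d / 2 = d / (2 * b) * b by field; rewrite gt_eqF.
  apply: ler_pM; rewrite ?l2_ge0//; last by rewrite /l2 ler_wsqrtr// HB.
  rewrite -ler_sqr ?nnegrE ?l2_ge0 ?(ltW db)// sqr_l2; apply: HT2; lra.
pose K1 := L ^+ 2 * (3 * (L ^+ 2 + 36 * M ^+ 4)).
have K10 : 0 < K1.
  apply: mulr_gt0; first exact: exprn_gt0.
  apply: mulr_gt0 => //; apply: ltr_pwDl; first exact: exprn_gt0.
  by apply: mulr_ge0 => //; apply: exprn_ge0; exact: le_trans M1'.
pose K2 := C * (1 + B).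
have K20 : 0 < K2 by rewrite mulr_gt0// addr_gt0.
(* The initial gap 2 K1 d, the energy drop K2 d and the elapsed time K2 d add up to e / 2. *)
pose d := e / (4 * (K1 + K2)).
have K12 : 0 < K1 + K2 by exact: addr_gt0.
have d0 : 0 < d by rewrite divr_gt0// mulr_gt0.
have dE : K1 * d + K2 * d = e / 4 by rewrite /d; field; rewrite gt_eqF.
have [T1 HT1] := h1small d d0.
have [T2 T22 HT2] := Ee8 d0.
exists (`|T1| + T2 + 2) => t tT.
have n1 := ler_norm T1; have n2 := normr_ge0 T1.
have [|r [r1 r2 Dr]] := @good_time _ _ L0 _ F t; first by lra.
have t0 : 0 < t by lra. have r0 : 0 < r by lra.
have Drd : D r <= d.
  have h : E (t - 1) <= e8 + d by apply: HT2; lra.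
  by rewrite Dr; have := e8E t0; lra.
have yr : h2_gap L U phi r <= K1 * (d + d).
  have r1' : 1 <= r by lra.
  apply: (le_trans (h2_gap_le L0 F P M1' PM r0 (fun x => UM r x r1'))).
  rewrite mulrA -/K1; apply: ler_wpM2l; first exact: ltW.
  by apply: lerD => //; apply: HT1; lra.
have dy := der_h2_gap L0 F P; have dEn := der_flow_energy L0 F.
pose V (q : R) : R := h2_gap L U phi q + K2 * E q + q * - (K2 * d).
have dV : der [set q | 0 < q] V (fun q => h2_gap_rate L U phi phi1 q - K2 * D q - K2 * d).
  by rewrite /V; derr.
have VV : V t <= V r.
  apply: (der_nonincreasing (ltW r2) _ dV) => q /andP[rq qt] /=; first by lra.
  have q0 : 0 < q by lra. have q1 : 1 <= q by lra. have q2 : 2 <= q by lra.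
  have H := HC q q0 (fun x => UM q x q1) (HN2 q q1).
  have h1 : h1_gap L U phi phi1 q <= d by apply: HT1; lra.
  have h2 : (1 + h2_gap L U phi q) * (D q + h1_gap L U phi phi1 q) <= (1 + B) * (D q + d).
    apply: ler_pM.
    - by rewrite addr_ge0// h2_gap_ge0.
    - by rewrite addr_ge0 ?dissipation_ge0 ?h1_gap_ge0.
    - by rewrite lerD2l HB.
    - by rewrite lerD2l.
  have := ler_wpM2l (ltW C0) h2; rewrite [leRHS]mulrA -/K2.
  by move: H; set z := C * _; lra.
have Er : E r <= e8 + d by apply: HT2; lra.
have Et := e8E t0.
have hh : K2 * (E r - E t) <= K2 * d by rewrite ler_wpM2l ?(ltW K20)//; lra.
have h3 : (t - r) * (K2 * d) <= K2 * d.
  by apply: ler_piMl; [exact: mulr_ge0 (ltW K20) (ltW d0)|lra].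
by move: VV; rewrite /V; lra.
Qed.

End GapConvergence.

Lemma flow_converges (R : realType) (L : R) (U : nat -> R -> R -> R) : 0 < L ->
  flow L U -> exists phi phi1, [/\ profile L phi phi1 0,
    forall e : R, 0 < e -> exists T, forall t : R, T <= t -> l2_gap L U phi t <= e &
    forall e : R, 0 < e -> exists T, forall t : R, T <= t -> h2_gap L U phi t <= e].
Proof.
move=> L0 F.
have [Y Y0 HY] := flow_h2_bound L0 F.
have [e8 [e8E Ee8]] := flow_energy_limit L0 F.
have [phi [phi1 [c [s [P sge Us U1s Es]]]]] := limit_profile L0 F.
have phiE : energy L phi phi1 = e8.
  apply: (tends_unique Es) => e e0.
  have [T T2 HT] := Ee8 e e0.
  exists (Num.truncn T).+1 => n Tn.
  have /andP[_ h] := truncn_itv (le_trans (ler0n _ 2) T2).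
  have h2 : (Num.truncn T).+1%:R <= n%:R :> R by rewrite ler_nat.
  have h3 := sge n.
  have n0 : 0 <= n%:R :> R by [].
  have h5 : flow_energy L U (s n) <= e8 + e by apply: HT; lra.
  have h6 : e8 <= flow_energy L U (s n) by apply: e8E; lra.
  by rewrite ler_norml; apply/andP; split; lra.
have [c0 Pcases] := profile_classification L0 P; rewrite c0 in P.
exists phi, phi1.
have N0 : forall e : R, 0 < e -> exists T, forall t : R, T <= t -> l2_gap L U phi t <= e.
  case: Pcases => [ph0|[b [x0 A]]].
    have phiz : phi = fun=> 0 by apply/funext.
    have phi1z : phi1 = fun=> 0.
      apply/funext => x; apply: (@der_uniq _ setT phi _ (fun=> 0) x I (profile_der P)).
      by rewrite phiz; exact: der_cst.
    move=> e e0.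
    have [|T HT] := @converges_to_zero _ _ L0 _ F _ Y0 HY _ e8E Ee8 _ e e0.
      rewrite -phiE /energy phiz phi1z (eq_cint L (g := fun=> 4^-1)).
        by rewrite cint_cst// mulrC.
      by move=> x; rewrite expr0n/= sub0r sqrrN expr1n mulr0 add0r mulr1.
    exists T => t /HT; rewrite /l2_gap phiz.
    by under [in X in _ -> X]eq_cint do rewrite subr0.
  have [[t0 [t02 Et0]]|nst] := pselect (exists t0, 2 <= t0 /\ flow_energy L U t0 <= e8).
    exact: (converges_stationary L0 F Y0 HY e8E P sge Us t02 Et0).
  apply: (converges_nonstationary L0 F Y0 HY Ee8 P sge Us phiE A) => t t2.
  by rewrite ltNge; apply/negP => h; apply: nst; exists t.
split => //.
exact: (h2_gap_converges L0 F Y0 HY e8E Ee8 P N0).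
Qed.

(** * Weak derivatives on the torus *)

Section SmoothAlgebra.
Context {R : realType}.

Lemma der_derive1 (f g : R -> R) : der setT f g -> derive1 f = g.
Proof. by move=> fg; apply/funext => x; rewrite derive1E; have [_ ->] := fg x I. Qed.

(** The algebra generated by G. Once it contains the derivatives of its generators it is stable
    under differentiation, so its elements are smooth and no higher derivative has to be
    computed. *)
Inductive generated (G : (R -> R) -> Prop) : (R -> R) -> Prop :=
| generated_gen f : G f -> generated G f
| generated_cst c : generated G (fun=> c)
| generated_add f g : generated G f -> generated G g -> generated G (fun x => f x + g x)
| generated_mul f g : generated G f -> generated G g -> generated G (fun x => f x * g x).

Lemma generated_der G f :
  (forall g, G g -> exists2 g', generated G g' & der setT g g') ->
  generated G f -> exists2 f', generated G f' & der setT f f'.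
Proof.
move=> H; elim => {f} [f|c|f g Gf [f' Gf' ff'] Gg [g' Gg' gg']|f g Gf [f' Gf' ff'] Gg [g' Gg' gg']].
- exact: H.
- by exists (fun=> 0); [exact: generated_cst|exact: der_cst].
- by exists (fun x => f' x + g' x); [exact: generated_add|exact: derD].
- exists (fun x => f' x * g x + f x * g' x); last exact: derM.
  by apply: generated_add; exact: generated_mul.
Qed.

Lemma generated_smooth G f :
  (forall g, G g -> exists2 g', generated G g' & der setT g g') ->
  generated G f -> forall j x, derivable (derive1n j f) x 1.
Proof.
move=> H Gf; have Gj j : generated G (derive1n j f).
  elim: j => [|j IH]; first by rewrite derive1n0.
  by have [g Gg fg] := generated_der H IH; rewrite derive1nS (der_derive1 fg).
by move=> j x; have [g _ fg] := generated_der H (Gj j); have [] := fg x I.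
Qed.

End SmoothAlgebra.

(** * Test functions approximating the indicator of an arc *)

Section ArcTestFunctions.
Context {R : realType} (L : R) (L0 : 0 < L).

(* The product of two L-antiperiodic sines is L-periodic, positive on ]0, a[ and
   negative on ]a, L[. *)
Definition arc_profile (a y : R) : R := sin (pi / L * y) * sin (pi / L * (a - y)).
(** The logistic function of n times the profile, which tends to 1 on ]0, a[ and to 0 on ]a, L[. *)
Definition arc_test (a : R) (n : nat) (y : R) : R :=
  (1 + expR (- (n%:R * arc_profile a y)))^-1.

Lemma der_sin (f g : R -> R) : der setT f g ->
  der setT (fun x => sin (f x)) (fun x => cos (f x) * g x).
Proof.
by move=> fg; apply: (@der_comp _ setT setT sin f cos) => // x _; exact: is_derive_sin.
Qed.

Lemma der_cos (f g : R -> R) : der setT f g ->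
  der setT (fun x => cos (f x)) (fun x => - sin (f x) * g x).
Proof.
move=> fg; apply: (@der_comp _ setT setT cos f (fun x => - sin x)) => // x _.
exact: is_derive_cos.
Qed.

Let den_gt0 a n y : 0 < 1 + expR (- (n%:R * arc_profile a y)).
Proof. by rewrite addr_gt0// expR_gt0. Qed.

Let lin0 : der setT (fun y : R => pi / L * y) (fun=> pi / L).
Proof. by eapply der_ext; [eapply derM; [exact: der_cst|exact: der_id]|move=> x _ /=; ring]. Qed.
Let lin1 a : der setT (fun y : R => pi / L * (a - y)) (fun=> - (pi / L)).
Proof.
eapply der_ext; first eapply derM; first exact: der_cst.
  by eapply derD; [exact: der_cst|eapply derN; exact: der_id].
by move=> x _ /=; ring.
Qed.

(** [arc_test] is taken as a generator itself because the logistic function s satisfies s' = s (1 -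
    s), which keeps its derivative inside the algebra. *)
Definition arc_generator (a : R) (n : nat) (f : R -> R) : Prop :=
  [\/ f = (fun y => sin (pi / L * y)), f = (fun y => cos (pi / L * y)),
      f = (fun y => sin (pi / L * (a - y))) |
      f = (fun y => cos (pi / L * (a - y))) \/ f = arc_test a n].

Lemma arc_test_smooth a n j x : derivable (derive1n j (arc_test a n)) x 1.
Proof.
have g1 : generated (arc_generator a n) (fun y => sin (pi / L * y)).
  by apply: generated_gen; constructor 1.
have g2 : generated (arc_generator a n) (fun y => cos (pi / L * y)).
  by apply: generated_gen; constructor 2.
have g3 : generated (arc_generator a n) (fun y => sin (pi / L * (a - y))).
  by apply: generated_gen; constructor 3.
have g4 : generated (arc_generator a n) (fun y => cos (pi / L * (a - y))).
  by apply: generated_gen; constructor 4; left.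
have g5 : generated (arc_generator a n) (arc_test a n).
  by apply: generated_gen; constructor 4; right.
have gc := generated_cst (arc_generator a n).
have d1 := der_sin lin0; have d2 := der_cos lin0.
have d3 := der_sin (lin1 a); have d4 := der_cos (lin1 a).
apply: (@generated_smooth _ (arc_generator a n)) => // f [->|->|->|[->|->]].
- exists (fun y => cos (pi / L * y) * (pi / L)) => //.
  by apply: generated_mul.
- exists (fun y => (- 1 * sin (pi / L * y)) * (pi / L)).
    by do 2 apply: generated_mul => //.
  by apply: (der_ext d2) => y _; ring.
- exists (fun y => cos (pi / L * (a - y)) * - (pi / L)) => //.
  by apply: generated_mul.
- exists (fun y => (- 1 * sin (pi / L * (a - y))) * - (pi / L)).
    by do 2 apply: generated_mul => //.
  by apply: (der_ext d4) => y _; ring.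
- exists (fun y => (arc_test a n y * (1 + - 1 * arc_test a n y)) *
    (n%:R * (cos (pi / L * y) * (pi / L) * sin (pi / L * (a - y)) +
             sin (pi / L * y) * (cos (pi / L * (a - y)) * - (pi / L))))).
    repeat first [exact: g1|exact: g2|exact: g3|exact: g4|exact: g5|exact: gc
      |apply: generated_mul|apply: generated_add].
  have dp := derM d1 d3.
  eapply der_ext.
    eapply derV; last by move=> y _; rewrite gt_eqF//; exact: den_gt0.
    eapply derD; first exact: der_cst.
    eapply der_expR; eapply derN; eapply derM; first exact: der_cst.
    exact: dp.
  move=> y _ /=; rewrite /arc_test; have := den_gt0 a n y.
  rewrite /arc_profile; set e := expR _ => e0.
  by field; rewrite !gt_eqF.
Qed.

Lemma arc_test_periodic a n : periodic (arc_test a n) L.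
Proof.
move=> y; rewrite /arc_test /arc_profile.
have -> : pi / L * (y + L) = pi / L * y + pi by field; rewrite gt_eqF.
have -> : pi / L * (a - (y + L)) = - (pi / L * (y - a) + pi) by field; rewrite gt_eqF.
rewrite sinN !sinDpi mulrNN.
have -> : pi / L * (a - y) = - (pi / L * (y - a)) by ring.
by rewrite sinN.
Qed.

Lemma arc_test_bounds a n y : 0 <= arc_test a n y <= 1.
Proof.
rewrite /arc_test invr_ge0 (ltW (den_gt0 a n y))/= invf_le1//.
by rewrite lerDl expR_ge0.
Qed.

Lemma arc_test_function a n : test_function L (arc_test a n).
Proof. by split; [exact: arc_test_periodic|exact: arc_test_smooth]. Qed.

Lemma arc_profile_gt0 (a y : R) : 0 < y -> y < a -> a < L -> 0 < arc_profile a y.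
Proof.
move=> y0 ya aL; have pL : 0 < pi / L by rewrite divr_gt0// pi_gt0.
have pE : pi / L * L = pi by field; rewrite gt_eqF.
apply: mulr_gt0; apply: sin_gt0_pi; rewrite mulr_gt0 ?subr_gt0//=.
  by rewrite -[ltRHS]pE ltr_pM2l//; exact: lt_trans aL.
by rewrite -[ltRHS]pE ltr_pM2l//; lra.
Qed.

Lemma arc_profile_lt0 (a y : R) : 0 < a -> a < y -> y < L -> arc_profile a y < 0.
Proof.
move=> a0 ay yL; have y0 : 0 < y by exact: lt_trans ay.
have pL : 0 < pi / L by rewrite divr_gt0// pi_gt0.
have pE : pi / L * L = pi by field; rewrite gt_eqF.
have -> : arc_profile a y = - (sin (pi / L * y) * sin (pi / L * (y - a))).
  by rewrite /arc_profile -opprB mulrN sinN mulrN.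
rewrite oppr_lt0; apply: mulr_gt0; apply: sin_gt0_pi; rewrite mulr_gt0 ?subr_gt0//=.
- by rewrite -[ltRHS]pE ltr_pM2l.
- by rewrite -[ltRHS]pE ltr_pM2l//; lra.
Qed.

Lemma arc_test_cvg1 (a y : R) : 0 < arc_profile a y -> arc_test a n y @[n --> \oo] --> (1 : R).
Proof.
move=> p0.
have g0 : geometric (1 : R) (expR (- arc_profile a y)) @ \oo --> (0 : R).
  apply: cvg_geometric; rewrite ger0_norm ?expR_ge0// -expR0 ltr_expR.
  by rewrite oppr_lt0.
have den1 : (fun n => 1 + geometric (1 : R) (expR (- arc_profile a y)) n) @ \oo --> (1 + 0 : R).
  by apply: cvgD => //; exact: cvg_cst.
have := cvgV _ den1; rewrite addr0 oner_neq0 invr1 => /(_ _ isT).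
apply: cvg_trans; apply: near_eq_cvg; apply: nearW => n.
by rewrite /geometric/= mul1r /arc_test -(mulrN n%:R) expRM_natl.
Qed.

Lemma arc_test_cvg0 (a y : R) : arc_profile a y < 0 -> arc_test a n y @[n --> \oo] --> (0 : R).
Proof.
move=> p0.
have : geometric (1 : R) (expR (arc_profile a y)) @ \oo --> (0 : R).
  by apply: cvg_geometric; rewrite ger0_norm ?expR_ge0// -expR0 ltr_expR.
move=> /(squeeze_cvgr _ (cvg_cst 0)); apply; apply: nearW => n.
have /andP[-> _] /= := arc_test_bounds a n y.
rewrite /geometric/= mul1r -expRM_natl /arc_test.
rewrite -[leRHS]invrK -expRN lef_pV2 ?posrE ?expR_gt0//.
by rewrite lerDr ler01.
Qed.

End ArcTestFunctions.

(** * Integration on the torus *)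

Section Torus.
Context {R : realType} (L : R) (L0 : 0 < L).
Local Notation mu := (torus_measure L).
Local Notation lam := (@lebesgue_measure R).
Local Notation D := (`[0, L[%classic : set (measurableTypeR R)).
Local Notation J := (cint L).

Lemma torus_measureE (A : set R) : mu A = lam (A `&` D).
Proof. by []. Qed.

Lemma torus_ae (P : R -> Prop) : {ae lam, forall x, D x -> P x} -> {ae mu, forall x, P x}.
Proof.
move=> [A [mA A0 sA]]; exists (A `|` ~` D); split.
- by apply: measurableU => //; exact: measurableC.
- rewrite torus_measureE setIUl setICl setU0.
  apply/eqP; rewrite eq_le measure_ge0 andbT -A0.
  by apply: le_measure; rewrite ?inE//; exact: measurableI.
- move=> x /= nP; have [Dx|] := pselect (D x); last by right.
  by left; apply: sA => /= H; apply: nP; exact: H.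
Qed.

Lemma torus_integral (f : R -> \bar R) : measurable_fun setT f ->
  (\int[mu]_x f x = \int[lam]_(x in D) f x)%E.
Proof.
move=> mf; have mfD : measurable_fun setT (f \_ D).
  have [+ _] := @measurable_restrictT _ _ (measurableTypeR R) _ D f (measurable_itv _).
  by apply; apply: measurable_funTS.
transitivity (\int[mu]_x (f \_ D) x)%E.
  apply: ae_eq_integral => //.
  by apply: torus_ae; apply: aeW => x Dx _; rewrite patchE mem_set.
rewrite -integral_mkcond; apply: eq_measure_integral => A mA AD.
by rewrite torus_measureE setIidl.
Qed.

Lemma torus_integrableP (f : R -> \bar R) : measurable_fun setT f ->
  mu.-integrable setT f <-> lam.-integrable D f.
Proof.
move=> mf; have E : (\int[mu]_x `|f x| = \int[lam]_(x in D) `|f x|)%E.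
  by apply: torus_integral; exact: measurableT_comp.
split=> /integrableP[_ h]; apply/integrableP.
  by split; [exact: measurable_funTS|rewrite -E].
by split => //; rewrite E.
Qed.

Lemma cts_measurable (f : R -> R) : cts f -> measurable_fun setT f.
Proof. by move=> cf; apply: continuous_measurable_fun. Qed.

Lemma cts_torus_integrable (f : R -> R) : cts f -> mu.-integrable setT (EFin \o f).
Proof.
move=> cf; apply/torus_integrableP.
  by apply/measurable_EFinP; exact: cts_measurable.
apply: integrableS (continuous_integrable 0 L cf) => //.
by apply: subset_itvl; rewrite bnd_simp.
Qed.

Lemma cts_torus_integral (f : R -> R) : cts f -> \int[mu]_x f x = J f.
Proof.
move=> cf; rewrite /Rintegral torus_integral; last first.
  by apply/measurable_EFinP; exact: cts_measurable.
rewrite /cint -(@Rintegral_itv_bndo_bndc _ (BLeft 0) L)//.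
apply: integrableS (continuous_integrable 0 L cf) => //.
by apply: subset_itvl; rewrite bnd_simp.
Qed.

Lemma cts_L2_torus (f : R -> R) : cts f -> periodic f L -> L2_torus L f.
Proof.
move=> cf fL; split => //; rewrite inE; apply/andP; split.
  by rewrite inE/=; exact: cts_measurable.
rewrite inE /= /finite_norm unlock poweR_lty//.
have c2 : cts (fun x => f x ^+ 2) by cont.
have /integrableP[_] := cts_torus_integrable c2.
apply: le_lt_trans; rewrite le_eqVlt; apply/orP; left; apply/eqP.
by apply: eq_integral => x _ /=; rewrite normrX powR_mulrn.
Qed.

Lemma L2_torus_measurable (f : R -> R) : L2_torus L f -> measurable_fun setT f.
Proof. by move=> [_ /sub_Lfun_mfun]; rewrite inE. Qed.

Lemma L2_torusB (f g : R -> R) : L2_torus L f -> L2_torus L g ->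
  L2_torus L (fun x => f x - g x).
Proof.
move=> [fp f2] [gp g2]; split; first by move=> x; rewrite fp gp.
have p1 : (1 <= 2%:E :> \bar R)%E by rewrite lee_fin ler1n.
have [_ addc] := Lfun_addr_closed mu p1.
by have := addc _ _ f2 (Lfun_oppr_closed g2).
Qed.

Lemma L2_torus_integrable_mul (f g : R -> R) : L2_torus L f -> L2_torus L g ->
  mu.-integrable setT (EFin \o (fun x => f x * g x)).
Proof.
move=> [_ f2] [_ g2]; have [+ _] := @Lfun1_integrable _ _ _ mu (f \* g).
by apply; exact: Lfun2_mul_Lfun1.
Qed.

Lemma sqr_Lnorm2 (f : R -> R) : L2_torus L f ->
  fine ('N[mu]_2%:E[EFin \o f])%E ^+ 2 = \int[mu]_x (f x ^+ 2).
Proof.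
move=> [_ f2]; have fin : ('N[mu]_2%:E[EFin \o f] < +oo)%E.
  by have := sub_Lfun_finLfun f2; rewrite inE.
have N0 := Lnorm_ge0 mu 2%:E (EFin \o f).
rewrite /Rintegral.
have -> : (\int[mu]_x (f x ^+ 2)%:E = 'N[mu]_2%:E[EFin \o f] `^ 2)%E.
  rewrite powR_Lnorm//; apply: eq_integral => x _ /=.
  by rewrite powR_mulrn ?normr_ge0// real_normK ?num_real.
move: fin N0; case: ('N[mu]_2%:E[EFin \o f])%E => // r _; rewrite lee_fin => r0.
by rewrite poweR_EFin/= powR_mulrn.
Qed.

Lemma test_function_der (psi : R -> R) j : test_function L psi ->
  der setT (derive1n j psi) (derive1n j.+1 psi).
Proof.
move=> [_ H] x _; apply: DeriveDef; first exact: H.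
by rewrite derive1nS derive1E.
Qed.

Lemma test_function_cts (psi : R -> R) j : test_function L psi -> cts (derive1n j psi).
Proof. by move=> /(test_function_der j); exact: der_continuous. Qed.

Lemma test_function_periodic (psi : R -> R) j : test_function L psi ->
  periodic (derive1n j psi) L.
Proof.
move=> T; elim: j => [|j IH]; first by have [] := T.
exact: der_periodic (test_function_der j T) IH.
Qed.

Lemma test_function_L2 (psi : R -> R) j : test_function L psi -> L2_torus L (derive1n j psi).
Proof.
by move=> T; apply: cts_L2_torus; [exact: test_function_cts|exact: test_function_periodic].
Qed.

Section DuBoisReymond.
Context (h : R -> R) (h2 : L2_torus L h).
Hypothesis h0 : forall psi, test_function L psi -> \int[mu]_x (h x * psi x) = 0.

Let mh : measurable_fun setT h := L2_torus_measurable h2.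

Let ih : lam.-integrable D (EFin \o h).
Proof.
apply/torus_integrableP; first exact/measurable_EFinP.
have c1 : L2_torus L (fun=> 1).
  by apply: cts_L2_torus; [exact: continuous_cstr|].
have := L2_torus_integrable_mul h2 c1.
by under [fun x => h x * 1]eq_fun do rewrite mulr1.
Qed.

(** Dominated convergence along [arc_test L a n]. The null set {0, a} is removed first: there the
    profile vanishes and the test functions stay at 1 / 2. *)
Lemma vanishing_arc_integral (a : R) : 0 < a -> a < L ->
  (\int[lam]_(x in D) (h x * (x <= a)%R%:R)%:E = 0)%E.
Proof.
move=> a0 aL; pose N : set (measurableTypeR R) := [set 0; a].
have mN : measurable N by apply: measurableU.
have N0 : lam N = 0%E.
  apply/eqP; rewrite eq_le measure_ge0 andbT.
  by rewrite (le_trans (measureU2 _ _ _))//= !lebesgue_measure_set1 adde0.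
have mD : measurable D by [].
have marc n : measurable_fun setT (arc_test L a n).
  apply: cts_measurable; have := test_function_cts (j := 0%N) (arc_test_function L0 a n).
  by rewrite derive1n0.
have iarc n : lam.-integrable D (fun x => (h x * arc_test L a n x)%:E).
  apply/torus_integrableP.
    by apply/measurable_EFinP; exact: measurable_funM.
  apply: L2_torus_integrable_mul => //.
  by have := test_function_L2 0 (arc_test_function L0 a n).
have mind : measurable_fun setT (fun x : R => (x <= a)%R%:R : R).
  rewrite (_ : (fun x => _) = \1_(`]-oo, a]%classic)); first exact: measurable_indic.
  by apply/funext => x; rewrite indicE; congr (_ %:R); rewrite mem_setE in_itv.
have iind : lam.-integrable D (fun x => (h x * (x <= a)%R%:R)%:E).
  apply: (le_integrable mD _ _ ih).
    by apply/measurable_EFinP; apply: measurable_funTS; exact: measurable_funM.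
  move=> x _ /=; rewrite lee_fin normrM ler_piMr//.
  by case: (x <= a); rewrite ?normr1 ?normr0.
have z n : (\int[lam]_(x in D `\` N) (h x * arc_test L a n x)%:E = 0)%E.
  rewrite -(negligible_integral mN mD (iarc n) N0).
  have := h0 (arc_test_function L0 a n); rewrite /Rintegral torus_integral; last first.
    by apply/measurable_EFinP; exact: measurable_funM.
  by move=> E; rewrite -[LHS]fineK ?E//; exact: integrable_fin_num (iarc n).
rewrite (negligible_integral mN mD iind N0).
have mDN : measurable (D `\` N) by exact: measurableD.
have mf n : measurable_fun (D `\` N) (fun x => (h x * arc_test L a n x)%:E).
  apply/measurable_EFinP; apply: measurable_funTS; apply: measurable_funM => //.
  exact: marc.
have mg : measurable_fun (D `\` N) (fun x => (h x * (x <= a)%R%:R)%:E).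
  by apply/measurable_EFinP; apply: measurable_funTS; exact: measurable_funM.
have mh' : lam.-integrable (D `\` N) (fun x => `|h x|%:E).
  exact: integrableS mD mDN (@subDsetl _ _ _) (integrable_abse ih).
have cvf : {ae lam, forall x, (D `\` N) x ->
    (h x * arc_test L a n x)%:E @[n --> \oo] --> (h x * (x <= a)%R%:R)%:E}.
  apply: aeW => x; rewrite /= in_itv/= => -[/andP[x0 xL] nN].
  apply: cvg_EFin; first exact: nearW.
  apply: cvgMr; have [xa|ax|xa] := ltgtP x a.
  - apply: arc_test_cvg1 => //; apply: arc_profile_gt0 => //.
    by rewrite lt_neqAle x0 andbT; apply/eqP => x00; apply: nN; left.
  - by apply: arc_test_cvg0 => //; exact: arc_profile_lt0.
  - by exfalso; apply: nN; right.
have bf : {ae lam, forall x n, (D `\` N) x ->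
    (`|(h x * arc_test L a n x)%:E| <= `|h x|%:E)%E}.
  apply: aeW => x n _; rewrite lee_fin normrM ler_piMr//.
  by have /andP[t0 t1] := arc_test_bounds L a n x; rewrite ger0_norm.
have [_ _ cv] := dominated_convergence mDN mf mg cvf mh' bf.
move: cv; rewrite (_ : (fun n => _) = (fun=> 0%E)); last exact/funext.
by move=> /cvg_lim <-//; rewrite lim_cst.
Qed.

End DuBoisReymond.

End Torus.

(** * Uniqueness of weak derivatives and agreement with classical ones *)

Section WeakDerivative.
Context {R : realType} (L : R) (L0 : 0 < L).
Local Notation mu := (torus_measure L).
Local Notation lam := (@lebesgue_measure R).
Local Notation D := (`[0, L[%classic : set (measurableTypeR R)).
Local Notation J := (cint L).

(** The primitive of h vanishes on ]0, L[ by [vanishing_arc_integral], and by Lebesgue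
    differentiation its derivative is h almost everywhere. *)
Lemma du_bois_reymond (h : R -> R) : L2_torus L h ->
  (forall psi, test_function L psi -> \int[mu]_x (h x * psi x) = 0) ->
  h = 0 %[ae mu].
Proof.
move=> h2 h0; have mh := L2_torus_measurable h2.
have ih : lam.-integrable D (EFin \o h).
  have c1 : L2_torus L (fun=> 1) by apply: cts_L2_torus => //; exact: continuous_cstr.
  have := L2_torus_integrable_mul h2 c1.
  under [fun x => h x * 1]eq_fun do rewrite mulr1.
  have [+ _] := @torus_integrableP _ L (EFin \o h) ltac:(exact/measurable_EFinP).
  exact.
have ihD : lam.-integrable setT (EFin \o (h \_ D)).
  have [+ _] := @integrable_mkcond _ (measurableTypeR R) _ lam D (EFin \o h) (measurable_itv _).
  by move=> /(_ ih); rewrite restrict_EFin.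
have ihy y : lam.-integrable `]-oo, y] (EFin \o (h \_ D)).
  by apply: integrableS ihD => //; exact: measurable_itv.
have loc := integrable_locally_restrict (measurable_itv `[0, L[) ih.
have := FTC1Ny ihy loc; set F : R -> R := fun x => \int[lam]_(t in `]-oo, x]) _ => /= FD.
have F0 (y : R) : 0 < y -> y < L -> F y = 0.
  move=> y0 yL; rewrite /F /Rintegral -[RHS]/(fine 0%E) -(vanishing_arc_integral L0 h2 h0 y0 yL).
  congr fine; rewrite integral_mkcond [RHS]integral_mkcond; apply: eq_integral => x _.
  rewrite !patchE !mem_setE !in_itv/=.
  by case: (x <= y); case: (0 <= x < L) => //=; rewrite ?mulr0 ?mulr1.
apply: torus_ae; have N0 : lam.-negligible [set (0 : R)].
  by apply/negligibleP => //; exact: lebesgue_measure_set1.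
have nae : {ae lam, forall x : R, x != 0}.
  by apply: negligibleS N0 => x /= /negP; rewrite negbK => /eqP ->.
have aeF := ae_filter_ringOfSetsType lam.
move: FD nae; apply: filterS2 => x [_ Fx] x0 /=; rewrite in_itv/= => /andP[x_ge0 xL] _.
have {}x0 : 0 < x by rewrite lt_neqAle eq_sym x0.
have : is_derive x 1 F 0.
  apply: is_derive_eps => e e0; exists (Num.min x (L - x)).
    by rewrite lt_min x0 subr_gt0.
  move=> t _; rewrite lt_min => /andP[]; rewrite !ltr_norml => /andP[t1 _] /andP[_ t2].
  by rewrite !F0 ?subrr ?mul0r ?subr0 ?normr0 ?ltW//; lra.
move=> [_ dF]; move: Fx; rewrite derive1E dF patchE mem_set//.
by rewrite /= in_itv/= x_ge0.
Qed.

Lemma torus_ae_eqW (U V : pointedType) (f g : R -> U) (f' g' : R -> V) :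
  (forall x, f x = g x -> f' x = g' x) -> f = g %[ae mu] -> f' = g' %[ae mu].
Proof.
move=> fg [A [mA A0 sA]]; exists A; split => // x /= nfg; apply: sA => /= H.
by apply: nfg => _; apply: fg; exact: H.
Qed.

Lemma torus_integral_ae (f g : R -> R) : measurable_fun setT f -> measurable_fun setT g ->
  f = g %[ae mu] -> \int[mu]_x f x = \int[mu]_x g x.
Proof.
move=> mf mg fg; rewrite /Rintegral; congr fine; apply: ae_eq_integral => //.
- exact/measurable_EFinP.
- exact/measurable_EFinP.
- by move: fg; apply: torus_ae_eqW => x ->.
Qed.

Lemma is_weak_derivative_ae j (f f' g : R -> R) :
  measurable_fun setT f -> measurable_fun setT f' -> f = f' %[ae mu] ->
  is_weak_derivative L j f g -> is_weak_derivative L j f' g.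
Proof.
move=> mf mf' ff' fg psi T; rewrite -fg//.
have mpsi : measurable_fun setT (derive1n j psi).
  exact: L2_torus_measurable (test_function_L2 j T).
apply: torus_integral_ae; [exact: measurable_funM|exact: measurable_funM|].
by move: ff'; apply: torus_ae_eqW => x ->.
Qed.

Lemma is_weak_derivative_unique j (f g1 g2 : R -> R) : L2_torus L g1 -> L2_torus L g2 ->
  is_weak_derivative L j f g1 -> is_weak_derivative L j f g2 -> g1 = g2 %[ae mu].
Proof.
move=> g12 g22 fg1 fg2.
suff H : (fun x => g1 x - g2 x) = 0 %[ae mu].
  by move: H; apply: torus_ae_eqW => x /eqP; rewrite subr_eq0 => /eqP.
apply: du_bois_reymond; first exact: L2_torusB.
move=> psi T; under eq_Rintegral do rewrite mulrBl.
have psi2 : L2_torus L psi by have := test_function_L2 0 T.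
rewrite RintegralB//; [|exact: L2_torus_integrable_mul|exact: L2_torus_integrable_mul].
have sj : (-1) ^+ j != 0 :> R by rewrite signr_eq0.
apply/eqP; rewrite subr_eq0; apply/eqP/(mulfI sj).
by rewrite -fg1// -fg2.
Qed.

(** The arbitrary choice made in [weak_derivative] is harmless, since all candidates agree almost
    everywhere. *)
Lemma weak_derivativeP j (f g : R -> R) : L2_torus L g -> is_weak_derivative L j f g ->
  L2_torus L (weak_derivative L j f) /\ weak_derivative L j f = g %[ae mu].
Proof.
move=> g2 fg.
have [w2 fw] : [set g | L2_torus L g /\ is_weak_derivative L j f g] (weak_derivative L j f).
  exact: (@xgetI _ _ _ g).
by split => //; exact: is_weak_derivative_unique fg.
Qed.

Lemma sqr_Lnorm2_weak_derivative j (f g : R -> R) : L2_torus L g ->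
  is_weak_derivative L j f g ->
  fine ('N[mu]_2%:E[EFin \o weak_derivative L j f])%E ^+ 2 = \int[mu]_x (g x ^+ 2).
Proof.
move=> g2 fg; have [w2 wg] := weak_derivativeP g2 fg.
rewrite sqr_Lnorm2//; have mg := L2_torus_measurable g2.
have mw := L2_torus_measurable w2.
apply: torus_integral_ae; [exact: measurable_funX|exact: measurable_funX|].
by move: wg; apply: torus_ae_eqW => x ->.
Qed.

Lemma is_weak_derivative0 (f : R -> R) : is_weak_derivative L 0 f f.
Proof. by move=> psi _; rewrite expr0 mul1r. Qed.

Lemma jets_cts k (f : nat -> R -> R) : (forall i, (i < k)%N -> der setT (f i) (f i.+1)) ->
  cts (f k) -> forall i, (i <= k)%N -> cts (f i).
Proof.
by move=> fd cfk i; rewrite leq_eqVlt => /predU1P[->//|/fd]; exact: der_continuous.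
Qed.

Lemma jets_periodic k (f : nat -> R -> R) : (forall i, (i < k)%N -> der setT (f i) (f i.+1)) ->
  periodic (f 0%N) L -> forall i, (i <= k)%N -> periodic (f i) L.
Proof.
move=> fd p0; elim=> [//|i IH ik].
by apply: der_periodic (fd _ ik) (IH (ltnW ik)).
Qed.

Lemma classical_is_weak_derivative j (f : nat -> R -> R) :
  (forall i, (i < j)%N -> der setT (f i) (f i.+1)) -> cts (f j) -> periodic (f 0) L ->
  is_weak_derivative L j (f 0) (f j).
Proof.
move=> fd cfj p0 psi T.
have cf := jets_cts fd cfj; have pf := jets_periodic fd p0.
have cpsi i : cts (derive1n i psi) := @test_function_cts _ _ _ i T.
have ppsi i := test_function_periodic i T.
have E i k : (i + k = j)%N -> J (fun x => f 0%N x * derive1n j psi x) =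
    (-1) ^+ i * J (fun x => f i x * derive1n k psi x).
  elim: i k => [|i IH] k; first by rewrite add0n expr0 mul1r => ->.
  rewrite addSnnS => ikj; rewrite (IH _ ikj).
  have ij : (i < j)%N by rewrite -ikj addnS ltnS leq_addr.
  rewrite exprS mulN1r mulNr -mulrN; congr (_ * _).
  have dk := test_function_der k T.
  rewrite (cint_ibp L0 (fd i ij) dk) ?opprK//.
  - by apply: cf; exact: ij.
  - by apply: pf; exact: ltnW.
have cj := cpsi j; have c0 := cpsi 0%N; have cf0 := cf 0%N (leq0n j).
rewrite cts_torus_integral//; last by cont.
rewrite (E j 0%N) ?addn0// cts_torus_integral//.
by move: c0; rewrite derive1n0 => c0; cont.
Qed.

Lemma classical_Znorm k (f : nat -> R -> R) :
  (forall i, (i < k)%N -> der setT (f i) (f i.+1)) -> cts (f k) -> periodic (f 0) L ->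
  Znorm L k (f 0) = Num.sqrt (\sum_(j < k.+1) J (fun x => f j x ^+ 2)).
Proof.
move=> fd cfk p0; congr Num.sqrt; apply: eq_bigr => j _.
have jk : (j <= k)%N by rewrite -ltnS.
have cf := jets_cts fd cfk; have pf := jets_periodic fd p0.
rewrite (@sqr_Lnorm2_weak_derivative j _ (f j)).
- by have cj : cts (f j) := cf j jk; rewrite cts_torus_integral//; cont.
- by apply: cts_L2_torus; [exact: cf|exact: pf].
- apply: classical_is_weak_derivative => //; last exact: cf.
  by move=> i ij; apply: fd; exact: leq_trans jk.
Qed.

Lemma classical_Zspace k (f : nat -> R -> R) :
  (forall i, (i < k)%N -> der setT (f i) (f i.+1)) -> cts (f k) -> periodic (f 0) L ->
  J (f 0) = 0 -> Zspace L k (f 0).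
Proof.
move=> fd cfk p0 m0.
have cf := jets_cts fd cfk; have pf := jets_periodic fd p0.
split; first by apply: cts_L2_torus => //; exact: cf.
  by rewrite /zero_mean cts_torus_integral//; exact: cf.
move=> j jk; exists (f j); first by apply: cts_L2_torus; [exact: cf|exact: pf].
apply: classical_is_weak_derivative => //; last exact: cf.
by move=> i ij; apply: fd; exact: leq_trans jk.
Qed.

(** Functions equal almost everywhere have the same set of weak derivatives, so the element chosen
    from it is literally the same. *)
Lemma Znorm_ae k (f g : R -> R) : measurable_fun setT f -> measurable_fun setT g ->
  f = g %[ae mu] -> Znorm L k f = Znorm L k g.
Proof.
move=> mf mg fg; congr Num.sqrt; apply: eq_bigr => j _.
suff -> : weak_derivative L j f = weak_derivative L j g by [].
have gf : g = f %[ae mu] by move: fg; apply: torus_ae_eqW.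
rewrite /weak_derivative; congr xget; apply/funext => h; apply/propext.
by split=> -[h2 w]; split => //; [move: fg|move: gf] => /is_weak_derivative_ae; exact.
Qed.

Lemma sqr_le_Znorm k (f : R -> R) : L2_torus L f -> \int[mu]_x (f x ^+ 2) <= Znorm L k f ^+ 2.
Proof.
move=> f2; rewrite sqr_sqrtr; last by apply: sumr_ge0 => i _; exact: sqr_ge0.
rewrite big_ord_recl -(sqr_Lnorm2_weak_derivative f2 (is_weak_derivative0 f)) lerDl.
by apply: sumr_ge0 => i _; exact: sqr_ge0.
Qed.

Lemma torus_triangle (f g h : R -> R) : L2_torus L f -> L2_torus L g -> L2_torus L h ->
  \int[mu]_x ((f x - h x) ^+ 2) <=
  2 * \int[mu]_x ((f x - g x) ^+ 2) + 2 * \int[mu]_x ((g x - h x) ^+ 2).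
Proof.
move=> f2 g2 h2.
have isq u v : L2_torus L u -> L2_torus L v ->
    mu.-integrable setT (EFin \o (fun x => (u x - v x) ^+ 2)).
  by move=> u2 v2; apply: L2_torus_integrable_mul; exact: L2_torusB.
have ifg := isq _ _ f2 g2; have igh := isq _ _ g2 h2.
have ifg2 : mu.-integrable setT (EFin \o (fun x => 2 * (f x - g x) ^+ 2)).
  by have := integrableZl measurableT 2 ifg.
have igh2 : mu.-integrable setT (EFin \o (fun x => 2 * (g x - h x) ^+ 2)).
  by have := integrableZl measurableT 2 igh.
rewrite -!RintegralZl// -RintegralD//.
apply: le_Rintegral => //; [exact: isq|by have := integrableD measurableT ifg2 igh2|].
move=> x _; have := sqr_ge0 ((f x - g x) - (g x - h x)).
move: (f x) (g x) (h x) => a b c; lra.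
Qed.

Lemma torus_sqr_eq0 (f g : R -> R) : L2_torus L f -> L2_torus L g ->
  \int[mu]_x ((f x - g x) ^+ 2) = 0 -> f = g %[ae mu].
Proof.
move=> f2 g2 fg; have d2 := L2_torusB f2 g2.
have i2 : mu.-integrable setT (EFin \o (fun x => (f x - g x) ^+ 2)).
  exact: L2_torus_integrable_mul.
have /integrableP[m2 _] := i2.
have E : (\int[mu]_x `|((f x - g x) ^+ 2)%:E| = 0)%E.
  rewrite -[RHS]/(0%:E) -fg fineK; last exact: integrable_fin_num i2.
  by apply: eq_integral => x _; rewrite gee0_abs// lee_fin sqr_ge0.
have [+ _] := ae_eq_integral_abs mu measurableT m2.
move=> /(_ E); apply: torus_ae_eqW => x /= [] /eqP.
by rewrite sqrf_eq0 subr_eq0 => /eqP.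
Qed.

End WeakDerivative.

(** * Conclusion *)

Section Solution.
Context {R : realType} (L : R) (L0 : 0 < L).
Local Notation mu := (torus_measure L).
Local Notation J := (cint L).

Lemma derive1_W (v : R) : derive1 (@W R) v = v ^+ 3 - v.
Proof.
have dW : der setT (@W R) (fun v : R => v ^+ 3 - v).
  by unfold W; eapply der_ext; [dert|move=> x _ /=; field].
by rewrite (der_derive1 dW).
Qed.

Lemma der_laplacian (f f1 f2 : R -> R) : der setT f f1 -> der setT f1 f2 -> laplacian f = f2.
Proof.
by move=> d d1; rewrite /laplacian derive1nS derive1n1 (der_derive1 d) (der_derive1 d1).
Qed.

Lemma laplacian_mu0 (U : nat -> R -> R -> R) t :
  (forall j, (j < 6)%N -> der setT (U j t) (U j.+1 t)) ->
  laplacian (laplacian (mu0 U t)) = mu4 U t.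
Proof.
move=> d; have [d0 d1 d2] : [/\ der setT (U 0 t) (U 1 t), der setT (U 1 t) (U 2 t) &
    der setT (U 2 t) (U 3 t)] by split; exact: d.
have [d3 d4 d5] : [/\ der setT (U 3 t) (U 4 t), der setT (U 4 t) (U 5 t) &
    der setT (U 5 t) (U 6 t)] by split; exact: d.
have m0 : der setT (mu0 U t) (mu1 U t) by unfold mu0, mu1; derr.
have m1 : der setT (mu1 U t) (mu2 U t) by unfold mu1, mu2; derr.
have m2 : der setT (mu2 U t) (mu3 U t) by unfold mu2, mu3; derr.
have m3 : der setT (mu3 U t) (mu4 U t) by unfold mu3, mu4; derr.
by rewrite (der_laplacian m0 m1) (der_laplacian m2 m3).
Qed.

Section SolutionFlow.
Context (k : nat) (u0 : R -> R) (u : R -> R -> R) (S : is_solution L k u0 u).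
Local Notation U := (fun (j : nat) (t : R) => derive1n j (u t)).

Let U_der t j : 0 < t -> (j < 6)%N -> der setT (U j t) (U j.+1 t).
Proof.
move=> t0 j6 x _; apply: DeriveDef; first exact: (sol_derivable_x S).
by rewrite derive1nS derive1E.
Qed.

Let U_periodic t : 0 < t -> periodic (U 0%N t) L.
Proof. by move=> t0; have [[]] := sol_space S (ltW t0). Qed.

Lemma solution_flow : flow L U.
Proof.
split => //.
- by move=> t j t0 j6 x; exact: (sol_continuous_x S).
- move=> x t /= t0; apply: DeriveDef; first exact: (sol_derivable_t S).
  rewrite -derive1E -[LHS]/(derive1 (fun s => u s x) t) (sol_equation S)//.
  have -> : (fun y => laplacian (u t) y - derive1 (@W R) (u t y)) = mu0 U t.
    by apply/funext => y; rewrite derive1_W.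
  have d j (j6 : (j < 6)%N) : der setT (U j t) (U j.+1 t) := @U_der t j t0 j6.
  by rewrite (laplacian_mu0 d).
- move=> t t0; have [_ + _] := sol_space S (ltW t0).
  rewrite /zero_mean cts_torus_integral//.
  exact: der_continuous (U_der (j := 0) t0 isT).
Qed.

End SolutionFlow.

Section Profile.
Context (phi phi1 : R -> R) (P : profile L phi phi1 0).
Let d0 := profile_der P.
Let d1 := der_jet1 P.
Let d2 := der_jet2 P.

Let profile_generator (f : R -> R) : Prop := f = phi \/ f = phi1.

(** The algebra generated by phi and phi' is stable under differentiation because phi'' = phi^3 -
    phi. *)
Lemma profile_smooth j x : derivable (derive1n j phi) x 1.
Proof.
have g0 : generated profile_generator phi by apply: generated_gen; left.
have g1 : generated profile_generator phi1 by apply: generated_gen; right.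
apply: (generated_smooth _ g0) => f [->|->]; first by exists phi1.
exists (fun x => phi x * (phi x * phi x) + (-1) * phi x).
  by do !apply: generated_mul || apply: generated_add || apply: generated_cst || exact: g0.
by apply: (der_ext d1) => y _; rewrite /jet2; ring.
Qed.

Lemma profile_steady_state : steady_state L phi.
Proof.
have c0 := der_continuous d0.
split; first exact: profile_periodic P.
- by rewrite /zero_mean cts_torus_integral//; exact: profile_mean P.
- by move=> j x _; exact: profile_smooth.
move=> x; rewrite (_ : (fun y => _) = (fun=> 0)); last first.
  by apply/funext => y; rewrite (der_laplacian d0 d1) derive1_W /jet2 subrr.
have z : der setT (fun=> 0 : R) (fun=> 0 : R) := der_cst 0.
by rewrite !(der_laplacian z z).
Qed.

Lemma profile_Zspace k : (k <= 2)%N -> Zspace L k phi.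
Proof.
move=> k2; pose f (j : nat) := nth phi [:: phi; phi1; jet2 phi] j.
have c0 := der_continuous d0; have c1 := der_continuous d1; have c2 := der_continuous d2.
apply: (@classical_Zspace _ L L0 k f).
- by move=> [|[|[|i]]] // /leq_trans => /(_ _ k2).
- by case: k k2 => [|[|[|]]].
- exact: profile_periodic P.
- exact: profile_mean P.
Qed.

End Profile.

(** For k = 2 the norm also contains the first derivative, which interpolation bounds by the gaps of
    orders 0 and 2. *)
Lemma gap_Znorm k (U : nat -> R -> R -> R) (phi phi1 : R -> R) (t : R) :
  k = 0%N \/ k = 2%N -> flow L U -> profile L phi phi1 0 -> 0 < t ->
  Znorm L k (fun x => U 0%N t x - phi x) ^+ 2 <= 2 * (l2_gap L U phi t + h2_gap L U phi t).
Proof.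
move=> hk F P t0; have G0 : 0 <= l2_gap L U phi t by apply: cint_ge0 => x _; exact: sqr_ge0.
have G2 : 0 <= h2_gap L U phi t by apply: cint_ge0 => x _; exact: sqr_ge0.
pose w (j : nat) x := U j t x - nth phi [:: phi; phi1; jet2 phi] j x.
have wd i : (i < 3)%N -> der setT (U i t) (U i.+1 t).
  by move=> i3; apply: (flow_der F) => //; exact: ltn_trans i3 _.
have wd0 : der setT (w 0%N) (w 1%N) by exact: derD (wd 0%N _) (derN (profile_der P)).
have wd1 : der setT (w 1%N) (w 2%N) by exact: derD (wd 1%N _) (derN (der_jet1 P)).
have wd2 : der setT (w 2%N) (fun x => U 3 t x - jet3 phi phi1 x).
  by exact: derD (wd 2%N _) (derN (der_jet2 P)).
have wp : periodic (w 0%N) L.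
  by move=> x; rewrite /w (flow_periodic F t0) /= (profile_periodic P).
rewrite -[(fun x => _)]/(w 0%N) (classical_Znorm L0 (k := k))//; last 2 first.
- by case: hk => -> // -[|[|]].
- by case: hk => ->; [exact: der_continuous wd0|exact: der_continuous wd2].
rewrite sqr_sqrtr; last first.
  by apply: sumr_ge0 => i _; apply: cint_ge0 => x _; exact: sqr_ge0.
have J0 : J (fun x => w 0%N x ^+ 2) = l2_gap L U phi t by [].
have J2 : J (fun x => w 2%N x ^+ 2) = h2_gap L U phi t by [].
have J1 : J (fun x => w 1%N x ^+ 2) <= l2_gap L U phi t + h2_gap L U phi t.
  apply: (le_trans (gap_interpolation L0 F P t0)).
  rewrite /l2_gap /h2_gap -!sqr_l2.
  set a := l2 _ _; set b := l2 _ _.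
  by have := sqr_ge0 (a - b); have := sqr_ge0 (a + b); lra.
case: hk => ->; rewrite !big_ord_recl big_ord0 /= ?J0; first by lra.
by rewrite J2; lra.
Qed.

Section Convergence.
Context (k : nat) (hk : k = 0%N \/ k = 2%N).
Context (u0 : R -> R) (u : R -> R -> R) (S : is_solution L k u0 u).
Context (phi phi1 : R -> R) (P : profile L phi phi1 0).
Local Notation U := (fun (j : nat) (t : R) => derive1n j (u t)).
Hypothesis l2_cvg : forall e : R, 0 < e -> exists T, forall t : R, T <= t -> l2_gap L U phi t <= e.
Hypothesis h2_cvg : forall e : R, 0 < e -> exists T, forall t : R, T <= t -> h2_gap L U phi t <= e.

Lemma solution_Znorm_cvg : Znorm L k (fun x => u t x - phi x) @[t --> +oo] --> (0 : R).
Proof.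
apply/cvgrPdist_le => e e0; have e4 : 0 < e ^+ 2 / 4 by rewrite divr_gt0// exprn_gt0.
have [T1 H1] := l2_cvg e4; have [T2 H2] := h2_cvg e4.
exists (Num.max 0 (Num.max T1 T2)); split; first exact: num_real.
move=> t; rewrite !gt_max => /and3P[t0 t1 t2]; rewrite sub0r normrN ger0_norm ?sqrtr_ge0//.
rewrite -(@ler_pXn2r _ 2)// ?nnegrE ?sqrtr_ge0 ?(ltW e0)//.
have G : Znorm L k (fun x => u t x - phi x) ^+ 2 <= _ := gap_Znorm hk (solution_flow S) P t0.
apply: (le_trans G).
by have := H1 t (ltW t1); have := H2 t (ltW t2); lra.
Qed.

(** The limit set consists of functions rather than classes, so the singleton becomes an
    almost-everywhere class. Integer times show that each representative is a limit; conversely,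
    limits in L^2 are unique almost everywhere. *)
Lemma omega_limit_profile :
  omega_limit L k u = [set psi | Zspace L k psi /\ psi = phi %[ae mu]].
Proof.
have k2 : (k <= 2)%N by case: hk => ->.
have [phi2 _ _] := profile_Zspace P k2.
have mphi := L2_torus_measurable phi2.
apply/seteqP; split=> psi [Zpsi]; have [psi2 _ _] := Zpsi; last first.
  move=> psiphi; split => //; exists (fun m => m%:R); split => [//||].
    exact: cvgr_idn.
  have -> : (fun m => Znorm L k (fun x => u m%:R x - psi x)) =
      (fun t => Znorm L k (fun x => u t x - phi x)) \o (fun m => m%:R).
    apply/funext => m /=; have [um2 _ _] := sol_space S (ler0n R m).
    apply: Znorm_ae; [exact: L2_torus_measurable (L2_torusB um2 psi2)
      |exact: L2_torus_measurable (L2_torusB um2 phi2)|].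
    by move: psiphi; apply: torus_ae_eqW => x ->.
  exact: cvg_comp cvgr_idn solution_Znorm_cvg.
move=> [tm [tm0 tmoo cv]]; split => //; apply: torus_sqr_eq0 => //.
apply/eqP; rewrite eq_le; apply/andP; split; last first.
  by apply: Rintegral_ge0 => x _; exact: sqr_ge0.
apply/ler_addgt0Pl => e e0; rewrite addr0.
pose d := Num.sqrt (e / 4); have d0 : 0 < d by rewrite sqrtr_gt0 divr_gt0.
have dE : d ^+ 2 = e / 4 by rewrite sqr_sqrtr// divr_ge0// ltW.
have cv' : Znorm L k (fun x => u (tm m) x - phi x) @[m --> \oo] --> (0 : R).
  exact: cvg_comp tmoo solution_Znorm_cvg.
move/cvgrPdist_le : cv => /(_ d d0) [M1 _ H1].
move/cvgrPdist_le : cv' => /(_ d d0) [M2 _ H2].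
pose m := maxn M1 M2; have [um2 _ _] := sol_space S (tm0 m).
have sq (f : R -> R) : `|0 - Znorm L k f| <= d -> Znorm L k f ^+ 2 <= e / 4.
  rewrite sub0r normrN ger0_norm ?sqrtr_ge0// => fd.
  by rewrite -dE ler_pXn2r// ?nnegrE ?sqrtr_ge0.
have s1 := sq _ (H1 m (leq_maxl _ _)); have s2 := sq _ (H2 m (leq_maxr _ _)).
have q1 := sqr_le_Znorm L0 k (L2_torusB um2 psi2).
have q2 := sqr_le_Znorm L0 k (L2_torusB um2 phi2).
apply: (le_trans (torus_triangle psi2 um2 phi2)).
under [X in 2 * X + _]eq_Rintegral do rewrite -sqrrN opprB.
have -> : e = 2 * (e / 4) + 2 * (e / 4) by field.
by rewrite lerD// ler_wpM2l//; [exact: le_trans s1|exact: le_trans s2].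
Qed.

End Convergence.

End Solution.

Theorem corollary4p6 (R : realType) (L : R) (hL : 0 < L)
    (k : nat) (hk : k = 0%N \/ k = 2%N)
    (u0 : R -> R) (hu0 : Zspace L k u0)
    (u : R -> R -> R) (hu : is_solution L k u0 u) :
  exists phi : R -> R,
    [/\ steady_state L phi,
        Zspace L k phi,
        omega_limit L k u =
          [set psi | Zspace L k psi /\ psi = phi %[ae torus_measure L]] &
        Znorm L k (fun x => u t x - phi x) @[t --> +oo] --> (0 : R)].
Proof.
have [phi [phi1 [P l2_cvg h2_cvg]]] := flow_converges hL (solution_flow hu).
exists phi; split.
- exact: profile_steady_state P.
- by apply: (profile_Zspace hL P); case: hk => ->.
- exact: (omega_limit_profile hL hk hu P l2_cvg h2_cvg).
- exact: (solution_Znorm_cvg hL hk hu P l2_cvg h2_cvg).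
Qed.
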